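(* Let $n\ge1$ be a fixed integer, let $V$ be a vector space over $\mathbb{C}(q)$ and let $\{H_i\}_{i\ge1}$, $\{E_i\}_{i\ge1}$, $\{P_i\}_{i\ge1}$ be commuting linear operators on $V$ satisfying the relations of $h_i$, $e_i$ and $p_i$ in the ring $\Lambda$ of symmetric functions. Let $(v_\lambda)$ be a set of vectors in $V$ indexed by all partitions. Consider the conditions, each required for all $k\ge1$ and all partitions $\lambda$: (Pieri) $H_kv_\lambda=\sum_\mu\mathcal{K}_{\mu/\lambda,k}(q)\,v_\mu$; (dual-Pieri) $E_kv_\lambda=\sum_\mu\mathcal{L}_{\mu/\lambda,k}(q)\,v_\mu$; (Murnagham–Nakayama) $P_kv_\lambda=\sum_\mu\mathcal{X}_k^{\mu/\lambda}(q)\,v_\mu$. If one of these three holds, then all three hold. The same is true for the lowering versions: if $\{H_i^\perp\}$, $\{E_i^\perp\}$, $\{P_i^\perp\}$ are commuting linear operators on $V$ satisfying the relations of $h_i,e_i,p_i$ in $\Lambda$, and one of $H^\perp_kv_\lambda=\sum_\mu\mathcal{K}_{\lambda/\mu,k}(q)v_\mu$, $E^\perp_kv_\lambda=\sum_\mu\mathcal{L}_{\lambda/\mu,k}(q)v_\mu$, $P^\perp_kv_\lambda=\sum_\mu\mathcal{X}_k^{\lambda/\mu}(q)v_\mu$ holds for all $k\geq 1$ and all $\lambda$, then all three hold.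
   Context: $h_i,e_i,p_i\in\Lambda$ are the homogeneous, elementary and power sum symmetric functions; ''satisfying the relations of $h_i,e_i,p_i$'' means there is an algebra homomorphism from $\Lambda$ to $\mathrm{End}(V)$ sending $h_i\mapsto H_i$, $e_i\mapsto E_i$, $p_i\mapsto P_i$. Ribbons: fix $n\ge1$. Partitions are identified with their Young diagrams (first row on top); ''connected'' means connected through edges. A ribbon is a connected skew shape with exactly $n$ squares containing no $2\times 2$ square; its spin is its number of rows minus 1. The spin $s(T)$ of a shape tiled by ribbons is the sum of the spins of its ribbons. A horizontal ribbon strip is a skew shape tiled by ribbons such that the topright-most square of every ribbon touches the northern edge of the shape; such a tiling is unique if it exists. A vertical ribbon strip is the conjugate (transpose) of a horizontal ribbon strip. $\mathcal{K}_{\mu/\lambda,k}(q)=q^{s(T)}$ if $\mu/\lambda$ is a horizontal ribbon strip $T$ with $k$ ribbons, and $0$ otherwise; $\mathcal{L}_{\mu/\lambda,k}(q)=q^{s(T)}$ if $\mu/\lambda$ is a vertical ribbon strip $T$ with $k$ ribbons (with spin that of its tiling as a vertical ribbon strip), and $0$ otherwise. Border ribbon strips: a border ribbon strip $T$ is a connected skew shape $\lambda/\mu$ with a distinguished tiling by disjoint non-empty horizontal ribbon strips $T_1,\ldots,T_a$ (each with its ribbon tiling) such that $T_{+i}=\bigcup_{j\le i}T_j$ is a valid skew shape (of the form $\lambda^i/\mu$) for every $i$, $T_1$ is connected, and for each $i\ge2$ and each connected component $C$ of $T_i$: (1) the set of ribbons $C\cup T_{i-1}$ does not form a horizontal ribbon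 strip; (2) no proper sub horizontal ribbon strip $C'$ of $C$ (a subset of its ribbons) which can be added to the shape $T_{+(i-1)}$ (i.e. $T_{+(i-1)}\cup C'$ is a valid skew shape) has property (1), i.e. $C'\cup T_{i-1}$ forms a horizontal ribbon strip. The height $h(T_i)$ is the number of connected components of $T_i$, the height of $T$ is $h(T)=\left(\sum_i h(T_i)\right)-1$, its spin $s(T)$ is the sum of the spins of all its ribbons, and its size is its total number of ribbons. For $k\ge1$, $\mathcal{X}^{\mu/\lambda}_k(q)=\sum_T(-1)^{h(T)}q^{s(T)}$, summed over all border ribbon strips $T$ of shape $\mu/\lambda$ and size $k$ ($0$ if there are none). *)

(* Defs.v *)
From HB Require Import structures.
From mathcomp Require Import all_boot all_order all_algebra.
From mathcomp Require Import finmap mpoly complex.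
From mathcomp Require Import boolp classical_sets fsbigop reals.

Set Implicit Arguments.
Unset Strict Implicit.
Unset Printing Implicit Defensive.

Import GRing.Theory.

Record intpart := IntPart {
  intpart_seq :> seq nat;
  _ : sorted geq intpart_seq && (0 \notin intpart_seq) }.

HB.instance Definition _ := [isSub for intpart_seq].
HB.instance Definition _ := [Choice of intpart by <:].

Local Open Scope fset_scope.

(* A square is (row, column), both counted from 0, row 0 on top. *)
Definition square : Type := (nat * nat)%type.

Definition diagram (lam : intpart) : {fset square} :=
  [fset x in [seq (i, j) | i <- iota 0 (size lam), j <- iota 0 (nth 0 lam i)]].

Definition contained (lam mu : intpart) : bool := diagram lam `<=` diagram mu.

Definition skew_shape (mu lam : intpart) : {fset square} :=
  diagram mu `\` diagram lam.

Definition is_skew_shape_over (lam : intpart) (S : {fset square}) : Prop :=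
  exists2 mu : intpart, contained lam mu & S = skew_shape mu lam.

Definition is_skew_shape (S : {fset square}) : Prop :=
  exists lam : intpart, is_skew_shape_over lam S.

Definition adjacent : rel square := fun x y =>
  (x.1 == y.1) && ((x.2 == y.2.+1) || (y.2 == x.2.+1)) ||
  (x.2 == y.2) && ((x.1 == y.1.+1) || (y.1 == x.1.+1)).

Definition edge_connected (S : {fset square}) : Prop :=
  forall x y, x \in S -> y \in S ->
  exists p : seq square,
    [/\ path adjacent x p, last x p = y & {subset p <= S}].

Definition is_ribbon (n : nat) (R : {fset square}) : Prop :=
  [/\ is_skew_shape R, edge_connected R, #|` R| = n &
      forall i j, ~ [/\ (i, j) \in R, (i.+1, j) \in R,
                        (i, j.+1) \in R & (i.+1, j.+1) \in R]].

Definition spin (R : {fset square}) : nat := #|` [fset x.1 | x in R]|.-1.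

Definition toprightmost (R : {fset square}) (x : square) : Prop :=
  x \in R /\ forall y, y \in R -> (x.1 <= y.1) && (y.2 <= x.2).

Definition ribbons : Type := {fset {fset square}}.

Definition squares (T : ribbons) : {fset square} :=
  \big[fsetU/fset0]_(R <- T) R.

Definition spins (T : ribbons) : nat := \sum_(R <- T) spin R.

Definition touches_north (T : ribbons) : Prop :=
  forall R i j, R \in T -> toprightmost R (i.+1, j) -> (i, j) \notin squares T.

(* T forms a horizontal ribbon strip; its shape is [squares T]. *)
Definition horizontal_strip (n : nat) (T : ribbons) : Prop :=
  [/\ forall R, R \in T -> is_ribbon n R,
      forall R R', R \in T -> R' \in T -> R != R' -> [disjoint R & R'],
      is_skew_shape (squares T) &
      touches_north T].

Definition transpose (S : {fset square}) : {fset square} :=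
  [fset (x.2, x.1) | x in S].

Definition vertical_strip (n : nat) (T : ribbons) : Prop :=
  horizontal_strip n [fset transpose R | R in T].

Definition has_shape (mu lam : intpart) (T : ribbons) : Prop :=
  contained lam mu /\ squares T = skew_shape mu lam.

Definition horizontal_strip_of (n : nat) (mu lam : intpart) (k : nat)
    (T : ribbons) : Prop :=
  [/\ horizontal_strip n T, has_shape mu lam T & #|` T| = k].

Definition vertical_strip_of (n : nat) (mu lam : intpart) (k : nat)
    (T : ribbons) : Prop :=
  [/\ vertical_strip n T, has_shape mu lam T & #|` T| = k].

(* The connected components of the shape of a horizontal ribbon strip T, each
   given by the set of ribbons of T that it consists of (ribbons being
   connected, a component is a union of ribbons). *)
Definition is_component (T C : ribbons) : Prop :=
  [/\ C `<=` T, C != fset0, edge_connected (squares C) &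
      forall C' : ribbons, C `<=` C' -> C' `<=` T ->
        edge_connected (squares C') -> C' = C].

Definition ncomponents (T : ribbons) : nat :=
  #|` [fset C in fpowerset T | `[< is_component T C >]]|.

Definition all_squares (Ts : seq ribbons) : {fset square} :=
  \big[fsetU/fset0]_(T <- Ts) squares T.

(* Ts = [:: T_1; ...; T_a]: the strip T_i is [nth fset0 Ts i.-1], and T_{+i} is
   [all_squares (take i Ts)]. In the last clause, A and B are the consecutive
   strips T_i and T_(i+1), for i >= 1. *)
Definition border_ribbon_strip (n : nat) (mu lam : intpart)
    (Ts : seq ribbons) : Prop :=
  let T := nth fset0 Ts in
  [/\ [/\ contained lam mu, all_squares Ts = skew_shape mu lam,
          edge_connected (skew_shape mu lam) & (0 < size Ts)%N],
      forall i, (i < size Ts)%N -> horizontal_strip n (T i) /\ T i != fset0,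
      forall i j, (i < j < size Ts)%N ->
        [disjoint squares (T i) & squares (T j)],
      (forall i, (0 < i <= size Ts)%N ->
        is_skew_shape_over lam (all_squares (take i Ts))) /\
      edge_connected (squares (T 0%N)) &
      forall i, (0 < i < size Ts)%N ->
        let A := T i.-1 in let B := T i in
        forall C, is_component B C ->
          ~ horizontal_strip n (C `|` A) /\
          (forall C' : ribbons, C' `<` C -> horizontal_strip n C' ->
             is_skew_shape_over lam (all_squares (take i Ts) `|` squares C') ->
             horizontal_strip n (C' `|` A))].

Definition border_size (Ts : seq ribbons) : nat := \sum_(T <- Ts) #|` T|.

Definition border_spin (Ts : seq ribbons) : nat := \sum_(T <- Ts) spins T.

Definition border_height (Ts : seq ribbons) : nat :=
  (\sum_(T <- Ts) ncomponents T).-1.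

Local Open Scope ring_scope.

(* The tiling T of a horizontal (resp. vertical) ribbon strip is unique, so the
   one chosen by [cid] here and in [Lcoef] is the only one. For [Lcoef], [spins]
   counts the rows of the ribbons of T itself, not of their transposes. *)
Definition Kcoef (F : fieldType) (q : F) (n : nat)
    (mu lam : intpart) (k : nat) : F :=
  if pselect (exists T, horizontal_strip_of n mu lam k T) is left exT
  then q ^+ spins (projT1 (cid exT)) else 0.

Definition Lcoef (F : fieldType) (q : F) (n : nat)
    (mu lam : intpart) (k : nat) : F :=
  if pselect (exists T, vertical_strip_of n mu lam k T) is left exT
  then q ^+ spins (projT1 (cid exT)) else 0.

(* The border ribbon strips of a given shape and size are finitely many, and the
   sum over the classical set runs over all of them. *)
Definition Xcoef (F : fieldType) (q : F) (n : nat)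
    (mu lam : intpart) (k : nat) : F :=
  \sum_(Ts \in [set Ts | border_ribbon_strip n mu lam Ts /\
                         border_size Ts = k]%classic)
    (-1) ^+ border_height Ts * q ^+ border_spin Ts.

Definition polyfam (F : fieldType) : Type := forall m : nat, {mpoly F[m]}.

Definition kill_last (F : fieldType) (m : nat) (f : {mpoly F[m.+1]}) :
    {mpoly F[m]} :=
  f \mPo [tuple (if unlift ord_max i is Some j then 'X_j else 0) | i < m.+1].

(* A symmetric function over F is a family of symmetric polynomials f_m in m
   variables, of bounded degree, such that f_m is f_(m+1) with its last
   variable set to 0. Its algebra operations are those of the polynomials
   f_m. *)
Definition in_Lambda (F : fieldType) (f : polyfam F) : Prop :=
  [/\ forall m, f m \is symmetric,
      forall m, kill_last (f m.+1) = f m &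
      exists d : nat, forall m, (msize (f m) <= d)%N].

Definition h_sym (F : fieldType) (i : nat) : polyfam F :=
  fun m => \sum_(u : 'X_{1..m < i.+1} | mdeg u == i) 'X_[u].

Definition e_sym (F : fieldType) (i : nat) : polyfam F :=
  fun m => mesym m F i.

Definition p_sym (F : fieldType) (i : nat) : polyfam F :=
  fun m => \sum_(j < m) 'X_j ^+ i.

(* phi restricts to a (unital) algebra homomorphism from Lambda to End(V). *)
Definition Lambda_morphism (F : fieldType) (V : lmodType F)
    (phi : polyfam F -> {linear V -> V}) : Prop :=
  [/\ forall x, phi (fun m => 1) x = x,
      forall f g, in_Lambda f -> in_Lambda g ->
        forall x, phi (fun m => f m + g m) x = phi f x + phi g x,
      forall (c : F) f, in_Lambda f ->
        forall x, phi (fun m => c *: f m) x = c *: phi f x &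
      forall f g, in_Lambda f -> in_Lambda g ->
        forall x, phi (fun m => f m * g m) x = phi f (phi g x)].

Definition satisfy_hep_relations (F : fieldType) (V : lmodType F)
    (H E P : nat -> {linear V -> V}) : Prop :=
  exists2 phi : polyfam F -> {linear V -> V}, Lambda_morphism phi &
    forall i, (0 < i)%N ->
      [/\ phi (h_sym F i) =1 H i, phi (e_sym F i) =1 E i &
          phi (p_sym F i) =1 P i].

Definition commuting_operators (F : fieldType) (V : lmodType F)
    (H E P : nat -> {linear V -> V}) : Prop :=
  let family (A : {linear V -> V}) :=
    exists2 i, (0 < i)%N & [\/ A = H i, A = E i | A = P i] in
  forall A B, family A -> family B -> forall x, A (B x) = B (A x).

(* For R : realType, R[i] is the field of complex numbers. *)
Definition Cq (R : realType) : fieldType := {fraction {poly R[i]}}.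

Definition qvar (R : realType) : Cq R := tofrac 'X.

(* The sums over mu are over all partitions; only finitely many terms are
   nonzero, and [\sum_(mu \in setT)] sums over these. *)
Definition raising_rule (F : fieldType) (V : lmodType F)
    (c : intpart -> intpart -> nat -> F) (v : intpart -> V)
    (A : nat -> {linear V -> V}) : Prop :=
  forall (k : nat) (lam : intpart), (0 < k)%N ->
    A k (v lam) = \sum_(mu \in setT) c mu lam k *: v mu.

Definition lowering_rule (F : fieldType) (V : lmodType F)
    (c : intpart -> intpart -> nat -> F) (v : intpart -> V)
    (A : nat -> {linear V -> V}) : Prop :=
  forall (k : nat) (lam : intpart), (0 < k)%N ->
    A k (v lam) = \sum_(mu \in setT) c lam mu k *: v mu.

(* Main.v *)
Require Import Defs.
From mathcomp Require Import all_boot all_order all_algebra.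
From mathcomp Require Import reals.
From mathcomp Require Import finmap boolp classical_sets fsbigop.
From mathcomp Require Import zify.

(** A ribbon has one square on each diagonal of content in (c - n, c], where c,
    its tip, is the content of its topright-most square.  A horizontal strip is
    built by adding its ribbons by increasing tips, a vertical strip by
    decreasing tips.  So in a pair formed by a horizontal strip and a vertical
    strip above it, the ribbon with the largest tip can be moved from one to the
    other, which gives sum_i (-1)^i L_i K_(m-i) = 0 for m > 0.

    A ribbon of tip c added above a strip A does not form a horizontal strip with
    A exactly when A has a ribbon with tip in (c, c + n]: we say that A covers c.
    The conditions on consecutive strips T_(i-1), T_i of a border ribbon strip
    say that in each component of T_i, exactly the ribbon with the largest tip is
    covered by T_(i-1).  Let Z(A) be the signed sum over the ways to continue a
    border ribbon strip after A, and H^A the sum over the horizontal strips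
    without ribbons covered by A.  Then H Z(A) = H^A: merging the next strip B with
    the horizontal strip applied last, whenever B does not cover a ribbon of it,
    gives a horizontal strip D in which B is a union of prefixes of components,
    and the choices of B in D cancel if A covers a ribbon of D.  Summing
    over the connected first strip A, which is a nonempty prefix of a component of
    D, each D is counted once for each of its ribbons, so m K_m = sum_k K_(m-k) X_k.

    Together with sum_i (-1)^i e_i h_(m-i) = 0 and m h_m = sum_k p_k h_(m-k), these
    identities determine each of the three families of rules from the others. *)

Set Implicit Arguments.
Unset Strict Implicit.
Unset Printing Implicit Defensive.

Import GRing.Theory Order.TTheory Num.Theory.
Local Open Scope fset_scope.

(** * Partitions as order ideals of squares *)

(** The coefficients X are never evaluated on their own, only after composition with H, where the
    recursion over the strips collapses. The cancellation behind this sees a strip only through its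
    tips: they are distinct, and coverage, components and sub-strips are all expressed by
    differences of tips. It is proved for an arbitrary predicate [cov] on tips and used twice:
    coverage by A gives H Z(A) = H^A, and equality with a single tip shows that each ribbon of D is
    the ribbon of largest tip of one first strip. Intermediate shapes are order ideals of squares
    rather than partitions, so that strips can be cut and merged freely; [young_part] and
    [diagram_inj] lead back to partitions. In the final induction the unknown operator of degree m
    occurs in a relation once, next to operators that are already known. Its coefficient must be
    invertible; it is a sign or 1, except that recovering H_m from the P_k needs -m, which is where
    characteristic zero enters. *)

Definition young (D : {fset square}) : Prop :=
  forall i j i' j', (i' <= i)%N -> (j' <= j)%N -> (i, j) \in D -> (i', j') \in D.

Lemma in_diagram (lam : intpart) i j :
  ((i, j) \in diagram lam) = (j < nth 0 lam i)%N.
Proof.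
rewrite /diagram in_fset; apply/allpairsPdep/idP => /=.
  by case=> i' [j' [_]]; rewrite mem_iota => /andP[_ ?] [-> ->].
move=> ltj; exists i, j; split=> //; rewrite mem_iota //=.
by case: ltnP => // lei; rewrite nth_default in ltj.
Qed.

Lemma young_diagram (lam : intpart) : young (diagram lam).
Proof.
move=> i j i' j' lei lej; rewrite !in_diagram => ltj.
apply: (leq_ltn_trans lej); apply: (leq_trans ltj).
have [lt|] := ltnP i (size lam); last by move=> ?; rewrite nth_default.
have /andP[so _] := valP lam.
have tr : transitive geq by move=> a b c /= h1 h2; apply: leq_trans h2 h1.
by apply: (sorted_leq_nth tr leqnn 0 so) => //; rewrite !inE; apply: leq_ltn_trans lt.
Qed.

Lemma fset_square_bound (D : {fset square}) :
  exists N, forall x, x \in D -> (x.1 < N)%N && (x.2 < N)%N.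
Proof.
exists (\sum_(x <- D) (x.1 + x.2)).+1 => x xD.
have : (x.1 + x.2 <= \sum_(y <- D) (y.1 + y.2))%N.
  by rewrite (big_rem x) //= leq_addr.
by lia.
Qed.

Lemma young_part (D : {fset square}) : young D -> exists lam, diagram lam = D.
Proof.
move=> yD; have [N bN] := fset_square_bound D.
have exr i : exists j, (i, j) \notin D.
  by exists N; apply/negP => /bN /=; lia.
pose r i := ex_minn (exr i).
have rP i j : ((i, j) \in D) = (j < r i)%N.
  rewrite /r; case: ex_minnP => m nm mm; apply/idP/idP => [ij|lt].
    by rewrite ltnNge; apply/negP => le; move: nm; rewrite (yD i j i m).
  by case: (boolP ((i, j) \in D)) => // /mm; rewrite leqNgt lt.
have exM : exists i, (i, 0%N) \notin D.
  by exists N; apply/negP => /bN /=; lia.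
pose M := ex_minn exM.
have MP i : (0 < r i)%N = (i < M)%N.
  rewrite -rP /M; case: ex_minnP => m nm mm; apply/idP/idP => [ij|lt].
    by rewrite ltnNge; apply/negP => le; move: nm; rewrite (yD i 0 m 0).
  by case: (boolP ((i, 0%N) \in D)) => // /mm; rewrite leqNgt lt.
have so : sorted geq (mkseq r M) && (0%N \notin mkseq r M).
  apply/andP; split.
    apply/(sortedP 0%N) => i; rewrite size_mkseq => lt.
    rewrite !nth_mkseq ?(ltnW lt) //=.
    rewrite leqNgt; apply/negP; rewrite -rP => h.
    by have := yD _ _ i (r i) (leqnSn _) (leqnn _) h; rewrite rP ltnn.
  apply/mapP => -[i]; rewrite mem_iota /= add0n -MP => lt e.
  by rewrite -e in lt.
exists (IntPart so); apply/fsetP => -[i j]; rewrite in_diagram /= rP.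
have [lt|ge] := ltnP i M; first by rewrite nth_mkseq.
rewrite nth_default ?size_mkseq //; move: ge; rewrite leqNgt -MP -leqNgt.
by rewrite leqn0 => /eqP ->.
Qed.

Lemma diagram_inj : injective diagram.
Proof.
move=> l m /fsetP e; apply/val_inj/(@eq_from_nth _ 0%N) => /=.
  have key (l' m' : intpart) : diagram l' =i diagram m' -> (size l' <= size m')%N.
    move: l' m' => {e}l {}m e; rewrite leqNgt; apply/negP => lt.
    have := e (size m, 0%N); rewrite !in_diagram [X in _ = (_ < X)%N]nth_default //.
    have /andP[_] := valP l; move/(nthP 0%N) => h.
    rewrite ltnn => /negbT; rewrite -leqNgt leqn0 => /eqP e0.
    by case: h; exists (size m).
  by apply/eqP; rewrite eqn_leq !key.
move=> i _; apply/eqP; rewrite eqn_leq.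
have := e (i, nth 0 l i); have := e (i, nth 0 m i).
by rewrite !in_diagram !ltnn => a b; apply/andP; split; rewrite leqNgt ?a -?b.
Qed.

(** * Skew shapes, contents and connectedness *)

Lemma is_skew_shapeP (S : {fset square}) : is_skew_shape S <->
  exists L M, [/\ young L, young M, L `<=` M & S = M `\` L].
Proof.
split=> [[lam [mu sub ->]]|[L [M [/young_part[l <-] /young_part[m <-] sub ->]]]].
  by exists (diagram lam), (diagram mu); split=> //; exact: young_diagram.
by exists l; exists m.
Qed.

Lemma is_skew_shape_overP lam (S : {fset square}) : is_skew_shape_over lam S <->
  [disjoint diagram lam & S] /\ young (diagram lam `|` S).
Proof.
split=> [[mu sub ->]|[dis /young_part[m em]]].
  split; first by apply/fdisjointP => x xl; rewrite /skew_shape in_fsetD xl.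
  by rewrite /skew_shape fsetUDl fsetDv fsetD0 (fsetUidPr _ _ sub); apply: young_diagram.
exists m; first by rewrite /contained em fsubsetUl.
rewrite /skew_shape em; apply/fsetP => x; rewrite in_fsetD in_fsetU.
by have := fdisjointP dis x; case: (x \in diagram lam) => //= /(_ isT)/negbTE ->.
Qed.

(** Convexity for the componentwise order, the only consequence of being a skew shape that
    connectedness and ribbons require. *)
Definition convex (S : {fset square}) : Prop :=
  forall i1 j1 i j i2 j2, (i1, j1) \in S -> (i2, j2) \in S ->
  (i1 <= i <= i2)%N -> (j1 <= j <= j2)%N -> (i, j) \in S.

Lemma skew_convex S : is_skew_shape S -> convex S.
Proof.
move=> /is_skew_shapeP[L [M [yL yM sub ->]]] i1 j1 i j i2 j2.
rewrite !in_fsetD => /andP[n1 _] /andP[_ m2] /andP[le1 le2] /andP[le3 le4].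
rewrite (yM _ _ _ _ le2 le4 m2) andbT; apply: contra n1.
exact: (yL _ _ _ _ le1 le3).
Qed.

Definition content (x : square) : int := (x.2 : int) - (x.1 : int).

(** As in [edge_connected], the path lists only the squares after x, so x itself need not lie in S;
    hence the extra hypothesis of [linked_sym]. *)
Definition linked (S : {fset square}) (x y : square) : Prop :=
  exists p : seq square, [/\ path adjacent x p, last x p = y & {subset p <= S}].

Lemma linked_refl S x : linked S x x. Proof. by exists [::]. Qed.

Lemma linked_trans S x y z : linked S x y -> linked S y z -> linked S x z.
Proof.
move=> [p [p1 p2 p3]] [q [q1 q2 q3]]; exists (p ++ q).
rewrite cat_path p1 last_cat p2 q1 q2; split=> // t.
by rewrite mem_cat => /orP[/p3|/q3].
Qed.

Lemma linked_subset S S' x y : S `<=` S' -> linked S x y -> linked S' x y.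
Proof.
by move=> /fsubsetP sub [p [p1 p2 p3]]; exists p; split=> // t /p3 /sub.
Qed.

Lemma adjacent_sym : symmetric adjacent.
Proof. by move=> [a b] [c d]; rewrite /adjacent /=; lia. Qed.

Lemma linked_sym S x y : x \in S -> linked S x y -> linked S y x.
Proof.
move=> xS [p [p1 p2 p3]]; exists (rev (belast x p)); split.
- rewrite -p2 rev_path; rewrite (eq_path (e' := adjacent)) //.
  by move=> a b /=; rewrite adjacent_sym.
- by case: p p1 p2 p3 => //= a p _ _ _; rewrite rev_cons last_rcons.
- move=> t; rewrite mem_rev => /mem_belast; rewrite inE => /orP[/eqP->//|].
  exact: p3.
Qed.

Lemma linked_step S x y : adjacent x y -> y \in S -> linked S x y.
Proof.
move=> a yS; exists [:: y]; rewrite /= a; split=> //.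
by move=> t; rewrite inE => /eqP ->.
Qed.

Lemma linked_right S i j k :
  (forall l, (l <= k)%N -> (i, j + l)%N \in S) -> linked S (i, j) (i, (j + k)%N).
Proof.
elim: k => [|k IH] h; first by rewrite addn0; exact: linked_refl.
apply: (linked_trans (IH _)) => [l le|]; first by apply: h; lia.
by apply: linked_step (h _ (leqnn _)); rewrite /adjacent /=; lia.
Qed.

Lemma linked_down S i j k :
  (forall l, (l <= k)%N -> (i + l, j)%N \in S) -> linked S (i, j) ((i + k)%N, j).
Proof.
elim: k => [|k IH] h; first by rewrite addn0; exact: linked_refl.
apply: (linked_trans (IH _)) => [l le|]; first by apply: h; lia.
by apply: linked_step (h _ (leqnn _)); rewrite /adjacent /=; lia.
Qed.

Lemma linked_le S i j i' j' : convex S -> (i, j) \in S -> (i', j') \in S ->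
  (i <= i')%N -> (j <= j')%N -> linked S (i, j) (i', j').
Proof.
move=> cS x y le1 le2.
apply: (@linked_trans _ _ (i, j')).
  rewrite -[X in linked _ _ (_, X)](subnKC le2).
  by apply: linked_right => l le; apply: cS x y _ _; lia.
rewrite -[X in linked _ _ (X, _)](subnKC le1).
by apply: linked_down => l le; apply: cS x y _ _; lia.
Qed.

(* Squares of contents c and c or c + 1 are comparable componentwise, so the
   rectangle that they span lies in S. *)
Lemma linked_content S x y : convex S -> x \in S -> y \in S ->
  (content x <= content y <= content x + 1)%R -> linked S x y.
Proof.
move: x y => [a b] [c d] cS xS yS; rewrite /content /= => h.
have [le1|lt1] := leqP a c; first by apply: linked_le => //; lia.
by apply: linked_sym => //; apply: linked_le => //; lia.
Qed.

(** From any square one climbs through contents c, c + 1, ..., m by [linked_content], and two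
    squares of content m are linked by the same lemma. *)
Lemma interval_connected (S : {fset square}) (m : int) : convex S ->
  (forall x, x \in S -> (content x <= m)%R) ->
  (forall x, x \in S -> (content x < m)%R ->
     exists2 y, y \in S & content y = (content x + 1)%R) ->
  edge_connected S.
Proof.
move=> cS hm hS.
have key k x : x \in S -> content x = (m - k%:R)%R ->
    exists2 y, y \in S /\ content y = m & linked S x y.
  elim: k x => [|k IH] x xS cx.
    by exists x; [split=> //; lia | exact: linked_refl].
  have [|y yS cy] := hS x xS; first by lia.
  have [|z zS lz] := IH y yS; first by lia.
  exists z => //; apply: linked_trans lz; apply: linked_content => //; lia.
have {}key x : x \in S -> exists2 y, y \in S /\ content y = m & linked S x y.
  move=> xS; apply: (key `|m - content x|%N) => //.
  by have := hm x xS; lia.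
move=> x y xS yS.
have [x' [x'S cx'] lx] := key x xS; have [y' [y'S cy'] ly] := key y yS.
apply: (linked_trans lx); apply: (@linked_trans _ _ y').
  by apply: linked_content => //; lia.
exact: linked_sym.
Qed.

Lemma adjacent_content x y : adjacent x y ->
  content y = (content x + 1)%R \/ content y = (content x - 1)%R.
Proof. by move: x y => [a b] [c d]; rewrite /adjacent /content /=; lia. Qed.

(** A discrete intermediate value property: the content changes by 1 at each step of a path. *)
Lemma connected_content (S : {fset square}) x y (c : int) : edge_connected S ->
  x \in S -> y \in S -> (content x <= c <= content y)%R ->
  exists2 z, z \in S & content z = c.
Proof.
move=> eS xS yS; have [p [p1 p2 p3]] := eS x y xS yS.
elim: p x xS p1 p2 p3 => [|a p IH] x xS /=.
  by move=> _ -> _ h; exists y => //; lia.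
move=> /andP[axa pp] lp sp h.
have aS : a \in S by apply: sp; rewrite inE eqxx.
have [e|ne] := eqVneq (content x) c; first by exists x.
apply: (IH a) => //; first by move=> t tp; apply: sp; rewrite inE tp orbT.
by have := adjacent_content axa; lia.
Qed.

Lemma edge_connectedU (S S' : {fset square}) x : edge_connected S ->
  edge_connected S' -> x \in S -> x \in S' -> edge_connected (S `|` S').
Proof.
move=> cS cS' xS xS'.
have key y : y \in S `|` S' -> linked (S `|` S') x y.
  rewrite in_fsetU => /orP[yS|yS'].
    exact: (linked_subset (fsubsetUl _ _) (cS x y xS yS)).
  exact: (linked_subset (fsubsetUr _ _) (cS' x y xS' yS')).
move=> y z yS zS; apply: (@linked_trans _ _ x); last exact: key.
by apply: linked_sym; [rewrite in_fsetU xS | exact: key].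
Qed.

(** * Ribbons *)

Lemma fset_argmax (T : choiceType) (f : T -> int) (A : {fset T}) :
  A != fset0 -> exists2 x, x \in A & forall y, y \in A -> (f y <= f x)%R.
Proof.
have [k] := ubnP #|` A|; elim: k A => // k IH A lek A0.
have [x xA] := fset0Pn _ A0.
have [e|ne] := eqVneq (A `\ x) fset0.
  exists x => // y yA; have [->//|nyx] := eqVneq y x.
  by have := in_fset0 y; rewrite -e in_fsetD1 nyx yA.
have [|y] := IH (A `\ x) _ ne; first by have := cardfsD1 x A; rewrite xA; lia.
rewrite in_fsetD1 => /andP[_ yA] my.
have [le|lt] := leP (f x) (f y).
  by exists y => // z zA; have [->//|nz] := eqVneq z x; apply: my; rewrite in_fsetD1 nz.
exists x => // z zA; have [->//|nz] := eqVneq z x.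
by apply: le_trans (ltW lt); apply: my; rewrite in_fsetD1 nz.
Qed.

(* 0 is a junk value, for the empty set of squares. *)
Definition tip (R : {fset square}) : int :=
  if pselect (exists2 x, x \in R & forall y, y \in R -> (content y <= content x)%R)
  is left h then content (projT1 (cid2 h)) else 0.

Lemma tip_le R x : x \in R -> (content x <= tip R)%R.
Proof.
move=> xR; rewrite /tip; case: pselect => [h|[]]; last first.
  by apply: fset_argmax; apply/fset0Pn; exists x.
by case: (cid2 h) => y yR my /=; apply: my.
Qed.

Lemma tip_in R : R != fset0 -> exists2 x, x \in R & content x = tip R.
Proof.
move=> R0; rewrite /tip; case: pselect => [h|[]]; last exact: fset_argmax.
by case: (cid2 h) => y yR my /=; exists y.
Qed.

Lemma in_squares (T : ribbons) x :
  reflect (exists2 R, R \in T & x \in R) (x \in squares T).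
Proof.
apply: (iffP idP) => [|[R RT xR]]; rewrite /squares.
  by move=> /bigfcupP[R /andP[RT _] xR]; exists R.
by apply/bigfcupP; exists R => //; rewrite RT.
Qed.

Section Ribbon.
Variables (n : nat) (n0 : (0 < n)%N) (R : {fset square}).
Hypothesis ribR : is_ribbon n R.

Lemma ribbon_neq0 : R != fset0.
Proof. by case: ribR => _ _ cR _; rewrite -cardfs_gt0 cR. Qed.

Lemma ribbon_convex : convex R.
Proof. by case: ribR => /skew_convex. Qed.

(** Two squares on one diagonal would, by convexity, force a 2 x 2 square. *)
Lemma ribbon_content_inj x y : x \in R -> y \in R -> content x = content y -> x = y.
Proof.
have gen i j k : (i, j) \in R -> (i + k, j + k)%N \in R -> k = 0%N.
  case: k => // k x0 y0; case: ribR => _ _ _ /(_ i j) []; split=> //;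
  by apply: (ribbon_convex x0 y0); lia.
move: x y => [a b] [c d] xR yR; rewrite /content /= => e.
have [le|lt] := leqP a c.
  have h := @gen a b (c - a) xR; suff: (c - a = 0)%N by move=> ?; congr pair; lia.
  by apply: h; have -> : ((a + (c - a), b + (c - a)) = (c, d))%N by congr pair; lia.
have h := @gen c d (a - c) yR; suff: (a - c = 0)%N by move=> ?; congr pair; lia.
by apply: h; have -> : ((c + (a - c), d + (a - c)) = (a, b))%N by congr pair; lia.
Qed.

Lemma ribbon_content (c : int) :
  (exists2 x, x \in R & content x = c) <-> (tip R - n%:Z < c <= tip R)%R.
Proof.
have [x0 x0R x0h] := tip_in ribbon_neq0.
have [y0 y0R y0m] := fset_argmax (fun x => - content x)%R ribbon_neq0.
have cR : edge_connected R by case: ribR.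
have le0 := tip_le y0R.
have all c' : (content y0 <= c' <= tip R)%R -> exists2 x, x \in R & content x = c'.
  by rewrite -x0h; exact: connected_content.
(* The contents fill the interval from that of y0 to the tip, each once, so counting the n squares
   gives its length. *)
suff e : (content y0 = tip R - n%:Z + 1)%R.
  split=> [[x xR <-]|h]; last by apply: all; lia.
  by have := tip_le xR; have := y0m x xR; lia.
have : #|` [fset content x | x in R]| = `|tip R - content y0|.+1.
  have -> : [fset content x | x in R] =
      [fset (content y0 + i%:Z)%R | i in iota 0 `|tip R - content y0|.+1].
    apply/fsetP => z; apply/imfsetP/imfsetP => /= [[x xR ->]|[i]].
      have := tip_le xR; have := y0m x xR => h1 h2.
      exists `|content x - content y0|%N; first by rewrite inE mem_iota; lia.
      by lia.
    rewrite inE mem_iota => hi ->; have [|x xR ex] := all (content y0 + i%:Z)%R; first by lia.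
    by exists x.
  rewrite card_imfset; last by move=> i j; lia.
  set k := `|_|.+1; transitivity (size (undup (iota 0 k))) => //.
  by rewrite undup_id ?iota_uniq // size_iota.
rewrite card_in_imfset /=; last by move=> x y; exact: ribbon_content_inj.
by case: ribR => _ _ -> _; lia.
Qed.

Lemma ribbon_content_gt x : x \in R -> (tip R - n%:Z < content x)%R.
Proof.
by move=> xR; have := (ribbon_content _).1 (ex_intro2 _ _ x xR erefl); case/andP.
Qed.

Lemma ribbon_next i j : (i, j) \in R -> (content (i, j) < tip R)%R ->
  (i, j.+1) \in R \/ exists2 i', i = i'.+1 & (i', j) \in R.
Proof.
move=> xR lt; have [|[a b] yR cy] := (ribbon_content (content (i, j) + 1)%R).2.
  by have := ribbon_content_gt xR; lia.
move: cy lt; rewrite /content /= => cy lt.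
have [le1|lt1] := leqP i a.
  have zR : (i, j.+1) \in R by apply: ribbon_convex xR yR _ _; lia.
  by left.
right; exists i.-1; first by lia.
by apply: ribbon_convex yR xR _ _; lia.
Qed.

(** By [ribbon_next], each increase of the content is a step to the right or upwards. *)
Lemma ribbon_monotone x y : x \in R -> y \in R -> (content x <= content y)%R ->
  (y.1 <= x.1)%N && (x.2 <= y.2)%N.
Proof.
move=> xR yR le.
have [k ek] : exists k : nat, content y = (content x + k%:Z)%R.
  by exists `|content y - content x|%N; lia.
elim: k x xR ek {le} => [|k IH] [i j] xR ek.
  by rewrite (ribbon_content_inj xR yR) ?leqnn //; lia.
have := tip_le yR => hy.
have [|zR|[i' ei zR]] := ribbon_next xR; first by lia.
  by have := IH _ zR; rewrite /content /= in ek *; lia.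
by have := IH _ zR; rewrite /content /= in ek *; lia.
Qed.

Lemma toprightmost_ribbon x : toprightmost R x <-> x \in R /\ content x = tip R.
Proof.
split=> [[xR mx]|[xR hx]].
  split=> //; have [y yR hy] := tip_in ribbon_neq0.
  have := mx y yR; have := tip_le xR; move: x y hy {xR mx yR} => [a b] [c d].
  by rewrite /content /=; lia.
by split=> // y yR; apply: ribbon_monotone => //; rewrite hx tip_le.
Qed.

End Ribbon.

(** * Horizontal ribbon strips *)

Lemma youngP (D : {fset square}) :
  (forall i j, (i.+1, j) \in D -> (i, j) \in D) ->
  (forall i j, (i, j.+1) \in D -> (i, j) \in D) -> young D.
Proof.
move=> up left i j i' j' /subnK <- /subnK <-.
elim: (i - i')%N => [|k IH]; last by rewrite addSn => /up.
by elim: (j - j')%N => [|l IH] //; rewrite addSn => /left.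
Qed.

Lemma squares_fset0 : squares fset0 = fset0.
Proof. by apply/fsetP => x; rewrite in_fset0; apply/negP => /in_squares[]. Qed.

Lemma squares_fset1 R : squares [fset R] = R.
Proof.
apply/fsetP => x; apply/in_squares/idP => [[R' /fset1P -> //]|xR].
by exists R; rewrite ?in_fset1.
Qed.

Lemma squaresU T T' : squares (T `|` T') = squares T `|` squares T'.
Proof.
apply/fsetP => x; rewrite in_fsetU; apply/in_squares/orP.
  by case=> R /fsetUP[] RT xR; [left|right]; apply/in_squares; exists R.
by case=> /in_squares[R RT xR]; exists R; rewrite // in_fsetU RT ?orbT.
Qed.

Lemma squares_subset T T' : T `<=` T' -> squares T `<=` squares T'.
Proof.
move=> /fsubsetP sub; apply/fsubsetP => x /in_squares[R RT xR].
by apply/in_squares; exists R => //; apply: sub.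
Qed.

(** * Strips above a fixed shape: tips, diagonals, removal of the last ribbon *)

Section AddableStrips.
Variables (n : nat) (n0 : (0 < n)%N).

(** [horizontal_strip] speaks of a skew shape alone. Fixing the lower shape makes it possible to
    compare the strips contained in one another. *)
Definition addable (lam : {fset square}) (T : ribbons) : Prop :=
  [/\ young lam, horizontal_strip n T, [disjoint lam & squares T] &
      young (lam `|` squares T)].

(* If the ribbons of A were added last, then c is covered by A if and only if
   A contains the last square of the diagonal of content c + 1, which is the
   square north of the topright-most square of an added ribbon of tip c. *)
Definition covered (A : ribbons) (c : int) : Prop :=
  exists2 R, R \in A & (c < tip R <= c + n%:Z)%R.

Section Addable.
Variables (lam : {fset square}) (T : ribbons).
Hypothesis adT : addable lam T.

Lemma addable_ribbon R : R \in T -> is_ribbon n R.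
Proof. by case: adT => _ [h _ _ _] _ _; exact: h. Qed.

Lemma addable_same R R' x : R \in T -> R' \in T -> x \in R -> x \in R' -> R = R'.
Proof.
case: adT => _ [_ h _ _] _ _ RT RT' xR xR'; apply/eqP/negPn/negP => ne.
by have /fdisjointP/(_ x xR) := h _ _ RT RT' ne; rewrite xR'.
Qed.

Lemma addable_notin R x : R \in T -> x \in R -> x \notin lam.
Proof.
case: adT => _ _ /fdisjointP h _ RT xR; apply/negP => /h /negP; apply.
by apply/in_squares; exists R.
Qed.

Lemma addable_young : young lam. Proof. by case: adT. Qed.

Lemma addable_north R i j : R \in T -> (i.+1, j) \in R ->
  content (i.+1, j) = tip R -> (i, j) \in lam.
Proof.
case: adT => _ [_ _ _ tn] _ yU RT xR cR.
have /tn := RT; move=> /(_ i j); rewrite (toprightmost_ribbon n0 (addable_ribbon RT)).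
move=> /(_ (conj xR cR)) /negbTE h; suff : (i, j) \in lam `|` squares T.
  by rewrite in_fsetU h orbF.
apply: (yU i.+1 j) => //; rewrite in_fsetU; apply/orP; right.
by apply/in_squares; exists R.
Qed.

(** The square north of the tip square (a, b) has content [tip R + 1] and lies in [lam], so the
    squares of that diagonal outside [lam] come after it. For a = 0 the claim is arithmetic. *)
Lemma addable_after_tip R a b i j : R \in T -> (a, b) \in R ->
  content (a, b) = tip R -> (i, j) \notin lam ->
  content (i, j) = (tip R + 1)%R -> (a <= i)%N && (b < j)%N.
Proof.
move=> RT xR cR nl; rewrite -cR /content /= => e.
case: a xR cR e => [|a] xR cR e; first by lia.
have := addable_north RT xR cR => l.
suff : (a < i)%N by lia.
rewrite ltnNge; apply/negP => le; case/negP: nl.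
by apply: (addable_young _ _ l) => //; lia.
Qed.

(** Of two tip squares on one diagonal, the square north of the lower one lies in [lam] and is
    weakly south-east of the upper one, which would then lie in [lam] too. *)
Lemma addable_tip_inj R R' : R \in T -> R' \in T -> tip R = tip R' -> R = R'.
Proof.
have gen S S' a b c d : S \in T -> S' \in T -> (a, b) \in S -> (c, d) \in S' ->
    content (a, b) = tip S -> content (c, d) = tip S' -> tip S = tip S' ->
    (a <= c)%N -> S = S'.
  move=> ST ST' xS xS' cS cS' e le.
  have [ea|ne] := eqVneq a c.
    have eb : b = d by move: cS cS'; rewrite /content /=; lia.
    by subst; apply: addable_same xS xS'.
  have lt : (a < c)%N by lia.
  case: c xS' cS' le lt {ne} => // c xS' cS' _ lt.
  have := addable_north ST' xS' cS' => l.
  case/negP: (addable_notin ST xS).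
  by apply: (addable_young _ _ l) => //; move: cS cS'; rewrite /content /=; lia.
move=> RT RT' e.
have [[a b] xR cR] := tip_in (ribbon_neq0 n0 (addable_ribbon RT)).
have [[c d] xR' cR'] := tip_in (ribbon_neq0 n0 (addable_ribbon RT')).
have [le|lt] := leqP a c; first by apply: gen xR xR' cR cR' e le.
by apply/esym/(gen _ _ _ _ _ _ RT' RT xR' xR cR' cR (esym e)); lia.
Qed.

(** On a common diagonal the ribbon of larger tip lies below. This is read off at the tip of R',
    where R goes on to the next diagonal, and propagates back along both ribbons, since they move by
    single steps and are disjoint. *)
Lemma addable_diagonal R R' i j i' j' : R \in T -> R' \in T ->
  (tip R' < tip R)%R -> (i, j) \in R -> (i', j') \in R' ->
  content (i, j) = content (i', j') -> (i' < i)%N.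
Proof.
move=> RT RT' lt; have rR := addable_ribbon RT; have rR' := addable_ribbon RT'.
have fin a b a' b' : (a, b) \in R -> (a', b') \in R' ->
    content (a, b) = content (a', b') -> (a' <= a)%N -> (a' < a)%N.
  move=> xR xR' e le; rewrite ltn_neqAle le andbT; apply/negP => /eqP ea.
  have eb : b = b' by move: e; rewrite /content /=; lia.
  by subst; move: lt; rewrite (addable_same RT RT' xR xR') ltxx.
move=> xR xR' e.
have [k ek] : exists k : nat, tip R' = (content (i', j') + k%:Z)%R.
  by exists `|tip R' - content (i', j')|%N; have := tip_le xR'; lia.
elim: k i j i' j' xR xR' e ek => [|k IH] i j i' j' xR xR' e ek.
  apply: (fin _ _ _ _ xR xR' e).
  have [|[p q] yR cy] := (ribbon_content n0 rR (tip R' + 1)%R).2.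
    by have := ribbon_content_gt n0 rR xR; have := tip_le xR'; lia.
  have /andP[le1 _] : (i' <= p)%N && (j' < q)%N.
    by apply: (addable_after_tip RT' xR') => //; [lia | exact: addable_notin RT yR].
  have /= /andP[h _] : (p <= i)%N && (j <= q)%N by apply: (ribbon_monotone n0 rR xR yR); lia.
  exact: leq_trans h.
have [[p q] yR [cy ley]] : exists2 y, y \in R & content y = (content (i, j) + 1)%R /\ (i <= y.1.+1)%N.
  have [|yR|[p ep yR]] := ribbon_next n0 rR xR; first by lia.
    by exists (i, j.+1); rewrite // /content /=; lia.
  by exists (p, j); rewrite // /content /=; lia.
have [[p' q'] yR' [cy' ley']] : exists2 y, y \in R' & content y = (content (i', j') + 1)%R /\ (i' <= y.1.+1)%N.
  have [|yR'|[p' ep yR']] := ribbon_next n0 rR' xR'; first by lia.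
    by exists (i', j'.+1); rewrite // /content /=; lia.
  by exists (p', j'); rewrite // /content /=; lia.
have lt' : (p' < p)%N by apply: (IH _ _ _ _ yR yR'); [rewrite cy cy' e | rewrite cy' ek; lia].
have /= /andP[h _] : (p <= i)%N && (j <= q)%N by apply: (ribbon_monotone n0 rR xR yR); lia.
by apply: (fin _ _ _ _ xR xR' e); move: ley'; rewrite /=; lia.
Qed.

Lemma squares_fsetD1 R x : R \in T ->
  (x \in squares (T `\ R)) = (x \in squares T) && (x \notin R).
Proof.
move=> RT; apply/in_squares/andP => [[R' /fsetD1P[ne RT'] xR']|[/in_squares[R' RT' xR'] nx]].
  split; first by apply/in_squares; exists R'.
  by apply/negP => xR; case/eqP: ne; apply: addable_same xR' xR.
by exists R' => //; apply/fsetD1P; split=> //; apply: contraNneq nx => <-.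
Qed.

Lemma addable_sub_over L C : young L -> C `<=` T -> [disjoint L & squares C] ->
  young (L `|` squares C) -> addable L C.
Proof.
case: adT => _ [h1 h2 h3 h4] _ _ yL sub dis yC.
have /fsubsetP sb := sub; split=> //; split.
- by move=> R /sb; apply: h1.
- by move=> R R' /sb RT /sb; apply: h2.
- apply/is_skew_shapeP; exists L, (L `|` squares C); split=> //.
    exact: fsubsetUl.
  rewrite fsetDUl fsetDv fset0U; apply/esym/fsetDidPl.
  by rewrite fdisjoint_sym.
- move=> R i j RC /h4 h; apply: contra (h (sb _ RC)).
  exact: (fsubsetP (squares_subset sub)).
Qed.

Lemma addable_sub B : B `<=` T -> young (lam `|` squares B) -> addable lam B.
Proof.
case: adT => yl _ dis _ sub yB; apply: addable_sub_over => //.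
apply/fdisjointP => x /(fdisjointP dis).
by apply: contra; apply: (fsubsetP (squares_subset sub)).
Qed.

(** A square of another ribbon directly south or east of a square of R would, following one of the
    two ribbons by one step, put R above that ribbon on a common diagonal, against
    [addable_diagonal]. If the other ribbon ends at a square south of R, its northern neighbour lies
    in [lam]. *)
Lemma addable_remove_max R : R \in T ->
  (forall R', R' \in T -> (tip R' <= tip R)%R) -> addable lam (T `\ R).
Proof.
move=> RT mR; apply: addable_sub; first exact: fsubD1set.
have yU : young (lam `|` squares T) by case: adT.
have rR := addable_ribbon RT.
have key x : x \in lam `|` squares T -> x \notin R -> x \in lam `|` squares (T `\ R).
  rewrite !in_fsetU => /orP[->//|h nR].
  by rewrite squares_fsetD1 // h nR orbT.
have lt R' : R' \in T `\ R -> R' \in T /\ (tip R' < tip R)%R.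
  move=> /fsetD1P[ne RT']; split=> //; rewrite lt_neqAle mR // andbT.
  by apply: contra ne => /eqP e; apply/eqP/addable_tip_inj.
apply: youngP => i j; rewrite in_fsetU => /orP[l|xT].
- by rewrite in_fsetU (addable_young _ _ l).
- apply: key.
    apply: (yU i.+1 j) => //; move: xT.
    by rewrite in_fsetU squares_fsetD1 // => /andP[-> _]; rewrite orbT.
  apply/negP => yR; have /in_squares[R' /lt[RT' lt'] xR'] := xT.
  have := tip_le xR'; rewrite le_eqVlt => /orP[/eqP e|lt''].
    by have := addable_north RT' xR' e; apply/negP/(addable_notin RT yR).
  have [yR'|[p [<-] yR']] := ribbon_next n0 (addable_ribbon RT') xR' lt''; last first.
    by rewrite (addable_same RT RT' yR yR') ltxx in lt'.
  have := addable_diagonal RT RT' lt' yR yR'; rewrite /content /= => h.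
  suff : (i.+1 < i)%N by lia.
  by apply: h; lia.
- by rewrite in_fsetU (addable_young _ _ l).
- apply: key.
    apply: (yU i j.+1) => //; move: xT.
    by rewrite in_fsetU squares_fsetD1 // => /andP[-> _]; rewrite orbT.
  apply/negP => yR; have /in_squares[R' /lt[RT' lt'] xR'] := xT.
  have lex := tip_le xR'; have ltc : (content (i, j) < tip R)%R.
    by move: lex; rewrite /content /=; lia.
  have [yR'|[p ep yR']] := ribbon_next n0 rR yR ltc.
    by rewrite (addable_same RT RT' yR' xR') ltxx in lt'.
  have := addable_diagonal RT RT' lt' yR' xR'; rewrite /content /= => h.
  suff : (i < p)%N by lia.
  by apply: h; lia.
Qed.
End Addable.
End AddableStrips.

(** * Sub-strips, merging, and uniqueness of the tiling *)

Section SubStrips.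
Variables (n : nat) (n0 : (0 < n)%N).

Lemma addable_max lam T : addable n lam T -> T != fset0 ->
  exists R, [/\ R \in T, forall R', R' \in T -> (tip R' <= tip R)%R &
    addable n lam (T `\ R)].
Proof.
move=> adT T0; have [R RT mR] := fset_argmax tip T0.
by exists R; split=> //; apply: addable_remove_max.
Qed.

Lemma addable_prefix lam T t : addable n lam T ->
  addable n lam [fset R in T | (tip R <= t)%R].
Proof.
have [k] := ubnP #|` T|; elim: k T => // k IH T lek adT.
have [e|T0] := eqVneq T fset0.
  suff -> : [fset R in T | (tip R <= t)%R] = T by [].
  by apply/fsetP => R; rewrite !inE /= e in_fset0.
have [R [RT mR adR]] := addable_max adT T0.
have [le|lt] := leP (tip R) t.
  suff -> : [fset R in T | (tip R <= t)%R] = T by [].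
  apply/fsetP => R'; rewrite !inE /=; apply: andb_idr => /mR h.
  exact: le_trans le.
suff -> : [fset R in T | (tip R <= t)%R] = [fset R' in T `\ R | (tip R' <= t)%R].
  by apply: IH => //; have := cardfsD1 R T; rewrite RT; lia.
apply/fsetP => R'; rewrite !inE /=; have [->|//] := eqVneq R' R.
by rewrite leNgt lt andbF.
Qed.

Section Sub.
Variables (lam : {fset square}) (T : ribbons).
Hypothesis adT : addable n lam T.

(** The condition on tips says that R meets the diagonal after the tip of R'. Its square there is
    south-east of the tip square of R', which must therefore be present in the order ideal below
    B. *)
Lemma addable_lower B R R' : B `<=` T -> addable n lam B -> R \in B -> R' \in T ->
  (tip R - n%:Z <= tip R' < tip R)%R -> R' \in B.
Proof.
move=> /fsubsetP sub adB RB R'T h.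
have [[a b] xR' cR'] := tip_in (ribbon_neq0 n0 (addable_ribbon adT R'T)).
have [|[i j] xR cR] := (ribbon_content n0 (addable_ribbon adB RB) (tip R' + 1)%R).2.
  by lia.
have /andP[le1 le2] : (a <= i)%N && (b < j)%N.
  by apply: (addable_after_tip n0 adT R'T xR') => //; apply: addable_notin adB _ _ RB xR.
have : (a, b) \in lam `|` squares B.
  case: adB => _ _ _ yB; apply: (yB i j) => //; first exact: ltnW.
  by rewrite in_fsetU; apply/orP; right; apply/in_squares; exists R.
rewrite in_fsetU (negbTE (addable_notin adT R'T xR')) /= => /in_squares[R2 R2B xR2].
by rewrite (addable_same adT R'T (sub _ R2B) xR' xR2).
Qed.

(** Converse of [addable_lower]: the closure condition is all that an addable subset must satisfy,
    so addability becomes a condition on tips. *)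
Lemma addable_closed B : B `<=` T ->
  (forall R R', R \in B -> R' \in T -> (tip R - n%:Z <= tip R' < tip R)%R -> R' \in B) ->
  addable n lam B.
Proof.
move=> subB cl; have /fsubsetP sub := subB; apply: (addable_sub adT) => //.
(* The prefix of tips up to [tip R] contains the northern and western neighbours of R. A ribbon R'
   through such a neighbour has tip at least [content (i, j) - 1], hence at least [tip R - n], so
   the closure applies. *)
have key R i j i' j' : R \in B -> (i, j) \in R -> (i' <= i)%N -> (j' <= j)%N ->
    (content (i, j) - 1 <= content (i', j'))%R -> (i', j') \in lam `|` squares B.
  move=> RB xR le1 le2 le3; have RT := sub _ RB.
  have [_ _ _ yP] := addable_prefix (tip R) adT.
  have : (i', j') \in lam `|` squares [fset R' in T | (tip R' <= tip R)%R].
    apply: (yP i j) => //; rewrite in_fsetU; apply/orP; right.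
    by apply/in_squares; exists R => //; rewrite !inE /= RT lexx.
  rewrite !in_fsetU => /orP[->//|/in_squares[R']]; rewrite !inE /= => /andP[R'T le] xR'.
  apply/orP; right; apply/in_squares; exists R' => //.
  have [->//|ne] := eqVneq R' R; apply: (cl R) => //.
  rewrite lt_neqAle le andbT; apply/andP; split.
    by have := tip_le xR'; have := ribbon_content_gt n0 (addable_ribbon adT RT) xR; lia.
  by apply: contra ne => /eqP e; apply/eqP/(addable_tip_inj n0 adT).
apply: youngP => i j; rewrite in_fsetU => /orP[l|/in_squares[R RB xR]].
- by rewrite in_fsetU (addable_young adT _ _ l).
- by apply: (key R _ _ _ _ RB xR) => //; rewrite /content /=; lia.
- by rewrite in_fsetU (addable_young adT _ _ l).
- by apply: (key R _ _ _ _ RB xR) => //; rewrite /content /=; lia.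
Qed.

Lemma addable_diff B : B `<=` T -> addable n lam B ->
  addable n (lam `|` squares B) (T `\` B).
Proof.
move=> sub adB; have eT : squares B `|` squares (T `\` B) = squares T.
  rewrite -squaresU; congr squares; apply/fsetP => R; rewrite in_fsetU in_fsetD.
  by have /fsubsetP/(_ R) := sub; case: (R \in B) => // ->.
apply: (addable_sub_over adT); first by case: adB.
- exact: fsubsetDl.
- apply/fdisjointP => x; rewrite in_fsetU => /orP[xl|/in_squares[R RB xR]].
    case: adT => _ _ /fdisjointP/(_ x xl) h _; apply: contra h.
    by rewrite -eT in_fsetU orbC => ->.
  apply/negP => /in_squares[R' /fsetDP[R'T /negP nB] xR']; apply: nB.
  by rewrite -(addable_same adT (fsubsetP sub _ RB) R'T xR xR').
- by rewrite -fsetUA eT; case: adT.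
Qed.

Lemma addable_max_diagonal R i j i' j' : R \in T ->
  (forall R', R' \in T -> (tip R' <= tip R)%R) -> (i, j) \in R ->
  (i', j') \in squares T -> content (i, j) = content (i', j') -> (i' <= i)%N.
Proof.
move=> RT mR xR /in_squares[R' R'T xR'] e.
have := mR _ R'T; rewrite le_eqVlt => /orP[/eqP et|lt].
  rewrite (addable_tip_inj n0 adT R'T RT et) in xR'.
  have [] : (i, j) = (i', j'); last by move=> -> _.
  exact: (ribbon_content_inj n0 (addable_ribbon adT RT)).
exact/ltnW/(addable_diagonal n0 adT RT R'T lt xR xR').
Qed.

End Sub.

(** The square north of the tip square of a ribbon of C has content one more than its tip. If B does
    not cover the tip, B has no square of that content, so this square is not in B and the ribbon
    still touches the northern edge. *)
Lemma addable_union lam B C : addable n lam B -> addable n (lam `|` squares B) C ->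
  (forall R, R \in C -> ~ covered n B (tip R)) -> addable n lam (B `|` C).
Proof.
move=> adB adC unc; have yl := addable_young adB.
case: (adC) => _ [c1 c2 c3 c4] /fdisjointP disC; rewrite -fsetUA -squaresU => yU.
case: (adB) => _ [b1 b2 b3 b4] /fdisjointP disB _.
have dis : [disjoint lam & squares (B `|` C)].
  apply/fdisjointP => x xl; rewrite squaresU in_fsetU (negbTE (disB x xl)) /=.
  by apply: disC; rewrite in_fsetU xl.
have disBC R R' : R \in B -> R' \in C -> [disjoint R & R'].
  move=> RB R'C; apply/fdisjointP => x xR; apply/negP => xR'.
  have /negP : x \notin squares C.
    by apply: disC; rewrite in_fsetU; apply/orP; right; apply/in_squares; exists R.
  by apply; apply/in_squares; exists R'.
split=> //; split.
- by move=> R /fsetUP[/b1|/c1].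
- move=> R R' /fsetUP[RB|RC] /fsetUP[RB'|RC'] ne.
  + exact: b2.
  + exact: disBC.
  + by rewrite fdisjoint_sym; apply: disBC.
  + exact: c2.
- apply/is_skew_shapeP; exists lam, (lam `|` squares (B `|` C)); split=> //.
    exact: fsubsetUl.
  by rewrite fsetDUl fsetDv fset0U; apply/esym/fsetDidPl; rewrite fdisjoint_sym.
move=> R i j /fsetUP[RB|RC].
  move/(toprightmost_ribbon n0 (addable_ribbon adB RB)) => [xR cR].
  by apply: (fdisjointP dis); apply: (addable_north n0 adB RB xR cR).
move/(toprightmost_ribbon n0 (addable_ribbon adC RC)) => [xR cR].
have xB := addable_north n0 adC RC xR cR.
rewrite squaresU in_fsetU negb_or disC // andbT; apply/negP => /in_squares[R' R'B xR'].
apply: (unc R RC); exists R' => //; move: cR; rewrite /content /= => cR.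
have := tip_le xR'; have := ribbon_content_gt n0 (addable_ribbon adB R'B) xR'.
by rewrite /content /=; lia.
Qed.

(** Converse of [addable_union]. A covering ribbon has a square of content [tip R + 1] outside
    [lam], so the square north of the tip square of R, further down that diagonal, cannot lie in
    [lam]; it lies in A, and R does not touch the northern edge of the union. *)
Lemma addable_uncovered lam A C R : addable n lam A -> addable n (lam `|` squares A) C ->
  horizontal_strip n (A `|` C) -> R \in C -> ~ covered n A (tip R).
Proof.
move=> adA adC [_ _ _ tn] RC [R' R'A lt].
have [[a b] xR cR] := tip_in (ribbon_neq0 n0 (addable_ribbon adC RC)).
have [|[i j] xR' cR'] := (ribbon_content n0 (addable_ribbon adA R'A) (tip R + 1)%R).2.
  by lia.
have yA : young (lam `|` squares A) by case: adA.
have ijA : (i, j) \in lam `|` squares A.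
  by rewrite in_fsetU; apply/orP; right; apply/in_squares; exists R'.
have nl := addable_notin adC RC xR.
have lta : (i < a)%N.
  rewrite ltnNge; apply: contra nl => le; apply: (yA _ _ _ _ le _ ijA).
  by move: cR cR'; rewrite /content /=; lia.
case: a xR cR nl lta => // a xR cR nl lta.
have := addable_north n0 adC RC xR cR; rewrite in_fsetU => /orP[xl|xA].
  have := addable_notin adA R'A xR'; rewrite (addable_young adA _ _ xl) //.
  by move: cR cR'; rewrite /content /=; lia.
have top : toprightmost R (a.+1, b).
  exact/(toprightmost_ribbon n0 (addable_ribbon adC RC)).
have := tn R a b _ top; rewrite squaresU !in_fsetU xA RC orbT.
by move=> /(_ isT).
Qed.

(** The largest tip is the largest content of the shape, and its ribbon takes the last square of the
    shape on each of its n diagonals by [addable_max_diagonal]. So both tilings have the same last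
    ribbon, which is removed. *)
Lemma addable_unique lam T T' : addable n lam T -> addable n lam T' ->
  squares T = squares T' -> T = T'.
Proof.
have ne0 T1 T2 : addable n lam T1 -> squares T1 = squares T2 -> T1 != fset0 ->
    T2 != fset0.
  move=> ad1 e /fset0Pn[R RT]; have /fset0Pn[x xR] := ribbon_neq0 n0 (addable_ribbon ad1 RT).
  have : x \in squares T2 by rewrite -e; apply/in_squares; exists R.
  by move=> /in_squares[R' R'T _]; apply/fset0Pn; exists R'.
have [k] := ubnP #|` T|; elim: k T T' => // k IH T T' lek adT adT' e.
have [e0|T0] := eqVneq T fset0.
  have [->//|T0] := eqVneq T' fset0.
  by have := ne0 _ _ adT' (esym e) T0; rewrite e0 eqxx.
have T0' := ne0 _ _ adT e T0.
have [R [RT mR adR]] := addable_max adT T0.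
have [R' [RT' mR' adR']] := addable_max adT' T0'.
have lt T1 T2 R1 R2 : squares T1 = squares T2 -> addable n lam T1 -> R1 \in T1 ->
    (forall R', R' \in T2 -> (tip R' <= tip R2)%R) -> (tip R1 <= tip R2)%R.
  move=> {}e ad1 R1T1 m2.
  have [x xR1 <-] := tip_in (ribbon_neq0 n0 (addable_ribbon ad1 R1T1)).
  have : x \in squares T2 by rewrite -e; apply/in_squares; exists R1.
  by move=> /in_squares[R3 R3T xR3]; apply: le_trans (tip_le xR3) (m2 _ R3T).
have et : tip R = tip R'.
  by apply: le_anti; rewrite (lt T T' R R') // (lt T' T R' R).
have sub T1 T2 R1 R2 : squares T1 = squares T2 -> addable n lam T1 -> addable n lam T2 ->
    R1 \in T1 -> R2 \in T2 -> tip R1 = tip R2 ->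
    (forall R', R' \in T1 -> (tip R' <= tip R1)%R) ->
    (forall R', R' \in T2 -> (tip R' <= tip R2)%R) -> R1 `<=` R2.
  move=> {}e ad1 ad2 RT1 RT2 et' m1 m2; apply/fsubsetP => -[i j] xR.
  have [|[i' j'] xR' c'] := (ribbon_content n0 (addable_ribbon ad2 RT2) (content (i, j))).2.
    by rewrite -et'; apply/(ribbon_content n0 (addable_ribbon ad1 RT1)); exists (i, j).
  have le1 : (i' <= i)%N.
    apply: (addable_max_diagonal ad1 RT1 m1 xR _ (esym c')).
    by rewrite e; apply/in_squares; exists R2.
  have le2 : (i <= i')%N.
    apply: (addable_max_diagonal ad2 RT2 m2 xR' _ c').
    by rewrite -e; apply/in_squares; exists R1.
  have -> // : (i, j) = (i', j').
  by move: c'; rewrite /content /= => c'; congr pair; lia.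
have eR : R = R'.
  by apply/eqP; rewrite eqEfsubset (sub T T') // (sub T' T).
subst R'; rewrite -(fsetD1K RT) -(fsetD1K RT'); congr (_ |` _).
apply: IH => //; first by have := cardfsD1 R T; rewrite RT; lia.
apply/fsetP => x; rewrite (squares_fsetD1 adT) // (squares_fsetD1 adT') //.
by rewrite e.
Qed.

End SubStrips.

(** * Components and border ribbon strips *)

Lemma edge_connected_adjacent (S S' : {fset square}) x y : edge_connected S ->
  edge_connected S' -> x \in S -> y \in S' -> adjacent x y ->
  edge_connected (S `|` S').
Proof.
move=> cS cS' xS yS' a.
have key z : z \in S `|` S' -> linked (S `|` S') x z.
  rewrite in_fsetU => /orP[zS|zS'].
    exact: (linked_subset (fsubsetUl _ _) (cS x z xS zS)).
  apply: (@linked_trans _ _ y); last first.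
    exact: (linked_subset (fsubsetUr _ _) (cS' y z yS' zS')).
  by apply: linked_step; rewrite // in_fsetU yS' orbT.
move=> z t zS tS; apply: (@linked_trans _ _ x); last exact: key.
by apply: linked_sym; [rewrite in_fsetU xS | exact: key].
Qed.

(** The value [fset0] is reached only for the empty strip. *)
Definition max_ribbon (T : ribbons) : {fset square} :=
  if pselect (exists2 R, R \in T & forall R', R' \in T -> (tip R' <= tip R)%R)
  is left h then projT1 (cid2 h) else fset0.

Lemma max_ribbonP T : T != fset0 -> max_ribbon T \in T /\
  forall R, R \in T -> (tip R <= tip (max_ribbon T))%R.
Proof.
move=> T0; rewrite /max_ribbon; case: pselect => [h|[]]; last exact: fset_argmax.
by case: (cid2 h).
Qed.

Lemma component_same (T C C' : ribbons) R : is_component T C -> is_component T C' ->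
  R \in C -> R \in C' -> R != fset0 -> C = C'.
Proof.
move=> [sC C0 cC mC] [sC' C0' cC' mC'] RC RC' /fset0Pn[x xR].
have cU : edge_connected (squares (C `|` C')).
  rewrite squaresU; apply: (@edge_connectedU _ _ x) => //.
    by apply/in_squares; exists R.
  by apply/in_squares; exists R.
have sU : C `|` C' `<=` T by rewrite fsubUset sC sC'.
by rewrite -(mC _ (fsubsetUl _ _) sU cU) (mC' _ (fsubsetUr _ _) sU cU).
Qed.

Section Components.
Variables (n : nat) (n0 : (0 < n)%N).

Lemma covered_content A R c : (forall R, R \in A -> is_ribbon n R) ->
  R \in A -> (exists2 x, x \in R & content x = (c + 1)%R) -> covered n A c.
Proof.
move=> rA RA [x xR cx]; exists R => //.
by have := tip_le xR; have := ribbon_content_gt n0 (rA _ RA) xR; lia.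
Qed.

Lemma content_covered A c : (forall R, R \in A -> is_ribbon n R) ->
  covered n A c -> exists2 x, x \in squares A & content x = (c + 1)%R.
Proof.
move=> rA [R RA h]; have [|x xR cx] := (ribbon_content n0 (rA _ RA) (c + 1)%R).2.
  by lia.
by exists x => //; apply/in_squares; exists R.
Qed.

(** The connected shape has a square of content [tip R + 1], and the ribbon through it covers the
    tip of R. *)
Lemma connected_covered A R R' : (forall R, R \in A -> is_ribbon n R) ->
  edge_connected (squares A) -> R \in A -> R' \in A -> (tip R < tip R')%R ->
  covered n A (tip R).
Proof.
move=> rA cA RA RA' lt.
have [x xR cx] := tip_in (ribbon_neq0 n0 (rA _ RA)).
have [y yR cy] := tip_in (ribbon_neq0 n0 (rA _ RA')).
have [|||z zS cz] := connected_content (c := (tip R + 1)%R) cA (x := x) (y := y).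
- by apply/in_squares; exists R.
- by apply/in_squares; exists R'.
- by lia.
have /in_squares[R2 R2A zR2] := zS.
by apply: (covered_content rA R2A); exists z.
Qed.

Section Addable.
Variables (lam : {fset square}) (T : ribbons).
Hypothesis adT : addable n lam T.

Let rT R : R \in T -> is_ribbon n R. Proof. exact: (addable_ribbon adT). Qed.

Lemma addable_convex B : addable n lam B -> convex (squares B).
Proof. by case=> _ [_ _ h _] _ _; apply: skew_convex. Qed.

Lemma component_ribbon C R : is_component T C -> R \in C -> is_ribbon n R.
Proof. by case=> /fsubsetP sC _ _ _ /sC; apply: rT. Qed.

Lemma component_adjacent C R R' x y : is_component T C -> R \in C -> R' \in T ->
  x \in R -> y \in R' -> adjacent x y -> R' \in C.
Proof.
move=> [sC C0 cC mC] RC R'T xR yR' a.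
have <- : R' |` C = C; last exact: fset1U1.
apply: mC; first exact: fsubsetUr.
  by rewrite fsubUset fsub1set R'T.
rewrite fsetUC squaresU squares_fset1.
apply: (@edge_connected_adjacent _ _ x y) => //; first by case: (rT R'T).
by apply/in_squares; exists R.
Qed.

(** A square next to a square of C lies in [lam] or in a ribbon of T adjacent to C, which by
    maximality belongs to C. *)
Lemma component_addable C : is_component T C -> addable n lam C.
Proof.
move=> cC; have [sC _ _ _] := cC; apply: (addable_sub adT) => //.
have key R x y : R \in C -> x \in R -> y \in lam `|` squares T -> adjacent x y ->
    y \in lam `|` squares C.
  move=> RC xR; rewrite !in_fsetU => /orP[->//|/in_squares[R' R'T yR']] a.
  apply/orP; right; apply/in_squares; exists R' => //.
  exact: (component_adjacent cC RC R'T xR yR' a).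
have yT : young (lam `|` squares T) by case: adT.
have inT x R : R \in C -> x \in R -> x \in lam `|` squares T.
  move=> RC xR; rewrite in_fsetU; apply/orP; right; apply/in_squares.
  by exists R => //; apply: (fsubsetP sC).
apply: youngP => i j; rewrite in_fsetU => /orP[l|/in_squares[R RC xR]].
- by rewrite in_fsetU (addable_young adT _ _ l).
- apply: (key R _ _ RC xR); last by rewrite /adjacent /=; lia.
  exact: (yT _ _ _ _ _ _ (inT _ _ RC xR)).
- by rewrite in_fsetU (addable_young adT _ _ l).
- apply: (key R _ _ RC xR); last by rewrite /adjacent /=; lia.
  exact: (yT _ _ _ _ _ _ (inT _ _ RC xR)).
Qed.

Lemma component_exists R : R \in T -> exists2 C, is_component T C & R \in C.
Proof.
move=> RT.
pose X := [fset C in fpowerset T | `[< R \in C /\ edge_connected (squares C) >]].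
have inX C : (C \in X) = (C `<=` T) && `[< R \in C /\ edge_connected (squares C) >].
  by rewrite !inE /= fpowersetE.
have X0 : X != fset0.
  apply/fset0Pn; exists [fset R]; rewrite inX fsub1set RT /=; apply/asboolP.
  by rewrite fset11 squares_fset1; split=> //; case: (rT RT).
have [C] := fset_argmax (fun C : ribbons => Posz #|` C|) X0.
rewrite inX => /andP[sC /asboolP[RC cC]] mC; exists C => //; split=> //.
  by apply/fset0Pn; exists R.
move=> C' sCC' sC' cC'; apply/esym/eqP; rewrite eqEfcard sCC' /=.
have := mC C'; rewrite inX sC' /= lez_nat; apply; apply/asboolP; split=> //.
exact: (fsubsetP sCC').
Qed.

(** A difference of two prefixes is a skew shape, so [interval_connected] applies. Where a ribbon of
    the interval ends before [tip R'], the next content is supplied by R' itself, which reaches down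
    to content [tip R' - n + 1], at most [tip R + 1]. *)
Lemma interval_strip_connected R R' : R \in T -> R' \in T ->
  (tip R < tip R' <= tip R + n%:Z)%R ->
  edge_connected (squares [fset R2 in T | (tip R <= tip R2 <= tip R')%R]).
Proof.
move=> RT R'T h; set U := [fset _ in T | _].
have inU R2 : (R2 \in U) = (R2 \in T) && (tip R <= tip R2 <= tip R')%R.
  by rewrite !inE.
pose P t := [fset R2 in T | (tip R2 <= t)%R].
have inP R2 t : (R2 \in P t) = (R2 \in T) && (tip R2 <= t)%R by rewrite !inE.
have eU : P (tip R') `\` P (tip R - 1)%R = U.
  by apply/fsetP => R2; rewrite in_fsetD !inP inU; case: (R2 \in T) => //=; lia.
have adU : addable n (lam `|` squares (P (tip R - 1)%R)) U.
  rewrite -eU; apply: (addable_diff (addable_prefix n0 _ adT)); last first.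
    exact: addable_prefix.
  by apply/fsubsetP => R2; rewrite !inP => /andP[->] /=; lia.
apply: (@interval_connected _ (tip R')).
- by case: adU => _ [_ _ + _] _ _; apply: skew_convex.
- move=> x /in_squares[R2]; rewrite inU => /andP[_ h2] xR.
  by have := tip_le xR; lia.
- move=> x /in_squares[R2 R2U xR] lt; have := R2U; rewrite inU => /andP[R2T h2].
  have := tip_le xR; rewrite le_eqVlt => /orP[/eqP e|lt2].
    have [|y yR cy] := (ribbon_content n0 (rT R'T) (content x + 1)%R).2; first by lia.
    by exists y => //; apply/in_squares; exists R' => //; rewrite inU R'T; lia.
  have [|y yR cy] := (ribbon_content n0 (rT R2T) (content x + 1)%R).2.
    by have := ribbon_content_gt n0 (rT R2T) xR; lia.
  by exists y => //; apply/in_squares; exists R2.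
Qed.

(** If a ribbon R' of T covered the tip of R, the connected interval from R to R' would enlarge the
    component. *)
Lemma component_max C R : is_component T C -> R \in C ->
  (forall R', R' \in C -> (tip R' <= tip R)%R) -> ~ covered n T (tip R).
Proof.
move=> cC RC mR [R' R'T h]; have [sC _ eC mC] := cC.
have RT := fsubsetP sC _ RC.
have cU := interval_strip_connected RT R'T h; set U := [fset _ in T | _] in cU.
have inU R2 : (R2 \in U) = (R2 \in T) && (tip R <= tip R2 <= tip R')%R.
  by rewrite !inE.
have [x xR] := fset0Pn _ (ribbon_neq0 n0 (rT RT)).
suff R'C : R' \in C by have := mR _ R'C; lia.
have <- : C `|` U = C; last by rewrite in_fsetU inU R'T; apply/orP; right; lia.
apply: mC; first exact: fsubsetUl.
  by rewrite fsubUset sC; apply/fsubsetP => R2; rewrite inU => /andP[].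
rewrite squaresU; apply: (@edge_connectedU _ _ x) => //.
  by apply/in_squares; exists R.
by apply/in_squares; exists R => //; rewrite inU RT; lia.
Qed.

Lemma component_covered C R R' : is_component T C -> R \in C -> R' \in C ->
  (tip R < tip R')%R -> covered n C (tip R).
Proof.
move=> cC RC R'C lt; apply: connected_covered lt => //.
- by move=> R2; apply: component_ribbon.
- by case: cC.
Qed.

Lemma covered_subset A B c : A `<=` B -> covered n A c -> covered n B c.
Proof. by move=> /fsubsetP s [R /s RB h]; exists R. Qed.

Lemma component_neq0 C : is_component T C -> C != fset0. Proof. by case. Qed.

(** Each component is represented by its ribbon of largest tip, and these are the ribbons that T
    does not cover. The sign of a strip thus becomes a count over tips. *)
Lemma ncomponentsE :
  ncomponents T = #|` [fset R in T | ~~ `[< covered n T (tip R) >]]|.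
Proof.
rewrite /ncomponents; set X := [fset C in _ | _].
have inX C : (C \in X) -> is_component T C by rewrite !inE /= => /andP[_ /asboolP].
have -> : [fset R in T | ~~ `[< covered n T (tip R) >]] = [fset max_ribbon C | C in X].
  apply/fsetP => R; rewrite !inE /=; apply/andP/imfsetP => /=.
    case=> RT /asboolP nc; have [C cC RC] := component_exists RT.
    have [mC m] := max_ribbonP (component_neq0 cC).
    exists C; first by rewrite !inE /= fpowersetE asboolT // andbT; case: cC.
    have := m _ RC; rewrite le_eqVlt => /orP[/eqP e|lt].
      by apply: (addable_tip_inj n0 (component_addable cC)).
    case: nc; have [sC _ _ _] := cC.
    exact: (covered_subset sC (component_covered cC RC mC lt)).
  case=> C /inX cC ->; have [mC m] := max_ribbonP (component_neq0 cC).
  split; first by have [/fsubsetP sC _ _ _] := cC; apply: sC.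
  by apply/asboolP/(component_max cC).
rewrite [RHS]card_in_imfset // => C C' /inX cC /inX cC' e.
have [mC _] := max_ribbonP (component_neq0 cC).
have [mC' _] := max_ribbonP (component_neq0 cC').
apply: (component_same cC cC' mC); rewrite ?e // -?e.
exact: (ribbon_neq0 n0 (component_ribbon cC mC)).
Qed.

End Addable.
End Components.

Lemma in_all_squares Ts x : reflect (exists2 i, (i < size Ts)%N & x \in squares (nth fset0 Ts i))
  (x \in all_squares Ts).
Proof.
rewrite /all_squares; elim: Ts => [|T Ts IH] /=.
  by rewrite big_nil in_fset0; constructor; case.
rewrite big_cons in_fsetU; apply: (iffP orP) => [[xT|/IH[i lt xi]]|[[|i] lt xi]].
- by exists 0%N.
- by exists i.+1.
- by left.
- by right; apply/IH; exists i.
Qed.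

Lemma all_squares_take k Ts x : x \in all_squares (take k Ts) ->
  exists j, [/\ (j < k)%N, (j < size Ts)%N & x \in squares (nth fset0 Ts j)].
Proof.
move=> /in_all_squares[j]; rewrite size_take_min leq_min => /andP[ltj lts].
by rewrite nth_take // => xj; exists j.
Qed.

Lemma all_squares_cons T Ts : all_squares (T :: Ts) = squares T `|` all_squares Ts.
Proof. by rewrite /all_squares big_cons. Qed.

Lemma all_squares_rcons T Ts : all_squares (rcons Ts T) = all_squares Ts `|` squares T.
Proof.
apply/fsetP => x; rewrite in_fsetU; elim: Ts => [|S Ts IH].
  by rewrite /all_squares big_seq1 big_nil in_fset0.
by rewrite rcons_cons !all_squares_cons !in_fsetU IH orbA.
Qed.

(** * Border ribbon strips as chains of valid strips *)

Section Chains.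
Variables (n : nat) (n0 : (0 < n)%N).

(* By [component_max] and [component_covered], the ribbons of B that B does not
   cover are those with the largest tips of their components. *)
Definition valid (A B : ribbons) : Prop :=
  forall R, R \in B -> covered n A (tip R) <-> ~ covered n B (tip R).

(** The last clause of [border_ribbon_strip], with [L] in the role of the shape reached before B.
    Disjointness from [L] holds for parts of B, so [young] replaces [is_skew_shape_over]. *)
Definition obstruction (L : {fset square}) (A B : ribbons) : Prop :=
  forall C, is_component B C ->
    ~ horizontal_strip n (C `|` A) /\
    (forall C' : ribbons, C' `<` C -> horizontal_strip n C' ->
       young (L `|` squares C') -> horizontal_strip n (C' `|` A)).

Lemma obstructionP lam A B : addable n lam A -> addable n (lam `|` squares A) B ->
  obstruction (lam `|` squares A) A B <-> valid A B.
Proof.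
move=> adA adB; split=> [ob|va].
  have key C R : is_component B C -> R \in C -> covered n A (tip R) <->
      forall R', R' \in C -> (tip R' <= tip R)%R.
    move=> cC RC; have [no sub] := ob C cC.
    have adC := component_addable n0 adB cC; have C0 := component_neq0 cC.
    have [M [MC mM adM]] := addable_max n0 adC C0.
    (* The component without its largest ribbon M is an addable proper sub-strip, so A covers none
       of its ribbons; since C as a whole is obstructed, A covers M. *)
    have hM : horizontal_strip n ((C `\ M) `|` A).
      apply: sub; first by rewrite fproperD1.
        by case: adM.
      by case: adM.
    have uncM R' : R' \in C -> covered n A (tip R') -> R' = M.
      move=> R'C; have [//|ne cov] := eqVneq R' M.
      case: (@addable_uncovered n n0 lam A (C `\ M) R') => //.
        by rewrite fsetUC.
      by rewrite in_fsetD1 ne.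
    split=> [cov|mR].
      by rewrite (uncM R RC cov).
    have -> : R = M.
      by apply: (addable_tip_inj n0 adC) => //; apply: le_anti; rewrite mM ?mR.
    apply: contrapT => nc; apply: no; rewrite fsetUC.
    case: (addable_union n0 adA adC) => // R' R'C cov.
    by apply: nc; rewrite -(uncM _ R'C cov).
  move=> R RB; have [C cC RC] := component_exists adB RB.
  rewrite (key C R cC RC); split; first exact: (component_max n0 adB cC).
  move=> nc R' R'C; rewrite leNgt; apply/negP => lt; apply: nc.
  have [sC _ _ _] := cC.
  exact: (covered_subset sC (component_covered n0 adB cC RC R'C lt)).
move=> C cC; have adC := component_addable n0 adB cC; have [sC C0 _ _] := cC.
have [mC mM] := max_ribbonP C0; set M := max_ribbon C in mC mM.
split=> [hs|C' pr hs y].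
  case: (@addable_uncovered n n0 lam A C M) => //; first by rewrite fsetUC.
  by apply/(va _ (fsubsetP sC _ mC)); apply: (component_max n0 adB cC) mM.
have sC' := fproper_sub pr.
have adC' : addable n (lam `|` squares A) C' := addable_sub adC sC' y.
rewrite fsetUC; case: (addable_union n0 adA adC') => // R RC' cov.
have RC := fsubsetP sC' _ RC'.
have nc := (va _ (fsubsetP sC _ RC)).1 cov.
have RM : R = M.
  apply: contrapT => ne; apply: nc; apply: (covered_subset sC).
  apply: (component_covered n0 adB cC RC mC); rewrite lt_neqAle mM // andbT.
  by apply/negP => /eqP e; apply: ne; apply: (addable_tip_inj n0 adC).
subst R; move: pr; rewrite fproperEneq => /andP[/negP + _]; apply.
apply/eqP/fsetP => R; apply/idP/idP => [/(fsubsetP sC')//|RC2].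
(* An addable part C' containing the largest ribbon M is all of C: the missing ribbon R2 of largest
   tip is covered by a ribbon R3 of C of larger tip, which lies in C', and then [addable_lower] puts
   R2 in C'. *)
apply: contrapT => nR.
have [|R2 + mR2] := fset_argmax tip (A := C `\` C').
  by apply/fset0Pn; exists R; rewrite in_fsetD RC2 andbT; apply/negP.
rewrite in_fsetD => /andP[nR2 R2C].
have lt : (tip R2 < tip M)%R.
  rewrite lt_neqAle mM // andbT; apply: contra nR2 => /eqP e.
  by rewrite (addable_tip_inj n0 adC R2C mC e).
have [R3 R3C h3] := component_covered n0 adB cC R2C mC lt.
have R3C' : R3 \in C'.
  apply: contrapT => /negP nR3; have := mR2 R3; rewrite in_fsetD nR3 R3C.
  by move=> /(_ isT); lia.
by case/negP: nR2; apply: (addable_lower n0 adC sC' adC' R3C' R2C); lia.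
Qed.

(** [Ts] continues a border ribbon strip that has reached the shape [lam] and whose latest strip is
    [A]. *)
Fixpoint chain (lam : {fset square}) (A : ribbons) (Ts : seq ribbons) : Prop :=
  if Ts is B :: Ts' then
    [/\ addable n lam B, B != fset0, valid A B & chain (lam `|` squares B) B Ts']
  else True.

Lemma chainP lam A Ts : chain lam A Ts <-> forall i, (i < size Ts)%N ->
  [/\ addable n (lam `|` all_squares (take i Ts)) (nth fset0 Ts i),
      nth fset0 Ts i != fset0 & valid (nth fset0 (A :: Ts) i) (nth fset0 Ts i)].
Proof.
elim: Ts lam A => [|B Ts IH] lam A /=; first by [].
split=> [[adB B0 vB /IH h] [|i] lt|h].
- by split=> //=; rewrite /all_squares big_nil fsetU0.
- by have := h i lt; rewrite all_squares_cons fsetUA.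
have := h 0%N isT; rewrite /= /all_squares big_nil fsetU0 => -[adB B0 vB].
split=> //; apply/IH => i lt.
by have := h i.+1 lt; rewrite /= all_squares_cons fsetUA.
Qed.

(** By validity a ribbon not covered by its own strip is covered by the previous one, and
    connectedness handles the first strip. So below the largest tip every content occurring in the
    shape is followed by the next one. *)
Lemma chain_connected lam A Ts : addable n lam A -> edge_connected (squares A) ->
  A != fset0 -> chain (lam `|` squares A) A Ts -> young (lam `|` all_squares (A :: Ts)) ->
  edge_connected (all_squares (A :: Ts)).
Proof.
move=> adA cA A0 /chainP ch yU.
have {}ch i : (i < (size Ts).+1)%N ->
    [/\ addable n (lam `|` all_squares (take i (A :: Ts))) (nth fset0 (A :: Ts) i),
        nth fset0 (A :: Ts) i != fset0 &
        (0 < i)%N -> valid (nth fset0 (A :: Ts) i.-1) (nth fset0 (A :: Ts) i)].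
  case: i => [|i] lt; first by rewrite /= /all_squares big_nil fsetU0.
  by have [? ? ?] := ch i lt; rewrite [take _ _]/= all_squares_cons fsetUA.
have rib i R : (i < (size Ts).+1)%N -> R \in nth fset0 (A :: Ts) i -> is_ribbon n R.
  by move=> lt; have [ad _ _] := ch i lt; exact: (addable_ribbon ad).
have [mA mM] := max_ribbonP A0; set M := max_ribbon A in mA mM.
(* The last ribbon of a strip is not covered by that strip, so it is covered by the previous strip,
   which has a larger tip: the largest tips decrease along the chain. *)
have le i R : (i < (size Ts).+1)%N -> R \in nth fset0 (A :: Ts) i -> (tip R <= tip M)%R.
  elim: i R => [|i IH] R lt Ri; first exact: mM.
  have [ad ne /(_ isT) va] := ch _ lt.
  have [m1 m2] := max_ribbonP ne; apply: (le_trans (m2 _ Ri)).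
  have [|R' R'i h] := (va _ m1).2.
    by case=> R' R'i h; have := m2 _ R'i; lia.
  by apply: le_trans (IH _ (ltnW lt) R'i); lia.
have dis : [disjoint lam & all_squares (A :: Ts)].
  apply/fdisjointP => x xl; apply/negP => /in_all_squares[i lt].
  have [[_ _ /fdisjointP d _] _ _] := ch i lt; apply/negP/d.
  by rewrite in_fsetU xl.
apply: (@interval_connected _ (tip M)).
- apply: skew_convex; apply/is_skew_shapeP; exists lam, (lam `|` all_squares (A :: Ts)).
  split=> //; [exact: addable_young adA | exact: fsubsetUl |].
  by rewrite fsetDUl fsetDv fset0U; apply/esym/fsetDidPl; rewrite fdisjoint_sym.
- move=> x /in_all_squares[i lt /in_squares[R Ri xR]].
  exact: le_trans (tip_le xR) (le i R lt Ri).
move=> x /in_all_squares[i lt /in_squares[R Ri xR]] ltM.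
suff [j [R' [ltj R'j [y yR' cy]]]] : exists j R', [/\ (j < (size Ts).+1)%N,
    R' \in nth fset0 (A :: Ts) j & exists2 y, y \in R' & content y = (content x + 1)%R].
  exists y => //; apply/in_all_squares; exists j => //.
  by apply/in_squares; exists R'.
have := tip_le xR; rewrite le_eqVlt => /orP[/eqP e|ltx]; last first.
  exists i, R; split=> //; apply/(ribbon_content n0 (rib i R lt Ri)).
  by have := ribbon_content_gt n0 (rib i R lt Ri) xR; lia.
have cov j : (j < (size Ts).+1)%N -> covered n (nth fset0 (A :: Ts) j) (tip R) ->
    exists j R', [/\ (j < (size Ts).+1)%N,
    R' \in nth fset0 (A :: Ts) j & exists2 y, y \in R' & content y = (content x + 1)%R].
  move=> ltj [R' R'j h]; exists j, R'; split=> //.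
  by apply/(ribbon_content n0 (rib j R' ltj R'j)); lia.
have [|nc] := pselect (covered n (nth fset0 (A :: Ts) i) (tip R)); first exact: cov.
case: i lt Ri nc => [|i] lt Ri nc.
  case: nc; apply: (connected_covered n0 _ cA Ri mA); last by rewrite -e.
  by move=> R'; apply: (rib 0%N).
have [_ _ /(_ isT) va] := ch _ lt.
by apply: (cov i (ltnW lt)); apply/(va R Ri).
Qed.

Lemma border_ribbon_stripP mu lam Ts : border_ribbon_strip n mu lam Ts <->
  exists A Ts', [/\ Ts = A :: Ts',
    [/\ addable n (diagram lam) A, A != fset0 & edge_connected (squares A)],
    chain (diagram lam `|` squares A) A Ts' &
    diagram mu = diagram lam `|` all_squares Ts].
Proof.
split.
  case=> [[sub eS eC sz] hT disT [sk cA] ob].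
  case: Ts sz eS hT disT sk cA ob => // A Ts _ eS hT disT sk cA ob.
  have eM : diagram mu = diagram lam `|` all_squares (A :: Ts).
    by rewrite eS /skew_shape fsetUDl fsetDv fsetD0; apply/esym/fsetUidPr.
  have yT i : (i <= (size Ts).+1)%N -> young (diagram lam `|` all_squares (take i (A :: Ts))).
    case: i => [|i] lt; first by rewrite take0 /all_squares big_nil fsetU0; apply: young_diagram.
    by have /is_skew_shape_overP[] := sk i.+1 lt.
  have dis : [disjoint diagram lam & all_squares (A :: Ts)].
    by rewrite eS; apply/fdisjointP => x xl; rewrite /skew_shape in_fsetD xl.
  have ad i : (i < (size Ts).+1)%N ->
      addable n (diagram lam `|` all_squares (take i (A :: Ts))) (nth fset0 (A :: Ts) i).
    move=> lt; have [hi _] := hT i lt; split=> //.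
    - exact: (yT i (ltnW lt)).
    - apply/fdisjointP => x; rewrite in_fsetU => /orP[xl|/all_squares_take[j [ltj _ xj]]].
        apply/negP => xi; have /negP := fdisjointP dis x xl; apply.
        by apply/in_all_squares; exists i.
      have /disT : (j < i < (size Ts).+1)%N by rewrite ltj.
      by move=> /fdisjointP/(_ x xj).
    - by have := yT i.+1 lt; rewrite (take_nth fset0) // all_squares_rcons fsetUA.
  exists A, Ts; split=> //.
    split; [|by have [] := hT 0%N isT|by []].
    by have := ad 0%N isT; rewrite take0 /all_squares big_nil fsetU0.
  apply/chainP => i lt; have := ad i.+1 lt; rewrite [take _ _]/= all_squares_cons fsetUA => adi.
  split=> //; first by have [] := hT i.+1 lt.
  have := ad i (ltnW lt); rewrite [nth _ _ _]/=.
  set L := diagram lam `|` _ => adA.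
  have eL : diagram lam `|` squares A `|` all_squares (take i Ts) =
      L `|` squares (nth fset0 (A :: Ts) i).
    rewrite /L -fsetUA -all_squares_cons -[A :: take i Ts]/(take i.+1 (A :: Ts)).
    by rewrite (take_nth fset0) ?all_squares_rcons ?fsetUA // ltnW.
  apply/(@obstructionP L) => //; first by rewrite -eL.
  move=> C cC; have [no s] := ob i.+1 lt C cC; split=> // C' pr hs yC'.
  apply: s => //; apply/is_skew_shape_overP.
  have eL' : diagram lam `|` all_squares (take i.+1 (A :: Ts)) =
      L `|` squares (nth fset0 (A :: Ts) i).
    by rewrite -eL all_squares_cons fsetUA.
  rewrite fsetUA eL'; split=> //.
  apply/fdisjointP => x xl; rewrite in_fsetU negb_or; apply/andP; split.
    apply: contra (fdisjointP dis x xl) => /all_squares_take[j [_ ltj xj]].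
    by apply/in_all_squares; exists j.
  have sC : C `<=` nth fset0 (A :: Ts) i.+1 by case: cC.
  apply: contra (fdisjointP dis x xl) => xC'; apply/in_all_squares; exists i.+1 => //.
  by apply: (fsubsetP (squares_subset sC)); apply: (fsubsetP (squares_subset (fproper_sub pr))).
move=> [A [Ts' [-> [adA A0 cA] ch eM]]].
have yM : young (diagram lam `|` all_squares (A :: Ts')) by rewrite -eM; apply: young_diagram.
have cM := chain_connected adA cA A0 ch yM; move: ch => /chainP ch.
have ad i : (i < (size Ts').+1)%N ->
    addable n (diagram lam `|` all_squares (take i (A :: Ts'))) (nth fset0 (A :: Ts') i).
  case: i => [|i] lt; first by rewrite /= /all_squares big_nil fsetU0.
  by have [? _ _] := ch i lt; rewrite [take _ _]/= all_squares_cons fsetUA.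
have dis : [disjoint diagram lam & all_squares (A :: Ts')].
  apply/fdisjointP => x xl; apply/negP => /in_all_squares[i lt].
  have [_ _ /fdisjointP d _] := ad i lt; apply/negP/d.
  by rewrite in_fsetU xl.
have eS : all_squares (A :: Ts') = skew_shape mu lam.
  rewrite /skew_shape eM fsetDUl fsetDv fset0U.
  by apply/esym/fsetDidPl; rewrite fdisjoint_sym.
split.
- split=> //; last by rewrite -eS.
  by rewrite /contained eM fsubsetUl.
- move=> i lt; split; first by have [] := ad i lt.
  by case: i lt => // i lt; have [] := ch i lt.
- move=> i j /andP[lti ltj]; apply/fdisjointP => x xi.
  have [_ _ /fdisjointP + _] := ad j ltj; apply; rewrite in_fsetU; apply/orP; right.
  apply/in_all_squares; exists i; first by rewrite size_takel // ltnW.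
  by rewrite nth_take.
- split=> // -[//|i] /andP[_ lt].
  have := ad i lt; rewrite /= => -[_ _ _]; rewrite -fsetUA -all_squares_rcons.
  rewrite -(take_nth fset0) // => yi; apply/is_skew_shape_overP; split=> //.
  apply/fdisjointP => x xl; apply: contra (fdisjointP dis x xl).
  move=> h; have [j [_ ltj xj]] := @all_squares_take i.+1 (A :: Ts') x h.
  by apply/in_all_squares; exists j.
move=> [//|i] /andP[_ lt] A' B' C cC.
have adi := ad i (ltnW lt); set L := _ `|` _ in adi.
have eL : diagram lam `|` all_squares (take i.+1 (A :: Ts')) =
    L `|` squares (nth fset0 (A :: Ts') i).
  by rewrite (take_nth fset0) ?all_squares_rcons ?fsetUA // ltnW.
have adi1 := ad i.+1 lt; rewrite eL in adi1.
have [_ _ va] := ch i lt.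
have ob := (obstructionP adi adi1).2 va.
have [no s] := ob C cC; split=> // C' pr hs /is_skew_shape_overP[_ yC'].
by apply: s => //; rewrite -eL -fsetUA.
Qed.

End Chains.

(** * Cancellation over unions of prefixes of components *)

Local Open Scope ring_scope.

Lemma big_bij (V : nmodType) (I J : eqType) (s : seq I) (t : seq J)
    (P : pred I) (Q : pred J) (F : I -> V) (G : J -> V) (f : I -> J) (g : J -> I) :
  uniq s -> uniq t ->
  (forall i, i \in s -> P i -> [/\ f i \in t, Q (f i), g (f i) = i & F i = G (f i)]) ->
  (forall j, j \in t -> Q j -> [/\ g j \in s, P (g j) & f (g j) = j]) ->
  \sum_(i <- s | P i) F i = \sum_(j <- t | Q j) G j.
Proof.
move=> us ut hf hg; rewrite -big_filter -[RHS]big_filter.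
have -> : \sum_(i <- [seq i <- s | P i]) F i =
    \sum_(j <- [seq f i | i <- [seq i <- s | P i]]) G j.
  rewrite big_map; apply: eq_big_seq => i; rewrite mem_filter => /andP[Pi si].
  by have [_ _ _ ->] := hf i si Pi.
apply: perm_big; apply: uniq_perm.
- rewrite map_inj_in_uniq ?filter_uniq // => i j.
  rewrite !mem_filter => /andP[Pi si] /andP[Pj sj] e.
  by have [_ _ <- _] := hf i si Pi; have [_ _ <- _] := hf j sj Pj; rewrite e.
- exact: filter_uniq.
move=> j; rewrite mem_filter; apply/mapP/andP => [[i]|[Qj tj]].
  by rewrite mem_filter => /andP[Pi si] ->; have [? ? _ _] := hf i si Pi.
have [sg Pg fg] := hg j tj Qj; exists (g j) => //.
by rewrite mem_filter Pg.
Qed.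

Section SignLemma.
Variables (n : nat) (cov : pred int).

Definition closed_in (D B : ribbons) : Prop :=
  forall R R', R \in B -> R' \in D -> tip R - n%:Z <= tip R' < tip R -> R' \in B.

(** For addable D, [prefix_setP] identifies these sets with the sub-strips B of D whose uncovered
    ribbons are exactly those satisfying [cov]. Only the tips matter here, so the cancellation needs
    no geometry. *)
Definition prefix_set (D B : ribbons) : Prop :=
  closed_in D B /\ forall R, R \in B -> cov (tip R) <-> ~ covered n B (tip R).

(** On prefix sets that are strips this is the sign given by the number of components, see
    [prefix_set_sign]. *)
Definition cov_sign (A : pzRingType) (B : ribbons) : A :=
  (-1) ^+ #|` [fset R in B | cov (tip R)]|.

Section Min.
Variables (D : ribbons) (d : {fset square}).
Hypotheses (dD : d \in D) (md : forall R, R \in D -> R != d -> tip d < tip R).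

Lemma covered_removed B c : B `<=` D -> tip d <= c ->
  covered n (B `\ d) c <-> covered n B c.
Proof.
move=> /fsubsetP sB le; split=> [[R /fsetD1P[_ RB] h]|[R RB h]]; exists R => //.
by apply/fsetD1P; split=> //; apply/eqP => e; subst R; lia.
Qed.

(** The ribbon d of least tip covers no tip of D. With d in B, the condition says that B does not
    cover d; without d, closure says the same. So d can be added or removed freely. *)
Lemma prefix_set_toggle B : cov (tip d) -> B `<=` D -> d \in B ->
  prefix_set D B <-> prefix_set D (B `\ d).
Proof.
move=> cd sB dB; have /fsubsetP sb := sB.
have ge R : R \in D -> tip d <= tip R.
  by move=> RD; have [->//|ne] := eqVneq R d; apply/ltW/md.
split=> -[cl va]; split.
- move=> R R' /fsetD1P[ne RB] R'D h; apply/fsetD1P; split; last exact: cl h.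
  apply/eqP => e; subst R'; apply: ((va d dB).1 cd); exists R => //; lia.
- move=> R /fsetD1P[ne RB]; rewrite covered_removed //; first exact: va.
  exact: ge (sb _ RB).
- move=> R R' RB R'D h; have [->//|ne] := eqVneq R' d.
  suff : R' \in B `\ d by move=> /fsetD1P[].
  apply: (cl R) => //; apply/fsetD1P; split=> //; apply/eqP => e; subst R.
  by have := ge _ R'D; lia.
move=> R RB; have [e|ne] := eqVneq R d; last first.
  by rewrite -covered_removed // ?ge ?sb //; apply: va; apply/fsetD1P.
subst R; split=> // _ [R RB' h].
have : d \in B `\ d.
  apply: (cl R) => //; last by lia.
  by apply/fsetD1P; split=> //; apply/eqP => e; subst R; lia.
by rewrite in_fsetD1 eqxx.
Qed.

(** Adds d exactly when closure forces it; inverse to the removal of d when [cov (tip d)] fails. *)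
Definition extend_set (B : ribbons) : ribbons :=
  if `[< covered n B (tip d) >] then d |` B else B.

(** When [cov (tip d)] fails, d belongs to B if and only if B covers its tip, so B is determined by
    its other ribbons. *)
Lemma prefix_set_drop B : ~~ cov (tip d) -> B `<=` D -> prefix_set D B ->
  prefix_set (D `\ d) (B `\ d) /\ extend_set (B `\ d) = B.
Proof.
move=> cd sB [cl va]; have /fsubsetP sb := sB.
have ge R : R \in D -> tip d <= tip R.
  by move=> RD; have [->//|ne] := eqVneq R d; apply/ltW/md.
split; first split.
- move=> R R' /fsetD1P[ne RB] /fsetD1P[ne' R'D] h; apply/fsetD1P; split=> //.
  exact: cl h.
- move=> R /fsetD1P[ne RB]; rewrite covered_removed //; first exact: va.
  exact: ge (sb _ RB).
rewrite /extend_set; case: asboolP => [|nc].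
  rewrite covered_removed // => -[R RB h]; apply: fsetD1K.
  by apply: (cl R) => //; lia.
apply/fsetP => R; rewrite in_fsetD1; have [->|//] := eqVneq R d.
apply/esym/negP => dB; apply: nc; rewrite covered_removed //.
apply: contrapT; move/(va d dB); exact/negP.
Qed.

Lemma prefix_set_extend B : ~~ cov (tip d) -> B `<=` D `\ d ->
  prefix_set (D `\ d) B ->
  [/\ extend_set B `<=` D, prefix_set D (extend_set B) & extend_set B `\ d = B].
Proof.
move=> cd sB [cl va]; have /fsubsetP sb := sB.
have dB : d \notin B by apply/negP => /sb; rewrite in_fsetD1 eqxx.
have sBD : B `<=` D := fsubset_trans sB (fsubD1set _ _).
have ge R : R \in D -> tip d <= tip R.
  by move=> RD; have [->//|ne] := eqVneq R d; apply/ltW/md.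
have sE : extend_set B `<=` D.
  by rewrite /extend_set; case: asboolP => // _; rewrite fsubUset fsub1set dD.
have eE : extend_set B `\ d = B.
  rewrite /extend_set; case: asboolP => _; first exact: fsetU1K.
  by apply/fsetP => R; rewrite in_fsetD1; have [->|//] := eqVneq R d; rewrite (negbTE dB).
have inE R : R \in B -> R \in extend_set B.
  by rewrite -{1}eE => /fsetD1P[].
have covE c : tip d <= c -> covered n (extend_set B) c <-> covered n B c.
  by move=> le; rewrite -covered_removed // eE.
split=> //; split.
- move=> R R' RE R'D h; have [e|ne] := eqVneq R' d.
    subst R'; rewrite /extend_set asboolT ?fset1U1 // -covE // .
    by exists R => //; lia.
  apply: inE; apply: (cl R) => //; last by apply/fsetD1P.
  by rewrite -eE; apply/fsetD1P; split=> //; apply/eqP => e; subst R; have := ge _ R'D; lia.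
move=> R RE; rewrite covE; last exact: ge (fsubsetP sE _ RE).
have [e|ne] := eqVneq R d; last by apply: va; rewrite -eE; apply/fsetD1P.
subst R; move: RE; rewrite /extend_set; case: asboolP => [cv _|]; last by rewrite (negbTE dB).
by rewrite (negbTE cd).
Qed.

End Min.

Lemma cov_sign_toggle (A : pzRingType) B d : d \in B -> cov (tip d) ->
  cov_sign A B = - cov_sign A (B `\ d).
Proof.
move=> dB cd; rewrite /cov_sign (cardfsD1 d) !inE /= dB cd add1n exprS mulN1r.
congr (- (_ ^+ #|` _|)).
by apply/fsetP => R; rewrite !inE /= andbA.
Qed.

Lemma cov_sign_drop (A : pzRingType) B d : ~~ cov (tip d) ->
  cov_sign A B = cov_sign A (B `\ d).
Proof.
move=> cd; rewrite /cov_sign; congr (_ ^+ #|` _|).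
apply/fsetP => R; rewrite !inE /=; have [->|//] := eqVneq R d.
by rewrite (negbTE cd) andbF.
Qed.

Lemma sum_prefix_sets (A : pzRingType) (D : ribbons) :
  {in D &, injective tip} ->
  \sum_(B <- fpowerset D | `[< prefix_set D B >]) cov_sign A B =
  (`[< forall R, R \in D -> ~~ cov (tip R) >])%:R.
Proof.
have [k] := ubnP #|` D|; elim: k D => // k IH D lek inj.
have [->|D0] := eqVneq D fset0.
  rewrite fpowerset0 big_mkcond big_seq_fset1 asboolT.
    rewrite asboolT; last by move=> R; rewrite in_fset0.
    rewrite /cov_sign; suff -> : [fset R in fset0 | cov (tip R)] = fset0 :> ribbons by rewrite cardfs0 expr0.
    by apply/fsetP => R; rewrite !inE.
  by split=> [R R'|R]; rewrite in_fset0.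
have [d dD mx] := fset_argmax (fun R => - tip R) D0.
have md R : R \in D -> R != d -> tip d < tip R.
  move=> RD ne; have := mx R RD; rewrite lerN2 le_eqVlt => /orP[/eqP e|//].
  by case/eqP: ne; apply: inj.
have [cd|ncd] := boolP (cov (tip d)); last first.
  have -> : `[< forall R, R \in D -> ~~ cov (tip R) >] =
      `[< forall R, R \in D `\ d -> ~~ cov (tip R) >].
    apply: asbool_equiv_eq; split=> h R; first by move=> /fsetD1P[_]; exact: h.
    by move=> RD; have [->//|ne] := eqVneq R d; apply: h; apply/fsetD1P.
  rewrite -IH; first last.
  - by move=> R R' /fsetD1P[_ RD] /fsetD1P[_ RD']; apply: inj.
  - by have := cardfsD1 d D; rewrite dD; lia.
  apply: (@big_bij _ _ _ _ _ _ _ _ _ (fun B => B `\ d) (extend_set d)); rewrite ?fset_uniq //.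
    move=> B; rewrite !fpowersetE => sB /asboolP gB.
    have [g1 g2] := prefix_set_drop dD md ncd sB gB; split=> //.
    - exact: fsetSD.
    - exact/asboolP.
    - exact: cov_sign_drop.
  move=> B; rewrite !fpowersetE => sB /asboolP gB.
  by have [? ? ?] := prefix_set_extend dD md ncd sB gB; split=> //; apply/asboolP.
rewrite asboolF => [|h]; last by have := h d dD; rewrite cd.
rewrite (bigID (fun B : ribbons => d \in B)) /=.
rewrite [X in X + _](_ : _ = - \sum_(B <- fpowerset D | `[< prefix_set D B >] && (d \notin B)) cov_sign A B).
  by rewrite addNr.
rewrite -sumrN.
apply: (@big_bij _ _ _ _ _ _ _ _ _ (fun B => B `\ d) (fun B => d |` B)); rewrite ?fset_uniq //.
  move=> B; rewrite !fpowersetE => sB /andP[/asboolP gB dB]; split=> //.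
  - exact: fsubset_trans (fsubD1set _ _) sB.
  - by rewrite in_fsetD1 eqxx andbT; apply/asboolP; exact: ((prefix_set_toggle dD md cd sB dB).1 gB).
  - exact: fsetD1K.
  - exact: cov_sign_toggle.
move=> B; rewrite !fpowersetE => sB /andP[/asboolP gB dB]; split=> //.
- by rewrite fsubUset fsub1set dD.
- rewrite fset1U1 andbT; apply/asboolP.
  have sU : d |` B `<=` D by rewrite fsubUset fsub1set dD.
  by apply: ((prefix_set_toggle dD md cd sU (fset1U1 _ _)).2 _); rewrite fsetU1K.
- exact: fsetU1K.
Qed.

End SignLemma.

(** * The Murnaghan-Nakayama identity *)

Lemma big_fset_split (V : nmodType) (I : choiceType) (B D : {fset I}) (F : I -> V) :
  B `<=` D -> \sum_(i <- D) F i = \sum_(i <- B) F i + \sum_(i <- D `\` B) F i.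
Proof.
move=> /fsubsetP sub; rewrite -big_cat; apply: perm_big; apply: uniq_perm.
- exact: fset_uniq.
- rewrite cat_uniq !fset_uniq andbT; apply/hasPn => x /=; rewrite in_fsetD.
  by case/andP.
by move=> x; rewrite mem_cat in_fsetD; have := sub x; case: (x \in B) => //= ->.
Qed.

Lemma spins_split (B D : ribbons) : B `<=` D -> spins D = (spins B + spins (D `\` B))%N.
Proof. exact: big_fset_split. Qed.

Lemma card_split (I : choiceType) (B D : {fset I}) : B `<=` D ->
  #|` D| = (#|` B| + #|` D `\` B|)%N.
Proof.
move=> sub; rewrite cardfsD (fsetIidPr sub); have := fsubset_leq_card sub; lia.
Qed.

Section Merging.
Variables (n : nat) (n0 : (0 < n)%N) (F : fieldType) (q : F).
Variables (M : {fset square}).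

(** [M] is the common top shape, so that all sums over strips run over one finite set. *)
Let U : {fset ribbons} := fpowerset (fpowerset M).

Lemma in_strips T : (T \in U) = (squares T `<=` M).
Proof.
rewrite fpowersetE; apply/fsubsetP/fsubsetP => sub.
  by move=> x /in_squares[R /sub]; rewrite fpowersetE => /fsubsetP; apply.
move=> R RT; rewrite fpowersetE; apply/fsubsetP => x xR.
by apply: sub; apply/in_squares; exists R.
Qed.

Definition strip_to (L : {fset square}) (k : nat) (T : ribbons) : Prop :=
  [/\ addable n L T, L `|` squares T = M & #|` T| = k].

Definition strip_sum L k : F :=
  \sum_(T <- U | `[< strip_to L k T >]) q ^+ spins T.

(** [f] is fuel for the number of strips and [k] bounds the number of ribbons. As the strips are
    nonempty, k <= f loses nothing, see [in_sequences]. *)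
Fixpoint sequences (f k : nat) : seq (seq ribbons) :=
  if f is f'.+1 then
    [::] :: [seq B :: Ts | B : ribbons <- [seq B : ribbons <- U | (B != fset0) && (#|` B| <= k)%N],
                           Ts : seq ribbons <- sequences f' (k - #|` B|)]
  else [:: [::]].

(** The weight of the strips after the first one: the -1 in [border_height] cancels the single
    component of the first strip. *)
Definition signed_weight (Ts : seq ribbons) : F :=
  (-1) ^+ (\sum_(T <- Ts) ncomponents T) * q ^+ border_spin Ts.

(** The coefficient from [L] to [M] of H Z(A) in degree k, for chains of at most f strips. *)
Definition chain_sum f (L : {fset square}) (A : ribbons) k : F :=
  \sum_(Ts <- sequences f k | `[< chain n L A Ts >])
    signed_weight Ts * strip_sum (L `|` all_squares Ts) (k - border_size Ts).

Lemma chain_sumS f L A k : chain_sum f.+1 L A k = strip_sum L k +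
  \sum_(B <- U | [&& B != fset0, (#|` B| <= k)%N & `[< addable n L B /\ valid n A B >]])
    (-1) ^+ ncomponents B * q ^+ spins B *
    chain_sum f (L `|` squares B) B (k - #|` B|).
Proof.
rewrite /chain_sum big_cons asboolT // /signed_weight /border_spin /border_size.
rewrite !big_nil !expr0 !mul1r /all_squares big_nil fsetU0 subn0; congr (_ + _).
rewrite big_mkcond big_allpairs_dep big_filter.
rewrite [LHS]big_mkcond [RHS]big_mkcond; apply: eq_bigr => B _.
rewrite andbA; case: ifP => //= /andP[B0 leB].
case: asboolP => [[adB vB]|nB]; last first.
  by apply: big1 => Ts _; rewrite asboolF // => -[adB _ vB _]; apply: nB.
rewrite mulr_sumr [RHS]big_mkcond; apply: eq_bigr => Ts _.
have -> : `[< chain n L A (B :: Ts) >] = `[< chain n (L `|` squares B) B Ts >].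
  by apply: asbool_equiv_eq; split=> [[]|].
case: ifP => // _.
rewrite !big_cons fsetUA exprD exprD subnDA.
by rewrite !mulrA; congr (_ * _ * _); rewrite -!mulrA; congr (_ * _); rewrite mulrC.
Qed.

Lemma strip_toP L B k C : B `<=` C -> addable n L B -> 
  strip_to L k C /\ (forall R, R \in C `\` B -> ~ covered n B (tip R)) <->
  [/\ addable n (L `|` squares B) (C `\` B), L `|` squares B `|` squares (C `\` B) = M,
      (#|` B| + #|` C `\` B|)%N = k & forall R, R \in C `\` B -> ~ covered n B (tip R)].
Proof.
move=> sub adB; have eC : squares B `|` squares (C `\` B) = squares C.
  rewrite -squaresU; congr squares; apply/fsetP => R; rewrite in_fsetU in_fsetD.
  by have /fsubsetP/(_ R) := sub; case: (R \in B) => // ->.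
rewrite -card_split // -fsetUA eC; split=> [[[adC eM ck] un]|[adC eM ck un]].
  by split=> //; apply: addable_diff.
split=> //; split=> //.
have -> : C = B `|` (C `\` B); last exact: addable_union.
apply/fsetP => R; rewrite in_fsetU in_fsetD.
by have /fsubsetP/(_ R) := sub; case: (R \in B) => // ->.
Qed.

Lemma prefix_setP (cov : pred int) L D B : addable n L D -> B `<=` D ->
  prefix_set n cov D B <-> addable n L B /\
    forall R, R \in B -> cov (tip R) <-> ~ covered n B (tip R).
Proof.
move=> adD sB; split=> -[h1 h2]; split=> //; first exact: addable_closed h1.
by move=> R R' RB R'D h; apply: (addable_lower n0 adD sB h1 RB R'D h).
Qed.

Lemma prefix_set_uncovered (cov : pred int) L D B : addable n L D -> B `<=` D ->
  prefix_set n cov D B -> forall R, R \in D `\` B -> ~ covered n B (tip R).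
Proof.
move=> adD sB [cl va] R /fsetDP[RD /negP nRB] [R' R'B h]; apply: nRB.
by apply: (cl R') => //; lia.
Qed.

Lemma prefix_set_sign (cov : pred int) L B : addable n L B ->
  (forall R, R \in B -> cov (tip R) <-> ~ covered n B (tip R)) ->
  (-1) ^+ ncomponents B = cov_sign cov F B.
Proof.
move=> adB va; rewrite /cov_sign (ncomponentsE n0 adB); congr (_ ^+ #|` _|).
apply/fsetP => R; rewrite !inE /=; have [RB|//] := boolP (R \in B).
apply/idP/idP => [/asboolPn h|cR]; first exact: (va R RB).2.
by apply/asboolPn; exact: (va R RB).1.
Qed.


(** The strips counted by H^A. *)
Definition uncovered_to (A : ribbons) L k T : Prop :=
  strip_to L k T /\ forall R, R \in T -> ~ covered n A (tip R).

Definition uncovered_sum (A : ribbons) L k : F :=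
  \sum_(T <- U | `[< uncovered_to A L k T >]) q ^+ spins T.

Lemma strip_to_in L k T : strip_to L k T -> T \in U.
Proof. by case=> _ eM _; rewrite in_strips -[X in _ `<=` X]eM fsubsetUr. Qed.

(* Merging a strip B with a strip C above it that B does not cover gives a
   strip D = B u C, in which B is a union of prefixes of components. *)
Lemma merge_sum (P : ribbons -> bool) (G : ribbons -> F) L k :
  (forall B, P B -> addable n L B) ->
  \sum_(B <- U | P B && (#|` B| <= k)%N)
    G B * q ^+ spins B * uncovered_sum B (L `|` squares B) (k - #|` B|) =
  \sum_(D <- U | `[< strip_to L k D >]) q ^+ spins D *
    \sum_(B <- fpowerset D | P B && `[< forall R, R \in D `\` B -> ~ covered n B (tip R) >]) G B.
Proof.
move=> adP.
pose cl D B := `[< forall R, R \in D `\` B -> ~ covered n B (tip R) >].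
have step B : P B && (#|` B| <= k)%N ->
    G B * q ^+ spins B * uncovered_sum B (L `|` squares B) (k - #|` B|) =
    \sum_(D <- U | `[< strip_to L k D >] && ((B `<=` D) && cl D B)) q ^+ spins D * G B.
  move=> /andP[PB leB]; have adB := adP _ PB.
  rewrite /uncovered_sum mulr_sumr.
  apply: (@big_bij _ _ _ _ _ _ _ _ _ (fun C => B `|` C) (fun D => D `\` B)); rewrite ?fset_uniq //.
    move=> C _ /asboolP[sC unC].
    have dis : (B `|` C) `\` B = C.
      apply/fsetP => R; rewrite in_fsetD in_fsetU; have [RB|] := boolP (R \in B) => //=.
      apply/esym/negP => RC; have [[adC _ _] _] := (sC, RC).
      have /fset0Pn[x xR] := ribbon_neq0 n0 (addable_ribbon adB RB).
      have /negP := addable_notin adC RC xR; apply; rewrite in_fsetU; apply/orP; right.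
      by apply/in_squares; exists R.
    have [sBC unBC] : strip_to L k (B `|` C) /\
        (forall R, R \in (B `|` C) `\` B -> ~ covered n B (tip R)).
      apply/(strip_toP _ (fsubsetUl _ _) adB); rewrite dis.
      by case: sC => adC eM cC; split=> //; rewrite cC subnKC.
    split=> //; first exact: strip_to_in sBC.
      apply/andP; split; first exact/asboolP.
      by rewrite fsubsetUl; apply/asboolP.
    by rewrite (@spins_split B (B `|` C)) ?fsubsetUl // dis exprD -mulrA [LHS]mulrC.
  move=> D _ /andP[/asboolP sD /andP[sub /asboolP unD]].
  have [adC eM ck _] := (strip_toP k sub adB).1 (conj sD unD).
  have sC : strip_to (L `|` squares B) (k - #|` B|) (D `\` B).
    by split=> //; rewrite -ck addKn.
  split; [exact: strip_to_in sC | exact/asboolP |].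
  apply/fsetP => R; rewrite in_fsetU in_fsetD.
  by have /fsubsetP/(_ R) := sub; case: (R \in B) => // ->.
rewrite (eq_bigr _ step).
rewrite (exchange_big_dep (fun D => `[< strip_to L k D >])) /=; last first.
  by move=> B D _ /andP[].
apply: eq_bigr => D /asboolP sD; rewrite mulr_sumr.
apply: (@big_bij _ _ _ _ _ _ _ _ _ id id); rewrite ?fset_uniq //.
  move=> B _ /andP[/andP[PB _] /and3P[_ sB cB]]; rewrite fpowersetE PB; split=> //.
move=> B; rewrite fpowersetE => sB /andP[PB cB]; split=> //.
  rewrite in_strips; apply: (fsubset_trans (squares_subset sB)).
  by rewrite -in_strips; apply: strip_to_in sD.
apply/andP; split; last by apply/and3P; split=> //; exact/asboolP.
by rewrite PB; case: sD => _ _ <-; apply: fsubset_leq_card.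
Qed.

(** The identity H Z(A) = H^A, by induction on the fuel: after a next strip B the sum is H^B, and
    [merge_sum] turns B and the strip above it into one strip D, where [sum_prefix_sets] applies. *)
Lemma chain_sumE f L A k : young L -> (k <= f)%N ->
  chain_sum f L A k = uncovered_sum A L k.
Proof.
elim: f L A k => [|f IH] L A k yL lek.
  move: lek; rewrite leqn0 => /eqP ->; rewrite /chain_sum /= big_mkcond big_seq1 asboolT //.
  rewrite /signed_weight /border_spin /border_size !big_nil !expr0 !mul1r.
  rewrite /all_squares big_nil fsetU0; apply: eq_bigl => T; apply: asbool_equiv_eq.
  split=> [sT|[]//]; split=> // R RT; have [_ _ /eqP] := sT.
  by rewrite cardfs_eq0 => /eqP e; rewrite e in_fset0 in RT.
rewrite chain_sumS.
pose P B := (B != fset0) && `[< addable n L B /\ valid n A B >].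
have adP B : P B -> addable n L B by move=> /andP[_ /asboolP[]].
rewrite (eq_bigl (fun B => P B && (#|` B| <= k)%N)); last first.
  by move=> B; rewrite /P -andbA [X in _ && X]andbC.
have -> : \sum_(B <- U | P B && (#|` B| <= k)%N)
     (-1) ^+ ncomponents B * q ^+ spins B * chain_sum f (L `|` squares B) B (k - #|` B|) =
  \sum_(B <- U | P B && (#|` B| <= k)%N)
     (-1) ^+ ncomponents B * q ^+ spins B * uncovered_sum B (L `|` squares B) (k - #|` B|).
  apply: eq_bigr => B /andP[PB leB]; rewrite IH //; first by case: (adP _ PB).
  have : (0 < #|` B|)%N by move: PB => /andP[]; rewrite -cardfs_gt0.
  by lia.
rewrite merge_sum // /strip_sum -big_split /=.
rewrite /uncovered_sum (eq_bigr (fun D => q ^+ spins D *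
    (`[< forall R, R \in D -> ~~ `[< covered n A (tip R) >] >])%:R)).
  rewrite [RHS]big_mkcond [LHS]big_mkcond; apply: eq_bigr => D _.
  have [sD|nD] := asboolP (strip_to L k D); last first.
    by rewrite asboolF // => -[].
  case: asboolP => [un|nun].
    rewrite asboolT ?mulr1 //; split=> // R RD; exact/asboolPn/(un R RD).
  rewrite asboolF ?mulr0 // => -[_ un]; apply: nun => R RD.
  by apply/asboolPn; exact: un.
move=> D /asboolP[adD eM ck].
pose cov := [pred c | `[< covered n A c >]].
have inj : {in D &, injective tip} by move=> R R'; apply: (addable_tip_inj n0 adD).
rewrite -(sum_prefix_sets n cov _ inj) -[X in X + _]mulr1 -mulrDr; congr (_ * _).
(* The empty prefix set has sign 1 and stands for the empty chain; the nonempty ones are the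
   possible next strips B. *)
rewrite [RHS]big_mkcond (bigD1_seq fset0) ?fset_uniq ?fpowersetE ?fsub0set //=.
have p0 : prefix_set n cov D fset0 by split=> [R R'|R]; rewrite in_fset0.
rewrite asboolT //; have -> : cov_sign cov F fset0 = 1.
  rewrite /cov_sign; suff -> : [fset R in fset0 | cov (tip R)] = fset0 :> ribbons.
    by rewrite cardfs0 expr0.
  by apply/fsetP => R; rewrite !inE.
congr (_ + _); rewrite -[RHS]big_mkcondr.
have covP B : (forall R, R \in B -> cov (tip R) <-> ~ covered n B (tip R)) <-> valid n A B.
  split=> va R RB; first by rewrite -(va R RB); apply: (rwP (asboolP _)).
  by rewrite -(va R RB); apply: iff_sym; apply: (rwP (asboolP _)).
apply: (@big_bij _ _ _ _ _ _ _ _ _ id id); rewrite ?fset_uniq //.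
  move=> B; rewrite fpowersetE => sB /andP[/andP[B0 /asboolP[adB /covP va]] _].
  split=> //; last exact: (prefix_set_sign adB va).
  by rewrite B0; apply/asboolP; apply: (prefix_setP _ adD sB).2; split=> //; apply/covP.
move=> B; rewrite fpowersetE => sB /andP[B0 /asboolP pB].
have [adB va] := (prefix_setP _ adD sB).1 pB.
split=> //; apply/andP; split.
  by rewrite /P B0; apply/asboolP; split=> //; apply/covP.
by apply/asboolP; apply: (prefix_set_uncovered adD sB pB).
Qed.


End Merging.

(** * The sum over the first strip *)

Section Root.
Variables (n : nat) (n0 : (0 < n)%N) (F : fieldType) (q : F).

(** That R is the only uncovered ribbon of B means that B is a single component with largest ribbon
    R. *)
Lemma prefix_set_rootP L (D B : ribbons) R : addable n L D -> B `<=` D -> R \in D ->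
  B != fset0 /\ prefix_set n (pred1 (tip R)) D B <->
  [/\ B != fset0, addable n L B, edge_connected (squares B) & max_ribbon B = R].
Proof.
move=> adD sB RD; have /fsubsetP sb := sB.
have ribD R' : R' \in B -> is_ribbon n R' by move=> /sb; apply: (addable_ribbon adD).
split=> [[B0 pB]|[B0 adB cB eR]]; last first.
  have [mB mx] := max_ribbonP B0; rewrite eR in mB mx.
  split=> //; apply/(prefix_setP n0 _ adD sB); split=> // R' RB /=.
  split=> [/eqP e [R2 R2B h]|nc]; first by have := mx _ R2B; lia.
  have [//|ne] := eqVneq (tip R') (tip R); case: nc.
  by apply: (connected_covered n0 ribD cB RB mB); rewrite lt_neqAle ne mx.
have [adB va] := (prefix_setP n0 _ adD sB).1 pB.
have [mB mx] := max_ribbonP B0.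
have eR : max_ribbon B = R.
  apply: (addable_tip_inj n0 adD) => //; first exact: sb.
  suff nc : ~ covered n B (tip (max_ribbon B)) by apply/eqP; exact: ((va _ mB).2 nc).
  by case=> R' R'B h; have := mx _ R'B; lia.
split=> //; rewrite eR in mB mx; apply: (@interval_connected _ (tip R)).
- exact: (addable_convex adB).
- by move=> x /in_squares[R' R'B xR]; apply: le_trans (tip_le xR) (mx _ R'B).
move=> x /in_squares[R' R'B xR] lt.
have := tip_le xR; rewrite le_eqVlt => /orP[/eqP e|ltx].
  rewrite e; apply: (content_covered n0 ribD); apply: contrapT => nc.
  by have /eqP e' := (va _ R'B).2 nc; rewrite -e' e ltxx in lt.
have [|y yR cy] := (ribbon_content n0 (ribD _ R'B) (content x + 1)%R).2.
  by have := ribbon_content_gt n0 (ribD _ R'B) xR; lia.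
by exists y => //; apply/in_squares; exists R'.
Qed.

(** Sort the sets B by their largest ribbon R. For [cov] equal to [pred1 (tip R)] the sum of
    [sum_prefix_sets] is 0; the empty set contributes 1 and each such B contributes -1, so their
    number is 1 in F. *)
Lemma count_roots L (D : ribbons) : addable n L D ->
  \sum_(B <- fpowerset D | [&& B != fset0, `[< addable n L B /\ edge_connected (squares B) >] &
      `[< forall R, R \in D `\` B -> ~ covered n B (tip R) >]]) (1 : F) = #|` D|%:R.
Proof.
move=> adD; have inj : {in D &, injective tip} by move=> R R'; apply: (addable_tip_inj n0 adD).
transitivity (\sum_(B <- fpowerset D | [&& B != fset0,
    `[< addable n L B /\ edge_connected (squares B) >] &
      `[< forall R, R \in D `\` B -> ~ covered n B (tip R) >]])
   \sum_(R <- D | max_ribbon B == R) (1 : F)).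
  rewrite [LHS]big_seq_cond [RHS]big_seq_cond; apply: eq_bigr => B.
  rewrite fpowersetE => /andP[/fsubsetP sB /andP[/max_ribbonP[mB _] _]].
  rewrite big_mkcond (bigD1_seq (max_ribbon B)) ?fset_uniq ?sB //= eqxx.
  by rewrite big1 ?addr0 // => R ne; rewrite eq_sym (negbTE ne).
rewrite (exchange_big_dep xpredT) //=.
rewrite -sum1_size natr_sum big_seq [RHS]big_seq; apply: eq_bigr => R RD.
have := sum_prefix_sets n (pred1 (tip R)) F inj.
rewrite asboolF => [|h]; last by have := h R RD; rewrite /= eqxx.
rewrite big_mkcond (bigD1_seq fset0) ?fset_uniq ?fpowersetE ?fsub0set //=.
have p0 : prefix_set n (pred1 (tip R)) D fset0 by split=> [R1 R2|R1]; rewrite in_fset0.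
rewrite asboolT // /cov_sign.
have -> : [fset R' in fset0 | pred1 (tip R) (tip R')] = fset0 :> ribbons.
  by apply/fsetP => R'; rewrite !inE.
rewrite cardfs0 expr0 => /eqP; rewrite addrC addr_eq0 => /eqP e.
apply: oppr_inj; rewrite -[RHS]e -big_mkcondr -sumrN.
apply: (@big_bij _ _ _ _ _ _ _ _ _ id id); rewrite ?fset_uniq //.
  move=> B; rewrite fpowersetE => sB /andP[/and3P[B0 /asboolP[adB cB] _] /eqP eR].
  have [_ pB] := (prefix_set_rootP adD sB RD).2 (And4 B0 adB cB eR).
  split=> //; first by rewrite B0; apply/asboolP.
  have [mB _] := max_ribbonP B0; rewrite eR in mB.
  have -> : [fset R' in B | pred1 (tip R) (tip R')] = [fset R].
    apply/fsetP => R'; rewrite !inE /=; apply/andP/eqP => [[RB /eqP et]|->].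
      by apply: inj => //; apply: (fsubsetP sB).
    by rewrite mB eqxx.
  by rewrite cardfs1 expr1.
move=> B; rewrite fpowersetE => sB /andP[B0 /asboolP pB].
have [_ adB cB eR] := (prefix_set_rootP adD sB RD).1 (conj B0 pB).
split=> //; rewrite eR eqxx andbT B0 /=; apply/andP; split; first exact/asboolP.
by apply/asboolP; apply: (prefix_set_uncovered n0 adD sB pB).
Qed.

Lemma root_sum M f L m : young L -> (m <= f)%N ->
  \sum_(A <- fpowerset (fpowerset M) | [&& A != fset0, (#|` A| <= m)%N &
     `[< addable n L A /\ edge_connected (squares A) >]])
    q ^+ spins A * chain_sum n q M f (L `|` squares A) A (m - #|` A|) =
  m%:R * strip_sum n q M L m.
Proof.
move=> yL lem.
pose P A := (A != fset0) && `[< addable n L A /\ edge_connected (squares A) >].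
have adP A : P A -> addable n L A by move=> /andP[_ /asboolP[]].
rewrite (eq_bigl (fun A => P A && (#|` A| <= m)%N)); last first.
  by move=> A; rewrite /P -andbA [X in _ && X]andbC.
transitivity (\sum_(A <- fpowerset (fpowerset M) | P A && (#|` A| <= m)%N)
    1 * q ^+ spins A * uncovered_sum n q M A (L `|` squares A) (m - #|` A|)).
  apply: eq_bigr => A /andP[PA leA]; rewrite mul1r (chain_sumE n0) //; last by lia.
  by case: (adP _ PA).
rewrite (merge_sum n0 q M _ _ adP) /strip_sum mulr_sumr; apply: eq_bigr => D.
move=> /asboolP[adD _ cD]; rewrite mulrC; congr (_ * _); rewrite -[in RHS]cD -(count_roots adD).
by apply: eq_bigl => B; rewrite /P andbA.
Qed.

End Root.

(** Turns the choice of the unique tiling in [Kcoef] and [Lcoef] into a sum, which can then be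
    exchanged with other sums. *)
Lemma sum_unique (V : nmodType) (I : choiceType) (U : {fset I}) (P : I -> Prop) (f : I -> V) :
  (forall i, P i -> i \in U) -> (forall i j, P i -> P j -> i = j) ->
  (if pselect (exists i, P i) is left e then f (projT1 (cid e)) else 0) =
  \sum_(i <- U | `[< P i >]) f i.
Proof.
move=> sub uni; case: pselect => [e|ne]; last first.
  by rewrite big1 // => i /asboolP Pi; case: ne; exists i.
case: cid => i Pi /=; rewrite big_mkcond (bigD1_seq i) ?fset_uniq ?sub //=.
rewrite asboolT // big1 ?addr0 // => j ne; rewrite asboolF // => Pj.
by case/eqP: ne; apply: uni.
Qed.

(** * The coefficients as sums over strips and sequences *)

Section Link.
Variables (n : nat) (n0 : (0 < n)%N) (F : fieldType) (q : F).

Lemma has_shapeP mu lam T : has_shape mu lam T <->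
  [disjoint diagram lam & squares T] /\ diagram mu = diagram lam `|` squares T.
Proof.
rewrite /has_shape /contained /skew_shape; split=> [[sub ->]|[dis ->]]; split.
- by apply/fdisjointP => x xl; rewrite in_fsetD xl.
- by rewrite fsetUDl fsetDv fsetD0; apply/esym/fsetUidPr.
- exact: fsubsetUl.
- by rewrite fsetDUl fsetDv fset0U; apply/esym/fsetDidPl; rewrite fdisjoint_sym.
Qed.

Lemma horizontal_strip_ofP mu lam k T : horizontal_strip_of n mu lam k T <->
  strip_to n (diagram mu) (diagram lam) k T.
Proof.
split=> [[hT /has_shapeP[dis eM] cT]|[[yl hT dis yU] eM cT]].
  split=> //; split=> //; first exact: young_diagram.
  by rewrite -eM; apply: young_diagram.
by split=> //; apply/has_shapeP.
Qed.

Lemma strip_to_unique M L k T T' : strip_to n M L k T -> strip_to n M L k T' -> T = T'.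
Proof.
move=> [ad e _] [ad' e' _]; apply: (addable_unique n0 ad ad').
have h D : [disjoint L & squares D] -> L `|` squares D = M -> squares D = M `\` L.
  move=> dis <-; rewrite fsetDUl fsetDv fset0U; apply/esym/fsetDidPl.
  by rewrite fdisjoint_sym.
by case: ad => _ _ d _; case: ad' => _ _ d' _; rewrite (h T) // (h T').
Qed.

Lemma KcoefE mu lam k :
  Kcoef q n mu lam k = strip_sum n q (diagram mu) (diagram lam) k.
Proof.
rewrite /Kcoef (@sum_unique _ _ (fpowerset (fpowerset (diagram mu))) _ (fun T => q ^+ spins T)).
- rewrite /strip_sum; apply: eq_bigl => T; apply: asbool_equiv_eq.
  exact: horizontal_strip_ofP.
- by move=> T /horizontal_strip_ofP; apply: strip_to_in.
- by move=> T T' /horizontal_strip_ofP s /horizontal_strip_ofP; apply: strip_to_unique.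
Qed.

Lemma strip_sum0 M L k : (forall T, ~ strip_to n M L k T) -> strip_sum n q M L k = 0.
Proof. by move=> h; rewrite /strip_sum big1 // => T /asboolP/h. Qed.

Section Sequences.
Variable M : {fset square}.

Lemma sequencesS f k : sequences M f.+1 k = [::] ::
  [seq B :: Ts | B : ribbons <- [seq B : ribbons <- fpowerset (fpowerset M) |
                    (B != fset0) && (#|` B| <= k)%N],
                 Ts : seq ribbons <- sequences M f (k - #|` B|)].
Proof. by []. Qed.

Lemma in_sequencesS f k Ts : Ts \in sequences M f.+1 k <-> Ts = [::] \/
  exists B Ts', [/\ Ts = B :: Ts', B != fset0, (#|` B| <= k)%N, squares B `<=` M &
    Ts' \in sequences M f (k - #|` B|)].
Proof.
rewrite sequencesS inE; split=> [/orP[/eqP ->|]|]; first by left.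
  move=> /flatten_mapP[B + /mapP[Ts' inT ->]].
  by rewrite mem_filter in_strips => /andP[/andP[B0 le] sB]; right; exists B, Ts'.
case=> [->//|[B [Ts' [-> B0 le sB inT]]]]; apply/orP; right.
apply/flatten_mapP; exists B; first by rewrite mem_filter in_strips B0 le.
by apply/mapP; exists Ts'.
Qed.

Lemma sequences_size f k Ts : Ts \in sequences M f k -> (border_size Ts <= k)%N.
Proof.
elim: f k Ts => [|f IH] k Ts.
  by rewrite inE => /eqP ->; rewrite /border_size big_nil.
move=> /in_sequencesS[->|[B [Ts' [-> _ leB _ /IH]]]]; rewrite /border_size.
  by rewrite big_nil.
by rewrite big_cons; lia.
Qed.

Lemma in_sequences f k Ts : (forall T, T \in Ts -> T != fset0 /\ squares T `<=` M) ->
  (border_size Ts <= k <= f)%N -> Ts \in sequences M f k.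
Proof.
elim: f k Ts => [|f IH] k [|B Ts] h le; rewrite ?mem_head //.
  have [B0 _] := h B (mem_head _ _); move: le; rewrite /border_size big_cons.
  by move: B0; rewrite -cardfs_gt0; lia.
apply/in_sequencesS; right; have [B0 sB] := h B (mem_head _ _).
move: le; rewrite /border_size big_cons => le; have := B0; rewrite -cardfs_gt0 => B1.
exists B, Ts; split=> //; first by lia.
apply: IH => [T TT|]; first by apply: h; rewrite inE TT orbT.
by rewrite /border_size; lia.
Qed.

Lemma sequences_uniq f k : uniq (sequences M f k).
Proof.
elim: f k => // f IH k; rewrite sequencesS cons_uniq; apply/andP; split.
  by apply/negP => /flatten_mapP[B _ /mapP[]].
apply: (@allpairs_uniq_dep _ (fun=> _)) => [|B _|]; [exact/filter_uniq/fset_uniq | exact: IH |].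
move=> [B Ts] [B' Ts'] _ _ /= [eB eT]; subst B'; by rewrite eT.
Qed.

End Sequences.

Lemma border_strips_in mu lam Ts m : border_ribbon_strip n mu lam Ts ->
  (border_size Ts <= m)%N -> Ts \in sequences (diagram mu) m.+1 m.
Proof.
move=> [[_ eS _ _] hT _ _ _] le; apply: in_sequences; last by rewrite le leqnSn.
move=> T /(nthP fset0)[i lt <-]; have [_ ne] := hT i lt; split=> //.
apply/fsubsetP => x xT; have : x \in all_squares Ts by apply/in_all_squares; exists i.
by rewrite eS /skew_shape in_fsetD => /andP[].
Qed.

Lemma sequences_mono M M' f k Ts : M `<=` M' -> Ts \in sequences M f k ->
  (k <= f)%N -> Ts \in sequences M' f k.
Proof.
move=> sM /[dup] /sequences_size le inT lef; apply: in_sequences; last by rewrite le.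
elim: f k Ts inT {le lef} => [|f IH] k Ts; first by rewrite inE => /eqP ->.
move=> /in_sequencesS[->//|[B [Ts' [-> B0 _ sB inT]]]] T.
rewrite inE => /orP[/eqP ->|]; last exact: IH inT T.
by split=> //; apply: fsubset_trans sM.
Qed.

(** One index set serves all [nu] and k. Its fuel is m.+1, so that fuel m remains after the first
    strip is split off. *)
Lemma XcoefE nu lam k m M : diagram nu `<=` M -> (k <= m)%N ->
  Xcoef q n nu lam k = \sum_(Ts <- sequences M m.+1 m |
      `[< border_ribbon_strip n nu lam Ts /\ border_size Ts = k >])
    (-1) ^+ border_height Ts * q ^+ border_spin Ts.
Proof.
move=> sM lek; rewrite bigfs ?sequences_uniq //.
  rewrite /Xcoef; apply: eq_fsbigl; apply/seteqP; split=> Ts /=.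
    by move=> h; apply/asboolP.
  by move/asboolP.
move=> Ts /asboolP[bT eT] /negP[]; apply: (sequences_mono sM) => //.
by apply: (border_strips_in bT); rewrite eT.
Qed.

Lemma ncomponents_connected L A : addable n L A -> A != fset0 ->
  edge_connected (squares A) -> ncomponents A = 1%N.
Proof.
move=> adA A0 cA; rewrite (ncomponentsE n0 adA); have [mA mx] := max_ribbonP A0.
rewrite -(cardfs1 (max_ribbon A)); congr #|` _|; apply/fsetP => R; rewrite !inE /=.
apply/andP/eqP => [[RA /asboolPn nc]|->].
  apply: (addable_tip_inj n0 adA) => //; apply: le_anti; rewrite mx //= leNgt.
  apply/negP => lt; apply: nc; apply: (connected_covered n0 _ cA RA mA lt).
  by move=> R'; apply: (addable_ribbon adA).
by split=> //; apply/asboolPn => -[R' R'A h]; have := mx _ R'A; lia.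
Qed.

Definition rooted (L : {fset square}) (A : ribbons) (Ts : seq ribbons) : Prop :=
  [/\ A != fset0, addable n L A, edge_connected (squares A) & chain n (L `|` squares A) A Ts].

(** A sequence of strips determines its size and its top shape, so at most one pair of k and [nu]
    contributes. *)
Lemma border_sum mu lam m (P : seq intpart) A Ts : uniq P ->
  (forall nu, diagram nu `<=` diagram mu -> nu \in P) ->
  (border_size (A :: Ts) <= m)%N ->
  \sum_(k < m) \sum_(nu <- P | `[< border_ribbon_strip n nu lam (A :: Ts) /\
        border_size (A :: Ts) = k.+1 >])
    (-1) ^+ border_height (A :: Ts) * q ^+ border_spin (A :: Ts) *
    strip_sum n q (diagram mu) (diagram nu) (m - k.+1) =
  if `[< rooted (diagram lam) A Ts >] then
    q ^+ spins A * (signed_weight q Ts *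
      strip_sum n q (diagram mu) (diagram lam `|` squares A `|` all_squares Ts)
        (m - #|` A| - border_size Ts))
  else 0.
Proof.
move=> uP inP les.
have bP nu : rooted (diagram lam) A Ts -> border_ribbon_strip n nu lam (A :: Ts) <->
    diagram nu = diagram lam `|` squares A `|` all_squares Ts.
  move=> [A0 adA cA ch]; rewrite -fsetUA -all_squares_cons.
  split=> [/(border_ribbon_stripP n0)[? [? []]]//|e].
  by apply/(border_ribbon_stripP n0); exists A, Ts.
case: asboolP => [rt|nrt]; last first.
  apply: big1 => k _; apply: big1 => nu /asboolP[].
  move=> /(border_ribbon_stripP n0)[A' [Ts' [[eA eT] [adA A0 cA] ch eM]]] _.
  subst A' Ts'.
  by case: nrt.
have [A0 adA cA ch] := rt.
(* If no partition in P has the top shape of the sequence, no strip leads from there to [mu], and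
   both sides vanish. *)
have [[nu0 [nuP eN]]|none] := pselect (exists nu0, nu0 \in P /\
    diagram nu0 = diagram lam `|` squares A `|` all_squares Ts); last first.
  rewrite big1 => [|k _]; last first.
    by apply: big1_seq => nu /andP[/asboolP[/(bP _ rt) e _] nP]; case: none; exists nu.
  rewrite strip_sum0 ?mulr0 // => T [adT eT _]; apply: none.
  have [|nu e] := @young_part (diagram lam `|` squares A `|` all_squares Ts).
    by case: adT.
  by exists nu; split=> //; apply: inP; rewrite e -eT fsubsetUl.
have s0 : (0 < border_size (A :: Ts))%N.
  by rewrite /border_size big_cons; move: A0; rewrite -cardfs_gt0; lia.
have ltk : ((border_size (A :: Ts)).-1 < m)%N by lia.
rewrite (bigD1 (Ordinal ltk)) //= [X in _ + X]big1 ?addr0; last first.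
  move=> k ne; apply: big1 => nu /asboolP[_ e]; case/eqP: ne; apply/val_inj => /=.
  by rewrite e.
rewrite big_mkcond (bigD1_seq nu0) //= [X in _ + X]big1 ?addr0; last first.
  move=> nu ne; rewrite asboolF // => -[/(bP _ rt) e _]; case/eqP: ne.
  by apply: diagram_inj; rewrite e eN.
rewrite asboolT; last by split; [apply/(bP _ rt) | rewrite prednK].
rewrite eN prednK // /signed_weight /border_height /border_spin /border_size !big_cons.
rewrite (ncomponents_connected adA A0 cA) add1n /= exprD subnDA -!mulrA.
by rewrite mulrCA.
Qed.

Lemma murnaghan_identity mu lam m (P : seq intpart) : uniq P ->
  (forall nu, diagram nu `<=` diagram mu -> nu \in P) ->
  \sum_(k < m) \sum_(nu <- P) Xcoef q n nu lam k.+1 * Kcoef q n mu nu (m - k.+1) =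
  m%:R * Kcoef q n mu lam m.
Proof.
move=> uP inP; set M := diagram mu.
rewrite KcoefE -(@root_sum n n0 F q M m) //; last exact: young_diagram.
transitivity (\sum_(k < m) \sum_(nu <- P) \sum_(Ts <- sequences M m.+1 m |
      `[< border_ribbon_strip n nu lam Ts /\ border_size Ts = k.+1 >])
    (-1) ^+ border_height Ts * q ^+ border_spin Ts * strip_sum n q M (diagram nu) (m - k.+1)).
  apply: eq_bigr => k _; apply: eq_bigr => nu _; rewrite KcoefE -mulr_suml.
  have [sM|nM] := boolP (diagram nu `<=` M); first by rewrite (@XcoefE _ _ _ m M).
  rewrite strip_sum0 ?mulr0 // => T [_ e _]; case/negP: nM.
  by rewrite -[X in _ `<=` X]e fsubsetUl.
transitivity (\sum_(Ts <- sequences M m.+1 m) \sum_(k < m) \sum_(nu <- P |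
      `[< border_ribbon_strip n nu lam Ts /\ border_size Ts = k.+1 >])
    (-1) ^+ border_height Ts * q ^+ border_spin Ts * strip_sum n q M (diagram nu) (m - k.+1)).
  rewrite [RHS]exchange_big; apply: eq_bigr => k _.
  under eq_bigr do rewrite big_mkcond.
  by rewrite exchange_big; apply: eq_bigr => Ts _; rewrite -big_mkcond.
rewrite sequencesS big_cons [X in X + _]big1 ?add0r => [|k _]; last first.
  by apply: big1 => nu /asboolP[_]; rewrite /border_size big_nil.
rewrite big_allpairs_dep big_filter [LHS]big_mkcond [RHS]big_mkcond.
apply: eq_bigr => A _; rewrite andbA; case: ((A != fset0) && (#|` A| <= m)%N) / andP => [[A0 leA]|//]; rewrite ?andTb.
transitivity (\sum_(Ts <- sequences M m (m - #|` A|)) if `[< rooted (diagram lam) A Ts >] then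
    q ^+ spins A * (signed_weight q Ts *
      strip_sum n q M (diagram lam `|` squares A `|` all_squares Ts)
        (m - #|` A| - border_size Ts))
  else 0).
  apply: eq_big_seq => Ts inT; apply: border_sum => //.
  by have := sequences_size inT; rewrite /border_size big_cons; lia.
case: asboolP => [[adA cA]|nA]; last first.
  by apply: big1 => Ts _; rewrite asboolF // => -[_ adA cA _]; apply: nA.
rewrite /chain_sum mulr_sumr [RHS]big_mkcond; apply: eq_bigr => Ts _.
have -> // : `[< rooted (diagram lam) A Ts >] =
  `[< chain n (diagram lam `|` squares A) A Ts >].
by apply: asbool_equiv_eq; split=> [[]|].
Qed.


End Link.

(** * Transposition and vertical strips *)

Local Close Scope ring_scope.

Lemma in_transpose (S : {fset square}) i j : ((i, j) \in transpose S) = ((j, i) \in S).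
Proof.
apply/imfsetP/idP => /= [[[a b] xS [-> ->]]//|xS].
by exists (j, i).
Qed.

Lemma transposeK : involutive transpose.
Proof. by move=> S; apply/fsetP => -[i j]; rewrite !in_transpose. Qed.

Lemma transposeU S S' : transpose (S `|` S') = transpose S `|` transpose S'.
Proof. by apply/fsetP => -[i j]; rewrite in_fsetU !in_transpose in_fsetU. Qed.

Lemma young_transpose L : young L -> young (transpose L).
Proof. by move=> yL i j i' j' le1 le2; rewrite !in_transpose; apply: yL. Qed.

Lemma fdisjoint_transpose S S' : [disjoint S & S'] -> [disjoint transpose S & transpose S'].
Proof. by move=> /fdisjointP d; apply/fdisjointP => -[i j]; rewrite !in_transpose => /d. Qed.

Lemma transpose_subset S S' : S `<=` S' -> transpose S `<=` transpose S'.
Proof.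
by move=> /fsubsetP s; apply/fsubsetP => -[i j]; rewrite !in_transpose; apply: s.
Qed.

Lemma skew_transpose S : is_skew_shape S -> is_skew_shape (transpose S).
Proof.
move=> /is_skew_shapeP[L [M [yL yM sub ->]]]; apply/is_skew_shapeP.
exists (transpose L), (transpose M); split; try exact: young_transpose.
  exact: transpose_subset.
by apply/fsetP => -[i j]; rewrite in_fsetD !in_transpose in_fsetD.
Qed.

Lemma connected_transpose S : edge_connected S -> edge_connected (transpose S).
Proof.
move=> cS [a b] [c d]; rewrite !in_transpose => xS yS.
have [p [p1 p2 p3]] := cS _ _ xS yS.
pose sw (x : square) : square := (x.2, x.1).
exists (map sw p); split.
- rewrite -[(a, b)]/(sw (b, a)) path_map; rewrite (eq_path (e' := adjacent)) //.
  by move=> [x1 x2] [y1 y2]; rewrite /= /adjacent /= orbC.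
- by rewrite -[(a, b)]/(sw (b, a)) last_map p2.
- by move=> x /mapP[[x1 x2] /p3 xp ->]; rewrite in_transpose.
Qed.

Lemma card_transpose S : #|` transpose S| = #|` S|.
Proof. by rewrite /transpose card_imfset //= => -[a b] [c d] /= [-> ->]. Qed.

Lemma ribbon_transpose n R : is_ribbon n R -> is_ribbon n (transpose R).
Proof.
case=> sR cR nR bR; split; first exact: skew_transpose.
- exact: connected_transpose.
- by rewrite card_transpose.
by move=> i j []; rewrite !in_transpose => h1 h2 h3 h4; apply: (bR j i).
Qed.

Definition transposes (T : ribbons) : ribbons := [fset transpose R | R in T].

Lemma in_transposes T R : (R \in transposes T) = (transpose R \in T).
Proof.
apply/imfsetP/idP => /= [[R' R'T ->]|RT]; first by rewrite transposeK.
by exists (transpose R); rewrite ?transposeK.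
Qed.

Lemma transposesK : involutive transposes.
Proof. by move=> T; apply/fsetP => R; rewrite !in_transposes transposeK. Qed.

Lemma squares_transposes T : squares (transposes T) = transpose (squares T).
Proof.
apply/fsetP => -[i j]; rewrite in_transpose; apply/in_squares/in_squares => -[R].
  by rewrite in_transposes => RT xR; exists (transpose R); rewrite ?in_transpose.
by move=> RT xR; exists (transpose R); rewrite ?in_transpose // in_transposes transposeK.
Qed.

Lemma transposes1 R : transposes [fset R] = [fset transpose R].
Proof.
apply/fsetP => Q; rewrite in_transposes !in_fset1.
by rewrite -(inj_eq (inv_inj transposeK)) transposeK.
Qed.

Lemma transposesU T T' : transposes (T `|` T') = transposes T `|` transposes T'.
Proof. by apply/fsetP => Q; rewrite in_fsetU !in_transposes in_fsetU. Qed.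

Lemma transposesD T T' : transposes (T `\` T') = transposes T `\` transposes T'.
Proof. by apply/fsetP => Q; rewrite in_fsetD !in_transposes in_fsetD. Qed.

Lemma max_ribbon_eq (T : ribbons) R : R \in T ->
  (forall Q, Q \in T -> Q != R -> (tip Q < tip R)%R) -> max_ribbon T = R.
Proof.
move=> RT mR; have [|mT mx] := max_ribbonP (T := T).
  by apply/fset0Pn; exists R.
by apply/eqP; have [//|ne] := eqVneq; have := mR _ mT ne; have := mx _ RT; lia.
Qed.

Section Vertical.
Variables (n : nat) (n0 : (0 < n)%N).

(** Transposition negates contents, so the least content [tip R - n + 1] becomes the largest. The
    order of tips is reversed. *)
Lemma tip_transpose R : is_ribbon n R -> tip (transpose R) = (n%:Z - 1 - tip R)%R.
Proof.
move=> rR; have rR' := ribbon_transpose rR.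
have R0 := ribbon_neq0 n0 rR; have R0' := ribbon_neq0 n0 rR'.
have [[i j] + e] := tip_in R0'; rewrite in_transpose => xR'.
have h1 := ribbon_content_gt n0 rR xR'.
have [|[a b] yR cy] := (ribbon_content n0 rR (tip R - n%:Z + 1)%R).2; first by lia.
have := @tip_le (transpose R) (b, a); rewrite in_transpose => /(_ yR).
by move: e h1 cy; rewrite /content /=; lia.
Qed.

(** The square north of the tip square has content above the tip, so a single ribbon always touches
    the northern edge. Being addable alone is thus invariant under transposition, which lets ribbons
    pass between the two kinds of strips. *)
Lemma addable_single L R : young L -> is_ribbon n R -> [disjoint L & R] ->
  young (L `|` R) -> addable n L [fset R].
Proof.
move=> yL rR dis yU; rewrite /addable squares_fset1; split=> //; split.
- by move=> R' /fset1P ->.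
- by move=> R1 R2 /fset1P -> /fset1P ->; rewrite eqxx.
- by rewrite squares_fset1; case: rR.
move=> R' i j /fset1P -> /(toprightmost_ribbon n0 rR)[xR cR].
rewrite squares_fset1; apply/negP => /tip_le; move: cR; rewrite /content /=; lia.
Qed.

Lemma addable1P L R : addable n L [fset R] <->
  [/\ young L, is_ribbon n R, [disjoint L & R] & young (L `|` R)].
Proof.
split=> [ad|[? ? ? ?]]; last exact: addable_single.
have rR : is_ribbon n R by apply: (addable_ribbon ad); rewrite fset11.
by case: ad; rewrite squares_fset1.
Qed.

Lemma addable1_transpose L R : addable n L [fset R] -> addable n (transpose L) [fset transpose R].
Proof.
move=> /addable1P[yL rR dis yU]; apply/addable1P; split.
- exact: young_transpose.
- exact: ribbon_transpose.
- exact: fdisjoint_transpose.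
- by rewrite -transposeU; apply: young_transpose.
Qed.

Definition vaddable (L : {fset square}) (T : ribbons) : Prop :=
  addable n (transpose L) (transposes T).

Lemma vaddable_ribbon L T R : vaddable L T -> R \in T -> is_ribbon n R.
Proof.
move=> adT RT; rewrite -[R]transposeK; apply: ribbon_transpose.
by apply: (addable_ribbon adT); rewrite in_transposes transposeK.
Qed.

(** After transposition R has the least tip, so it covers no ribbon of T and [addable_union]
    applies. *)
Lemma vaddable_add L R T : addable n L [fset R] -> vaddable (L `|` R) T ->
  (forall Q, Q \in T -> (tip Q < tip R)%R) -> vaddable L (R |` T).
Proof.
move=> adR adT lt; rewrite /vaddable transposesU transposes1.
apply: (addable_union n0 (addable1_transpose adR)).
  by rewrite squares_fset1 -transposeU.
have /addable1P[_ rR _ _] := adR.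
move=> Q; rewrite in_transposes => QT [R' /fset1P -> ].
have := lt _ QT; have : tip Q = (n%:Z - 1 - tip (transpose Q))%R.
  by rewrite -{1}[Q]transposeK (tip_transpose (vaddable_ribbon adT QT)).
rewrite (tip_transpose rR); lia.
Qed.

(** After transposition R has the least tip, so it forms a prefix by itself. *)
Lemma vaddable_remove L T R : vaddable L T -> R \in T ->
  (forall Q, Q \in T -> Q != R -> (tip Q < tip R)%R) ->
  addable n L [fset R] /\ vaddable (L `|` R) (T `\ R).
Proof.
move=> adT RT mR; have rR := vaddable_ribbon adT RT.
have := addable_prefix n0 (tip (transpose R)) adT.
have -> : [fset Q in transposes T | (tip Q <= tip (transpose R))%R] = [fset transpose R].
  apply/fsetP => Q; rewrite !inE in_transposes /=; apply/andP/eqP => [[QT le]|->].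
    have [e|ne] := eqVneq (transpose Q) R; first by rewrite -e transposeK.
    have := mR _ QT ne; have : tip Q = (n%:Z - 1 - tip (transpose Q))%R.
      by rewrite -{1}[Q]transposeK (tip_transpose (vaddable_ribbon adT QT)).
    by move: le; rewrite (tip_transpose rR); lia.
  by rewrite transposeK RT lexx.
move=> adR; split; first by have := addable1_transpose adR; rewrite !transposeK.
rewrite /vaddable transposesD transposeU transposes1.
have -> : transpose L `|` transpose R = transpose L `|` squares [fset transpose R].
  by rewrite squares_fset1.
apply: addable_diff => //.
by rewrite fsub1set in_transposes transposeK.
Qed.

Lemma addable_add L R T : addable n L T -> addable n (L `|` squares T) [fset R] ->
  (forall Q, Q \in T -> (tip Q <= tip R)%R) -> addable n L (R |` T).
Proof.
move=> adT adR le; rewrite fsetUC; apply: (addable_union n0 adT adR).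
by move=> Q /fset1P -> [R' R'T h]; have := le _ R'T; lia.
Qed.

Lemma addable_remove L T R : addable n L T -> R \in T ->
  (forall Q, Q \in T -> (tip Q <= tip R)%R) ->
  addable n L (T `\ R) /\ addable n (L `|` squares (T `\ R)) [fset R].
Proof.
move=> adT RT mR; have adR := addable_remove_max n0 adT RT mR; split=> //.
have e : T `\` (T `\ R) = [fset R].
  apply/fsetP => Q; rewrite in_fsetD in_fsetD1 in_fset1.
  by have [->|ne] /= := eqVneq Q R; rewrite ?RT //= andbC; case: (Q \in T).
by rewrite -[X in addable _ _ X]e; apply: (addable_diff adT _ adR); apply: fsubD1set.
Qed.

(** With equal tips, the tip square of R would be further down the diagonal. The square north of it
    is then in the shape below R, and so is the one to the right of the tip square of Q, which is
    beyond all contents of T. This makes the comparison of the two largest tips strict. *)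
Lemma addable_tip_neq L T R Q : addable n L T -> Q \in T ->
  (forall Q', Q' \in T -> (tip Q' <= tip Q)%R) ->
  addable n (L `|` squares T) [fset R] -> tip Q != tip R.
Proof.
move=> adT QT mQ adR; apply/eqP => e; have RR : R \in [fset R] by rewrite fset11.
have [[a b] xQ cQ] := tip_in (ribbon_neq0 n0 (addable_ribbon adT QT)).
have [[c d] xR cR] := tip_in (ribbon_neq0 n0 (addable_ribbon adR RR)).
have yU : young (L `|` squares T) by case: adT.
have xU : (a, b) \in L `|` squares T.
  by rewrite in_fsetU; apply/orP; right; apply/in_squares; exists Q.
have lt : (a < c)%N.
  rewrite ltnNge; apply/negP => le; have /negP := addable_notin adR RR xR; apply.
  by apply: (yU _ _ _ _ _ _ xU) => //; move: cQ cR; rewrite /content /=; lia.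
case: c lt xR cR => // c lt xR cR.
have xN := addable_north n0 adR RR xR cR.
have : (a, b.+1) \in L `|` squares T.
  by apply: (yU _ _ _ _ _ _ xN); move: cQ cR; rewrite /content /=; lia.
rewrite in_fsetU => /orP[l|/in_squares[Q' Q'T xQ']].
  by have /negP := addable_notin adT QT xQ; apply; apply: (addable_young adT _ _ l).
by have := mQ _ Q'T; have := tip_le xQ'; move: cQ; rewrite /content /=; lia.
Qed.

End Vertical.

(** * The dual identity *)

Local Open Scope ring_scope.

Section Dual.
Variables (n : nat) (n0 : (0 < n)%N) (F : fieldType) (q : F).

Definition vstrip_to (M L : {fset square}) (k : nat) (T : ribbons) : Prop :=
  [/\ vaddable n L T, L `|` squares T = M & #|` T| = k].

Lemma vertical_strip_ofP mu lam k T : vertical_strip_of n mu lam k T <->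
  vstrip_to (diagram mu) (diagram lam) k T.
Proof.
rewrite /vertical_strip_of /vertical_strip -/(transposes T).
split=> [[hT /has_shapeP[dis eM] cT]|[[yl hT dis yU] eM cT]].
  split=> //; split=> //; rewrite ?squares_transposes.
  - exact/young_transpose/young_diagram.
  - exact: fdisjoint_transpose.
  - by rewrite -transposeU -eM; apply/young_transpose/young_diagram.
split=> //; apply/has_shapeP; split=> //; rewrite -[diagram lam]transposeK -[squares T]transposeK.
by rewrite -squares_transposes; apply: fdisjoint_transpose.
Qed.

Lemma vstrip_to_unique M L k T T' : vstrip_to M L k T -> vstrip_to M L k T' -> T = T'.
Proof.
have h D : vstrip_to M L k D -> strip_to n (transpose M) (transpose L) k (transposes D).
  move=> [ad e <-]; split=> //; first by rewrite squares_transposes -transposeU e.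
  by rewrite /transposes card_imfset //; apply: inv_inj transposeK.
move=> /h s /h s'; apply: (inv_inj transposesK); exact: (strip_to_unique n0 s s').
Qed.

Lemma KcoefE_in mu lam k M : diagram mu `<=` M ->
  Kcoef q n mu lam k = \sum_(T <- fpowerset (fpowerset M) |
    `[< strip_to n (diagram mu) (diagram lam) k T >]) q ^+ spins T.
Proof.
move=> sM; rewrite /Kcoef (@sum_unique _ _ (fpowerset (fpowerset M)) _ (fun T => q ^+ spins T)).
- by apply: eq_bigl => T; apply: asbool_equiv_eq; exact: horizontal_strip_ofP.
- move=> T /horizontal_strip_ofP[_ e _]; rewrite in_strips; apply: fsubset_trans sM.
  by rewrite -[X in _ `<=` X]e fsubsetUr.
- move=> T T' /horizontal_strip_ofP s /horizontal_strip_ofP; exact: strip_to_unique.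
Qed.

Lemma LcoefE_in mu lam k M : diagram mu `<=` M ->
  Lcoef q n mu lam k = \sum_(T <- fpowerset (fpowerset M) |
    `[< vstrip_to (diagram mu) (diagram lam) k T >]) q ^+ spins T.
Proof.
move=> sM; rewrite /Lcoef (@sum_unique _ _ (fpowerset (fpowerset M)) _ (fun T => q ^+ spins T)).
- by apply: eq_bigl => T; apply: asbool_equiv_eq; exact: vertical_strip_ofP.
- move=> T /vertical_strip_ofP[_ e _]; rewrite in_strips; apply: fsubset_trans sM.
  by rewrite -[X in _ `<=` X]e fsubsetUr.
- move=> T T' /vertical_strip_ofP s /vertical_strip_ofP; exact: vstrip_to_unique.
Qed.

(** * The sign-reversing involution on pairs of strips *)

Section Toggle.
Variables (M L : {fset square}) (m : nat).

Definition strip_pair (p : ribbons * ribbons) : Prop :=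
  [/\ addable n L p.1, vaddable n (L `|` squares p.1) p.2,
      L `|` squares p.1 `|` squares p.2 = M & (#|` p.1| + #|` p.2|)%N = m].

Definition pair_weight (p : ribbons * ribbons) : F :=
  (-1) ^+ #|` p.2| * (q ^+ spins p.1 * q ^+ spins p.2).

(** The largest tip of the pair occurs in the horizontal strip, which is the lower one. *)
Definition max_below (p : ribbons * ribbons) : Prop :=
  p.1 != fset0 /\ forall R, R \in p.2 -> tip R < tip (max_ribbon p.1).

Definition move_up (p : ribbons * ribbons) : ribbons * ribbons :=
  let R := max_ribbon p.1 in (p.1 `\ R, R |` p.2).

Definition move_down (p : ribbons * ribbons) : ribbons * ribbons :=
  let R := max_ribbon p.2 in (R |` p.1, p.2 `\ R).

Lemma spins_fsetD1 (T : ribbons) R : R \in T -> spins T = (spin R + spins (T `\ R))%N.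
Proof.
move=> RT; rewrite (@spins_split [fset R]) ?fsub1set //; congr (_ + _)%N.
by rewrite /spins big_seq_fset1.
Qed.

Lemma pair_weight_move T1 T2 R : R \in T1 -> R \notin T2 ->
  pair_weight (T1, T2) = - pair_weight (T1 `\ R, R |` T2).
Proof.
move=> R1 R2; rewrite /pair_weight /= (spins_fsetD1 R1).
rewrite (@spins_fsetD1 (R |` T2) R) ?fset1U1 // fsetU1K //.
by rewrite cardfsU1 R2 add1n exprS mulN1r mulNr opprK !exprD; congr (_ * _); rewrite mulrCA mulrA.
Qed.

Lemma strict_max T1 R : addable n L T1 -> R \in T1 ->
  (forall Q, Q \in T1 -> tip Q <= tip R) ->
  forall Q, Q \in T1 -> Q != R -> tip Q < tip R.
Proof.
move=> ad RT mR Q QT ne; rewrite lt_neqAle mR // andbT; apply: contra ne => /eqP e.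
exact/eqP/(addable_tip_inj n0 ad).
Qed.

Lemma vaddable_max L' T R : vaddable n L' T -> R \in T ->
  (forall Q, Q \in T -> tip Q <= tip R) ->
  forall Q, Q \in T -> Q != R -> tip Q < tip R.
Proof.
move=> ad RT mR Q QT ne; rewrite lt_neqAle mR // andbT; apply: contra ne => /eqP e.
rewrite -(inj_eq (inv_inj transposeK)); apply/eqP.
apply: (addable_tip_inj n0 ad); rewrite ?in_transposes ?transposeK //.
rewrite (tip_transpose n0 (vaddable_ribbon ad QT)).
by rewrite (tip_transpose n0 (vaddable_ribbon ad RT)) e.
Qed.

Lemma move_upP T1 T2 : strip_pair (T1, T2) -> max_below (T1, T2) ->
  [/\ strip_pair (move_up (T1, T2)), ~ max_below (move_up (T1, T2)),
      move_down (move_up (T1, T2)) = (T1, T2) &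
      pair_weight (T1, T2) = - pair_weight (move_up (T1, T2))].
Proof.
rewrite /strip_pair /max_below /move_up /=.
move=> [ad1 ad2 eM em] [/max_ribbonP[+ +] lt]; set R := max_ribbon T1 in lt * => RT mR.
have R2 : R \notin T2 by apply/negP => /lt; rewrite ltxx.
have [adR adR1] := addable_remove n0 ad1 RT mR.
have eS : squares (T1 `\ R) `|` R = squares T1.
  by rewrite -[X in _ `|` X]squares_fset1 -squaresU fsetUC fsetD1K.
have smx := strict_max ad1 RT mR.
have mx : max_ribbon (R |` T2) = R.
  apply: max_ribbon_eq; first exact: fset1U1.
  by move=> Q /fset1UP[->|/lt//]; rewrite eqxx.
split.
- split=> //.
  + by apply: vaddable_add => //; rewrite -fsetUA eS.
  + by rewrite squaresU squares_fset1 !fsetUA -(fsetUA L) eS.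
  + by have := cardfsD1 R T1; rewrite RT cardfsU1 R2 /= => e; rewrite -em e; lia.
- case=> /max_ribbonP[+ _] /(_ R (fset1U1 _ _)); set Q := max_ribbon _.
  by move=> /fsetD1P[ne QT]; have := smx _ QT ne; lia.
- by rewrite /move_down /= mx fsetD1K // fsetU1K.
exact: pair_weight_move.
Qed.

Lemma move_downP T1 T2 : (0 < m)%N -> strip_pair (T1, T2) -> ~ max_below (T1, T2) ->
  [/\ strip_pair (move_down (T1, T2)), max_below (move_down (T1, T2)) &
      move_up (move_down (T1, T2)) = (T1, T2)].
Proof.
rewrite /strip_pair /max_below /move_down /=.
move=> m0 [ad1 ad2 eM em] nb.
(* If T2 is empty and [max_below] fails, both strips are empty, against 0 < m. *)
have T20 : T2 != fset0.
  apply/eqP => e; apply: nb; rewrite e; split=> [|R]; last by rewrite in_fset0.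
  by apply/eqP => e1; move: em m0; rewrite e e1 !cardfs0 => <-.
have [+ +] := max_ribbonP T20; set R := max_ribbon T2 => RT mR.
have [adR ad2R] := vaddable_remove n0 ad2 RT (vaddable_max ad2 RT mR).
have le Q : Q \in T1 -> tip Q <= tip R.
  move=> QT; rewrite leNgt; apply/negP => lt; apply: nb; split.
    by apply/fset0Pn; exists Q.
  have [|_ mx] := @max_ribbonP T1; first by apply/fset0Pn; exists Q.
  by move=> Q2 /mR le2; have := mx _ QT; lia.
have lt Q : Q \in T1 -> tip Q < tip R.
  move=> QT; have T10 : T1 != fset0 by apply/fset0Pn; exists Q.
  have [mT mx] := max_ribbonP T10; apply: (le_lt_trans (mx _ QT)).
  rewrite lt_neqAle le // andbT; exact: (addable_tip_neq n0 ad1 mT mx adR).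
have R1 : R \notin T1 by apply/negP => /lt; rewrite ltxx.
have mx : max_ribbon (R |` T1) = R.
  apply: max_ribbon_eq; first exact: fset1U1.
  by move=> Q /fset1UP[->|/lt//]; rewrite eqxx.
have eS : L `|` squares (R |` T1) = L `|` squares T1 `|` R.
  by rewrite squaresU squares_fset1 [R `|` _]fsetUC fsetUA.
have eS2 : R `|` squares (T2 `\ R) = squares T2.
  by rewrite -[X in X `|` _]squares_fset1 -squaresU fsetD1K.
split.
- split=> //; first exact: addable_add.
  + by rewrite eS.
  + by rewrite eS -fsetUA eS2.
  + by have := cardfsD1 R T2; rewrite RT cardfsU1 R1 /= => e; rewrite -em e; lia.
- split; first by apply/fset0Pn; exists R; apply: fset1U1.
  rewrite mx => Q /fsetD1P[ne QT]; exact: (vaddable_max ad2 RT mR).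
by rewrite /move_up /= mx fsetD1K // fsetU1K.
Qed.

Lemma strip_pair_in p : strip_pair p ->
  (p.1 \in fpowerset (fpowerset M)) && (p.2 \in fpowerset (fpowerset M)).
Proof.
case=> _ _ e _; rewrite !in_strips; apply/andP; split.
  by rewrite -[X in _ `<=` X]e -fsetUA fsetUCA fsubsetUl.
by rewrite -[X in _ `<=` X]e fsubsetUr.
Qed.

Lemma sum_strip_pairs (U := fpowerset (fpowerset M)) : (0 < m)%N ->
  \sum_(T1 <- U) \sum_(T2 <- U) (if `[< strip_pair (T1, T2) >]
     then pair_weight (T1, T2) else 0) = 0.
Proof.
move=> m0; pose s := [seq (T1, T2) | T1 <- U, T2 <- U].
transitivity (\sum_(p <- s | `[< strip_pair p >]) pair_weight p).
  by rewrite [RHS]big_mkcond big_allpairs.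
have us : uniq s.
  by apply: allpairs_uniq; rewrite ?fset_uniq // => -[? ?] [? ?].
have ins p : strip_pair p -> p \in s.
  move=> /strip_pair_in/andP[p1 p2]; apply/allpairsP; exists p.
  by split=> //; apply: surjective_pairing.
rewrite (bigID (fun p => `[< max_below p >])) /=.
apply/eqP; rewrite addr_eq0 -sumrN; apply/eqP.
apply: (@big_bij _ _ _ _ _ _ _ _ _ move_up move_down) => //.
  move=> [T1 T2] _ /andP[/asboolP sp /asboolP mb].
  have [h1 h2 h3 h4] := move_upP sp mb; split=> //; first exact: ins.
  by apply/andP; split; [apply/asboolP | apply/asboolPn].
move=> [T1 T2] _ /andP[/asboolP sp /asboolPn mb].
have [h1 h2 h3] := move_downP m0 sp mb; split=> //; first exact: ins.
by apply/andP; split; apply/asboolP.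
Qed.

End Toggle.

(** A pair of strips determines the intermediate partition and the number k of ribbons of its
    vertical strip, so the double sum is that of [sum_strip_pairs]. *)
Lemma dual_identity mu lam m (P : seq intpart) : (0 < m)%N -> uniq P ->
  (forall nu, diagram nu `<=` diagram mu -> nu \in P) ->
  \sum_(k < m.+1) (-1) ^+ k *
    (\sum_(nu <- P) Lcoef q n mu nu k * Kcoef q n nu lam (m - k)) = 0.
Proof.
move=> m0 uP inP; set M := diagram mu; pose U := fpowerset (fpowerset M).
rewrite -[RHS](@sum_strip_pairs M (diagram lam) m m0).
pose c (T1 T2 : ribbons) (k : 'I_m.+1) nu :=
  `[< strip_to n (diagram nu) (diagram lam) (m - k) T1 >] &&
  `[< vstrip_to M (diagram nu) k T2 >].
transitivity (\sum_(k < m.+1) \sum_(nu <- P) \sum_(T1 <- U) \sum_(T2 <- U)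
    (if c T1 T2 k nu then (-1) ^+ k * (q ^+ spins T1 * q ^+ spins T2) else 0)).
  apply: eq_bigr => k _; rewrite mulr_sumr; apply: eq_bigr => nu _.
  have [sM|nM] := boolP (diagram nu `<=` M); last first.
    rewrite [RHS]big1 => [|T1 _]; last first.
      apply: big1 => T2 _; rewrite /c [X in _ && X]asboolF ?andbF // => -[_ e _].
      by case/negP: nM; rewrite -e fsubsetUl.
    rewrite (@LcoefE_in _ _ _ M) // big1 ?mul0r ?mulr0 // => T /asboolP[_ e _].
    by case/negP: nM; rewrite -[X in _ `<=` X]e fsubsetUl.
  rewrite (@LcoefE_in _ _ _ M) // (@KcoefE_in _ _ _ M) // mulrC mulr_sumr.
  rewrite mulr_suml big_mkcond; apply: eq_bigr => T1 _.
  rewrite /c; case: asboolP => _ /=; last by rewrite big1.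
  rewrite mulr_suml mulr_suml big_mkcond; apply: eq_bigr => T2 _; case: ifP => // _.
  by rewrite mulrC [q ^+ _ * _]mulrC.
transitivity (\sum_(T1 <- U) \sum_(T2 <- U) \sum_(k < m.+1) \sum_(nu <- P)
    (if c T1 T2 k nu then (-1) ^+ k * (q ^+ spins T1 * q ^+ spins T2) else 0)).
  under eq_bigr do rewrite exchange_big.
  rewrite exchange_big; apply: eq_bigr => T1 _.
  under eq_bigr do rewrite exchange_big.
  by rewrite exchange_big.
apply: eq_bigr => T1 _; apply: eq_bigr => T2 _.
case: asboolP => [[/= ad1 ad2 eM em]|nsp]; last first.
  apply: big1 => k _; apply: big1 => nu _; rewrite /c; case: asboolP => //= -[ad1 e1 c1].
  case: asboolP => // -[ad2 e2 c2]; case: nsp; split=> /=; rewrite ?e1 //.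
  by rewrite c1 c2 subnK // -ltnS.
have [nu0 e0] : exists nu, diagram nu = diagram lam `|` squares T1.
  by apply: young_part; case: ad1.
have lt2 : (#|` T2| < m.+1)%N by rewrite ltnS -em leq_addl.
rewrite (bigD1 (Ordinal lt2)) //= [X in _ + X]big1 ?addr0; last first.
  move=> k ne; apply: big1 => nu _; rewrite /c; case: asboolP => //= _.
  case: asboolP => // -[_ _ e]; case/eqP: ne; apply/val_inj => /=.
  by rewrite e.
rewrite (bigD1_seq nu0) //=; last first.
  by apply: inP; rewrite e0 -[X in _ `<=` X]eM fsubsetUl.
rewrite [X in _ + X]big1 ?addr0; last first.
  move=> nu ne; rewrite /c; case: asboolP => //= -[_ e _]; case/eqP: ne.
  by apply: diagram_inj; rewrite e0 e.
rewrite /c asboolT /=; last by split=> //; rewrite -em addnK.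
by rewrite asboolT //; split; rewrite ?e0.
Qed.

End Dual.

(** * From matrix identities to operators *)

Definition psize (lam : intpart) : nat := #|` diagram lam|.

Lemma finite_parts N : exists s : seq intpart, forall mu, (psize mu <= N)%N -> mu \in s.
Proof.
pose box : {fset square} := [fset x in [seq (i, j) | i <- iota 0 N, j <- iota 0 N]].
have lamP D : exists lam : option intpart, forall mu, diagram mu = D -> lam = Some mu.
  have [[lam e]|ne] := pselect (exists lam, diagram lam = D).
    by exists (Some lam) => mu e'; congr Some; apply: diagram_inj; rewrite e e'.
  by exists None => mu e; case: ne; exists mu.
pose part D := projT1 (cid (lamP D)).
exists (pmap part (fpowerset box)) => mu le; rewrite mem_pmap; apply/mapP.
exists (diagram mu); last by rewrite /part; case: cid => lam /= h; rewrite (h mu).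
rewrite fpowersetE; apply/fsubsetP => -[i j] xmu; rewrite in_fset.
have col : (i < psize mu)%N.
  have <- : #|` [fset (i', 0%N) | i' in iota 0 i.+1]| = i.+1.
    rewrite card_imfset; last by move=> a b [].
    by transitivity (size (undup (iota 0 i.+1))); rewrite // undup_id ?iota_uniq // size_iota.
  apply: fsubset_leq_card; apply/fsubsetP => x /imfsetP[i' /=]; rewrite inE mem_iota => h ->.
  by apply: (young_diagram _ _ xmu); lia.
have row : (j < psize mu)%N.
  have <- : #|` [fset (0%N, j') | j' in iota 0 j.+1]| = j.+1.
    rewrite card_imfset; last by move=> a b [].
    by transitivity (size (undup (iota 0 j.+1))); rewrite // undup_id ?iota_uniq // size_iota.
  apply: fsubset_leq_card; apply/fsubsetP => x /imfsetP[j' /=]; rewrite inE mem_iota => h ->.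
  by apply: (young_diagram _ _ xmu); lia.
by apply/allpairsP; exists (i, j); rewrite /= !mem_iota; split=> //; lia.
Qed.

Definition parts (N : nat) : seq intpart :=
  [seq mu <- undup (projT1 (cid (finite_parts N))) | (psize mu <= N)%N].

Lemma in_parts N mu : (mu \in parts N) = (psize mu <= N)%N.
Proof.
rewrite mem_filter mem_undup; apply: andb_idr => le.
by case: cid => s /= h; apply: h.
Qed.

Lemma parts_uniq N : uniq (parts N). Proof. exact/filter_uniq/undup_uniq. Qed.

Section Rules.
Variables (F : fieldType) (V : lmodType F) (v : intpart -> V) (n : nat).

Definition matrix_family := intpart -> intpart -> nat -> F.

Definition rule_at (D : matrix_family) (A : nat -> {linear V -> V}) k : Prop :=
  forall lam, A k (v lam) = \sum_(mu \in setT) D lam mu k *: v mu.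

(** Gives each row finite support, without which the sum over all partitions would be the default
    value 0, and lets [parts N] replace it. *)
Definition bounded (D : matrix_family) : Prop :=
  forall lam mu k, D lam mu k != 0 -> (psize mu <= psize lam + n * k)%N.

(* h_0 = e_0 = 1; for the power sums, whose relation with the h_i involves no p_0,
   the identity is used with the coefficient -m that brings m h_m into the sum. *)
Definition ext_op (A : nat -> {linear V -> V}) k (x : V) : V :=
  if k == 0%N then x else A k x.

Definition ext_mx (D : matrix_family) : matrix_family :=
  fun lam mu k => if k == 0%N then (lam == mu)%:R else D lam mu k.

Lemma bounded_ext D : bounded D -> bounded (ext_mx D).
Proof.
move=> bD lam mu k; rewrite /ext_mx; case: (k =P 0%N) => [->|_]; last exact: bD.
by case: (lam =P mu) => [->|_]; rewrite ?eqxx // leq_addr.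
Qed.

Lemma sum_parts D lam k N : bounded D -> (psize lam + n * k <= N)%N ->
  \sum_(mu \in setT) D lam mu k *: v mu = \sum_(mu <- parts N) D lam mu k *: v mu.
Proof.
move=> bD le; rewrite (fsbigE (parts N)) ?parts_uniq //.
  by apply: eq_bigl => mu; rewrite in_setT.
move=> mu _; rewrite in_parts => nle; apply/eqP; rewrite scaler_eq0; apply/orP; left.
apply: contraNT nle => /bD h; exact: leq_trans le.
Qed.

Lemma ext_opE D A lam k N : bounded D -> (psize lam + n * k <= N)%N ->
  ((0 < k)%N -> rule_at D A k) ->
  ext_op A k (v lam) = \sum_(mu <- parts N) ext_mx D lam mu k *: v mu.
Proof.
move=> bD le r; rewrite /ext_op /ext_mx; case: (k =P 0%N) => [k0|/eqP k0].
  rewrite (bigD1_seq lam) ?parts_uniq ?in_parts //=; last by lia.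
  by rewrite eqxx scale1r big1 ?addr0 // => mu ne; rewrite eq_sym (negbTE ne) scale0r.
by rewrite r ?lt0n // (sum_parts bD le).
Qed.

Lemma ext_op_sum A k (I : eqType) (s : seq I) (c : I -> F) (w : I -> V) :
  ext_op A k (\sum_(i <- s) c i *: w i) = \sum_(i <- s) c i *: ext_op A k (w i).
Proof.
rewrite /ext_op; case: eqP => // _; rewrite linear_sum.
by apply: eq_bigr => i _; rewrite linearZ.
Qed.

(** * One family of rules determined by another; A is applied before B *)

Section Determine.
Variables (a b : matrix_family) (A B : nat -> {linear V -> V}) (c : nat -> nat -> F).
Hypotheses (ba : bounded a) (bb : bounded b).
Hypothesis rel_op : forall m x, (0 < m)%N ->
  \sum_(k < m.+1) c m k *: ext_op B k (ext_op A (m - k)%N x) = 0.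
Hypothesis rel_mx : forall m lam mu N, (0 < m)%N ->
  (psize lam <= N)%N -> (psize mu <= N)%N ->
  \sum_(k < m.+1) c m k *
    (\sum_(nu <- parts N) ext_mx a lam nu (m - k)%N * ext_mx b nu mu k) = 0.

Lemma ext_op_comp m k lam N : (k <= m)%N -> (psize lam + n * m <= N)%N ->
  ((0 < m - k)%N -> rule_at a A (m - k)%N) -> ((0 < k)%N -> rule_at b B k) ->
  ext_op B k (ext_op A (m - k)%N (v lam)) = \sum_(mu <- parts N)
    (\sum_(nu <- parts N) ext_mx a lam nu (m - k)%N * ext_mx b nu mu k) *: v mu.
Proof.
move=> lek leN rA rB.
have e : (n * (m - k)%N + n * k = n * m)%N by rewrite -mulnDr subnK.
rewrite (ext_opE (N := N) ba _ rA); last by lia.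
rewrite ext_op_sum; under [RHS]eq_bigr do rewrite scaler_suml.
rewrite [RHS]exchange_big; apply: eq_bigr => nu _.
have [->|ne] := eqVneq (ext_mx a lam nu (m - k)%N) 0.
  by rewrite scale0r big1 // => mu _; rewrite mul0r scale0r.
rewrite (ext_opE (N := N) bb _ rB); last by have := bounded_ext ba ne; lia.
by rewrite scaler_sumr; apply: eq_bigr => mu _; rewrite scalerA.
Qed.

(** The operator relation applied to [v lam] and the matrix relation combined with the vectors
    [v mu] agree in all terms but k0, so they agree there too, and [c m k0] can be cancelled. *)
Lemma determine_one m k0 lam N : (0 < m)%N -> (k0 <= m)%N -> c m k0 != 0 ->
  (psize lam + n * m <= N)%N ->
  (forall k, (k <= m)%N -> k != k0 ->
     ((0 < m - k)%N -> rule_at a A (m - k)%N) /\ ((0 < k)%N -> rule_at b B k)) ->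
  ext_op B k0 (ext_op A (m - k0)%N (v lam)) = \sum_(mu <- parts N)
    (\sum_(nu <- parts N) ext_mx a lam nu (m - k0)%N * ext_mx b nu mu k0) *: v mu.
Proof.
move=> m0 lek c0 leN r; have := rel_op (v lam) m0.
have : \sum_(k < m.+1) c m k *: \sum_(mu <- parts N)
    (\sum_(nu <- parts N) ext_mx a lam nu (m - k)%N * ext_mx b nu mu k) *: v mu = 0.
  under eq_bigr do rewrite scaler_sumr.
  rewrite exchange_big big_seq big1 // => mu; rewrite in_parts => lemu.
  under eq_bigr do rewrite scalerA.
  by rewrite -scaler_suml rel_mx ?scale0r //; lia.
have lt : (k0 < m.+1)%N by [].
move=> e1 e2; rewrite (bigD1 (Ordinal lt)) //= in e1.
rewrite (bigD1 (Ordinal lt)) //= in e2; apply: (scalerI c0).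
move/eqP: e1; rewrite addr_eq0 => /eqP ->.
move/eqP: e2; rewrite addr_eq0 => /eqP ->.
congr (- _); apply: eq_bigr => k ne; congr (_ *: _).
have lekm : (k <= m)%N by rewrite -ltnS.
by have [|rA rB] := r k lekm; [exact: ne | exact: ext_op_comp].
Qed.

(** Strong induction with k0 = m: in that term A has degree 0 and acts as the identity. In
    [determine_left] the roles are exchanged, with k0 = 0. *)
Lemma determine_right : (forall m, (0 < m)%N -> c m m != 0) ->
  (forall k, (0 < k)%N -> rule_at a A k) -> forall k, (0 < k)%N -> rule_at b B k.
Proof.
move=> cm rA m; have [k] := ubnP m; elim: k m => // k IH m lem m0 lam.
have := @determine_one m m lam (psize lam + n * m) m0 (leqnn m) (cm m m0) (leqnn _).
rewrite subnn /ext_op eqxx (gtn_eqF m0) (sum_parts bb (leqnn _)) => ->.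
  apply: eq_bigr => mu _; congr (_ *: _).
  rewrite (bigD1_seq lam) ?parts_uniq ?in_parts ?leq_addr //=.
  rewrite {1}/ext_mx eqxx eqxx mul1r /ext_mx (gtn_eqF m0).
  by rewrite big1 ?addr0 // => nu ne; rewrite eqxx eq_sym (negbTE ne) mul0r.
move=> j lej nej; split=> [? | j0]; first exact: rA.
by apply: IH => //; lia.
Qed.

Lemma determine_left : (forall m, (0 < m)%N -> c m 0 != 0) ->
  (forall k, (0 < k)%N -> rule_at b B k) -> forall k, (0 < k)%N -> rule_at a A k.
Proof.
move=> cm rB m; have [k] := ubnP m; elim: k m => // k IH m lem m0 lam.
have := @determine_one m 0 lam (psize lam + n * m) m0 (leq0n m) (cm m m0) (leqnn _).
rewrite subn0 /ext_op eqxx (gtn_eqF m0) (sum_parts ba (leqnn _)) => ->.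
  apply: eq_big_seq => mu; rewrite in_parts => lemu; congr (_ *: _).
  rewrite (bigD1_seq mu) ?parts_uniq ?in_parts //=.
  rewrite {2}/ext_mx eqxx eqxx mulr1 /ext_mx (gtn_eqF m0).
  by rewrite big1 ?addr0 // => nu ne; rewrite eqxx (negbTE ne) mulr0.
move=> j lej nej; split=> [j0|?]; last exact: rB.
by apply: IH => //; lia.
Qed.

End Determine.
End Rules.

(** * Symmetric functions *)

From mathcomp Require Import mpoly.

Section SymmetricFunctions.
Variable F : fieldType.

Section Coefficients.
Variable N : nat.

Lemma mcoeff_h_sym d (w : 'X_{1..N}) : (h_sym F d N)@_w = (mdeg w == d)%:R.
Proof.
rewrite /h_sym raddf_sum /=; have [e|ne] := eqVneq (mdeg w) d; last first.
  apply: big1 => u /eqP eu; rewrite mcoeffX; case: eqP => // uw.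
  by rewrite -uw eu eqxx in ne.
have lt : (mdeg w < d.+1)%N by rewrite e.
rewrite (bigD1 (BMultinom lt)) /= ?e // mcoeffX eqxx big1 ?addr0 // => u /andP[_ ne].
by rewrite mcoeffX; case: eqP => // uw; case/eqP: ne; apply/val_inj.
Qed.

Lemma mcoeff_h_symMX d (v w : 'X_{1..N}) : (h_sym F d N * 'X_[v])@_w =
  ((v <= w)%MM && (mdeg w == d + mdeg v)%N)%:R.
Proof.
have [le|nle] := boolP (v <= w)%MM.
  rewrite -{1}(submK le) addmC mcoeffMX mcoeff_h_sym /=.
  by rewrite -{2}(submK le) mdegD eqn_add2r.
rewrite /h_sym mulr_suml raddf_sum /= big1 // => u _.
rewrite -mpolyXD mcoeffX; case: eqP => // e.
by rewrite -e lem_addl in nle.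
Qed.

Lemma sum_lt (m a : nat) : (a <= m)%N -> (\sum_(k < m) (k < a) = a)%N.
Proof.
elim: m a => [|m IH] a lea; first by rewrite big_ord0; move: lea; rewrite leqn0 => /eqP.
rewrite big_ord_recr /=; have [e|lt] := eqVneq a m.+1.
  rewrite e ltnSn (eq_bigr (fun=> 1%N)); first by rewrite sum1_card card_ord addn1.
  by move=> k _; rewrite ltnS (ltnW (ltn_ord k)).
have lea' : (a <= m)%N by rewrite -ltnS ltn_neqAle lt.
by rewrite IH // ltnNge lea' addn0.
Qed.

(** The coefficient of a monomial w of degree m counts the pairs (j, k) with k < w_j, and there are
    m of them. *)
Lemma newton_identity m : \sum_(k < m) p_sym F k.+1 N * h_sym F (m - k.+1) N =
  m%:R *: h_sym F m N.
Proof.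
apply/mpolyP => w; rewrite mcoeffZ mcoeff_h_sym raddf_sum /=.
transitivity (\sum_(k < m) \sum_(j < N) ((k < w j)%N && (mdeg w == m))%:R : F).
  apply: eq_bigr => k _; rewrite mulrC /p_sym mulr_sumr raddf_sum /=.
  apply: eq_bigr => j _; rewrite mpolyXn mcoeff_h_symMX; congr (nat_of_bool _)%:R.
  rewrite mdegMn mdeg1 mul1n subnK //; congr andb.
  apply/mnm_lepP/idP => [/(_ j)|le i]; first by rewrite mulmnE mnm1E eqxx mul1n.
  by rewrite mulmnE mnm1E; case: eqP => [<-|_]; rewrite ?mul1n ?mul0n.
have [e|ne] := eqVneq (mdeg w) m; last first.
  by rewrite mulr0 big1 // => k _; rewrite big1 // => j _; rewrite andbF.
rewrite mulr1 exchange_big /=.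
have -> : m%:R = (mdeg w)%:R :> F by rewrite e.
rewrite mdegE natr_sum; apply: eq_bigr => j _.
rewrite -[in RHS](@sum_lt m (w j)); last by rewrite -e mdegE (bigD1 j) //= leq_addr.
by rewrite natr_sum; apply: eq_bigr => k _; rewrite andbT.
Qed.

(** Toggling one fixed variable j of w is a sign-reversing involution on the squarefree divisors of
    w. *)
Lemma sum_sets_sign (w : 'X_{1..N}) : (0 < mdeg w)%N ->
  \sum_(S : {set 'I_N} | (mesym1 S <= w)%MM) (-1) ^+ #|S| = 0 :> F.
Proof.
have leE (S : {set 'I_N}) : (mesym1 S <= w)%MM = [forall i in S, w i != 0%N].
  apply/mnm_lepP/forall_inP => h i; first by move=> iS; have := h i; rewrite mnmE iS -lt0n.
  by rewrite mnmE; case: (boolP (i \in S)) => // /h; rewrite -lt0n.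
rewrite lt0n mdeg_eq0 => w0.
have [j wj] : exists j, w j != 0%N.
  apply/existsP; apply: contraNT w0; rewrite negb_exists => /forallP h.
  by apply/eqP/mnmP => i; rewrite mnm0E; apply/eqP; have := h i; rewrite negbK.
rewrite (bigID (fun S : {set 'I_N} => j \in S)) /=.
rewrite (reindex_onto (fun S : {set 'I_N} => j |: S) (fun S => S :\ j)) /=; last first.
  by move=> S /andP[_ jS]; rewrite finset.setD1K.
apply/eqP; rewrite addr_eq0 -sumrN; apply/eqP; apply: eq_big => S.
  rewrite finset.setU11 andbT; apply/andP/andP => [[leS /eqP e]|[leS jS]].
    have jS : j \notin S by rewrite -e !inE eqxx.
    split=> //; move: leS; rewrite !leE => /forall_inP h; apply/forall_inP => i iS.
    by apply: h; rewrite inE iS orbT.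
  rewrite finset.setU1K //; split=> //; move: leS; rewrite !leE => /forall_inP h.
  by apply/forall_inP => i; rewrite finset.in_setU1 => /orP[/eqP ->|/h].
move=> /andP[_ /eqP e]; have jS : j \notin S by rewrite -e !inE eqxx.
by rewrite cardsU1 jS add1n exprS mulN1r.
Qed.

Lemma eh_identity m : (0 < m)%N ->
  \sum_(k < m.+1) (-1) ^+ k *: (e_sym F k N * h_sym F (m - k) N) = 0.
Proof.
move=> m0; apply/mpolyP => w; rewrite mcoeff0 raddf_sum /=.
transitivity (\sum_(k < m.+1) \sum_(S : {set 'I_N} | #|S| == k)
   (if (mesym1 S <= w)%MM && (mdeg w == m) then (-1) ^+ #|S| else 0) : F).
  apply: eq_bigr => k _; rewrite mcoeffZ /e_sym mesymE mulrC [_ * h_sym _ _ _]mulrC.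
  rewrite mulr_sumr raddf_sum /= mulr_suml; apply: eq_bigr => S /eqP cS.
  rewrite mcoeff_h_symMX mdeg_mesym1 cS subnK; last by rewrite -ltnS.
  by case: ifP => _; rewrite ?mul1r ?mul0r.
have [e|ne] := eqVneq (mdeg w) m; last first.
  by rewrite big1 // => k _; rewrite big1 // => S _; rewrite andbF.
have z := @sum_sets_sign w; rewrite e in z; rewrite -[RHS](z m0) [RHS]big_mkcond /=.
rewrite (exchange_big_dep xpredT) //=; apply: eq_bigr => S _; rewrite andbT.
case: ifP => [leS|nle]; last by rewrite big1.
have ltS : (#|S| < m.+1)%N.
  by rewrite ltnS -e -(mdeg_mesym1 S) !mdegE; apply: leq_sum => i _; apply/mnm_lepP.
rewrite (bigD1 (Ordinal ltS)) //= big1 ?addr0 // => k /andP[/eqP eS /eqP[]].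
exact/val_inj.
Qed.

End Coefficients.

Lemma h_sym0 : h_sym F 0 = (fun=> 1).
Proof. by apply: functional_extensionality_dep => N; apply/mpolyP => w; rewrite mcoeff_h_sym mcoeff1 mdeg_eq0. Qed.

Lemma e_sym0 : e_sym F 0 = (fun=> 1).
Proof. by apply: functional_extensionality_dep => N; rewrite /e_sym mesym0E. Qed.

Lemma kill_last_mwiden N (p : {mpoly F[N]}) : kill_last (mwiden p) = p.
Proof.
rewrite [p]mpolyE raddf_sum /kill_last raddf_sum; apply: eq_bigr => m _ /=.
rewrite mwidenZ comp_mpolyZ mwidenX comp_mpolyX big_ord_recr /=.
rewrite mnmwiden_ordmax expr0 mulr1 mpolyXE_id; congr (_ *: _).
apply: eq_bigr => i _; rewrite mnmwiden_widen tnth_mktuple.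
have -> : widen_ord (leqnSn N) i = lift ord_max i by apply/val_inj; rewrite /= /bump leqNgt ltn_ord.
by rewrite liftK.
Qed.

Lemma kill_last_max N : kill_last ('X_(ord_max) : {mpoly F[N.+1]}) = 0.
Proof.
by rewrite /kill_last comp_mpolyXU -tnth_nth tnth_mktuple unlift_none.
Qed.

Lemma in_Lambda_add f g : in_Lambda f -> in_Lambda g ->
  in_Lambda (fun N => f N + g N : {mpoly F[N]}).
Proof.
move=> [sf kf [df bf]] [sg kg [dg bg]]; split=> [N|N|].
- exact: (rpredD (sf N) (sg N)).
- by rewrite /kill_last comp_mpolyD -/(kill_last _) kf -/(kill_last _) kg.
exists (maxn df dg) => N; apply: (leq_trans (msizeD_le _ _)).
by rewrite geq_max !leq_max bf bg orbT.
Qed.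

Lemma in_Lambda_scale (c : F) f : in_Lambda f -> in_Lambda (fun N => c *: f N).
Proof.
move=> [sf kf [df bf]]; split=> [N|N|].
- exact: (rpredZ c (sf N)).
- by rewrite /kill_last comp_mpolyZ -/(kill_last _) kf.
by exists df => N; apply: leq_trans (msizeZ_le _ _) (bf N).
Qed.

Lemma in_Lambda_mul f g : in_Lambda f -> in_Lambda g ->
  in_Lambda (fun N => f N * g N : {mpoly F[N]}).
Proof.
move=> [sf kf [df bf]] [sg kg [dg bg]]; split=> [N|N|].
- exact: (rpredM (sf N) (sg N)).
- by rewrite /kill_last rmorphM /= -/(kill_last _) kf -/(kill_last _) kg.
exists (df + dg).+1 => N; apply: (leq_trans (msizeM_le _ _)).
by rewrite ltnS leq_add.
Qed.

Lemma in_Lambda_one : in_Lambda (fun N => 1 : {mpoly F[N]}).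
Proof.
split=> [N|N|]; [exact: rpred1 | by rewrite /kill_last comp_mpoly1 |].
by exists 1%N => N; rewrite msize1.
Qed.

Lemma in_Lambda_sum K (g : nat -> polyfam F) : (forall k, (k < K)%N -> in_Lambda (g k)) ->
  in_Lambda (fun N => \sum_(k < K) g k N).
Proof.
elim: K => [|K IH] h.
  have -> : (fun N => \sum_(k < 0) g k N) = (fun N => 0 *: 1 : {mpoly F[N]}).
    by apply: functional_extensionality_dep => N; rewrite big_ord0 scale0r.
  exact/in_Lambda_scale/in_Lambda_one.
have -> : (fun N => \sum_(k < K.+1) g k N) = (fun N => \sum_(k < K) g k N + g K N).
  by apply: functional_extensionality_dep => N; rewrite big_ord_recr.
by apply: in_Lambda_add; [apply: IH => k lt; apply: h; apply: ltnW | apply: h].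
Qed.

Lemma in_Lambda_e k : in_Lambda (e_sym F k).
Proof.
split=> [N|N|]; first exact: mesym_sym.
  case: k => [|k]; first by rewrite /e_sym !mesym0E /kill_last comp_mpoly1.
  rewrite /e_sym mesymSS /kill_last comp_mpolyD rmorphM /= -!/(kill_last _).
  by rewrite !kill_last_mwiden kill_last_max mulr0 addr0.
exists k.+1 => N; rewrite /e_sym mesymE; apply: (leq_trans (msize_sum _ _ _)).
by apply/bigmax_leqP => S /eqP cS; rewrite msizeX mdeg_mesym1 cS.
Qed.

(** Membership is needed because the morphism respects only the operations on [in_Lambda]. It
    follows from [eh_identity], which expresses h_m by the e_k and smaller h_k. *)
Lemma in_Lambda_h m : in_Lambda (h_sym F m).
Proof.
have [k] := ubnP m; elim: k m => // k IH [|m] lem.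
  by rewrite h_sym0; apply: in_Lambda_one.
have -> : h_sym F m.+1 =
    (fun N => (-1) *: \sum_(k < m.+1) (-1) ^+ k.+1 *: (e_sym F k.+1 N * h_sym F (m - k) N)).
  apply: functional_extensionality_dep => N; have := @eh_identity N m.+1 isT.
  rewrite big_ord_recl /= expr0 scale1r subn0 e_sym0 mul1r scaleN1r => /eqP.
  by rewrite addr_eq0 => /eqP ->; congr (- _); apply: eq_bigr.
apply: in_Lambda_scale.
apply: (@in_Lambda_sum m.+1 (fun k N => (-1) ^+ k.+1 *: (e_sym F k.+1 N * h_sym F (m - k) N))).
move=> j ltj; apply: in_Lambda_scale; apply: in_Lambda_mul; first exact: in_Lambda_e.
by apply: IH; lia.
Qed.

(** For m = 0 this fails: p_0 is the number of variables, which [kill_last] does not preserve. *)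
Lemma in_Lambda_p m : (0 < m)%N -> in_Lambda (p_sym F m).
Proof.
have [k] := ubnP m; elim: k m => // k IH [//|m] lem _.
have -> : p_sym F m.+1 = (fun N => m.+1%:R *: h_sym F m.+1 N +
    (-1) *: \sum_(k < m) p_sym F k.+1 N * h_sym F (m.+1 - k.+1) N).
  apply: functional_extensionality_dep => N; rewrite -newton_identity big_ord_recr /= subnn h_sym0 mulr1.
  by rewrite scaleN1r addrAC subrr add0r.
apply: in_Lambda_add; first exact/in_Lambda_scale/in_Lambda_h.
apply: in_Lambda_scale.
apply: (@in_Lambda_sum m (fun k N => p_sym F k.+1 N * h_sym F (m.+1 - k.+1) N)) => j ltj.
by apply: in_Lambda_mul; [apply: IH; lia | apply: in_Lambda_h].
Qed.

Section Morphism.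
Variables (V : lmodType F) (phi : polyfam F -> {linear V -> V}).
Hypothesis phiM : Lambda_morphism phi.

Lemma morphism_h0 x : phi (h_sym F 0) x = x.
Proof. by case: phiM => p1 _ _ _; rewrite h_sym0 p1. Qed.

Lemma morphism_e0 x : phi (e_sym F 0) x = x.
Proof. by case: phiM => p1 _ _ _; rewrite e_sym0 p1. Qed.

Lemma morphism_sum K (g : nat -> polyfam F) x :
  (forall k, (k < K)%N -> in_Lambda (g k)) ->
  phi (fun N => \sum_(k < K) g k N) x = \sum_(k < K) phi (g k) x.
Proof.
case: phiM => p1 pD pZ pM; elim: K => [|K IH] h.
  rewrite big_ord0; have -> : (fun N => \sum_(k < 0) g k N) = (fun N => 0 *: 1 : {mpoly F[N]}).
    by apply: functional_extensionality_dep => N; rewrite big_ord0 scale0r.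
  by rewrite pZ ?scale0r //; apply: in_Lambda_one.
have -> : (fun N => \sum_(k < K.+1) g k N) = (fun N => \sum_(k < K) g k N + g K N).
  by apply: functional_extensionality_dep => N; rewrite big_ord_recr.
rewrite pD; [|by apply: in_Lambda_sum => k lt; apply: h; apply: ltnW|exact: h].
by rewrite big_ord_recr IH // => k lt; apply: h; apply: ltnW.
Qed.

Lemma morphism_comm f g x : in_Lambda f -> in_Lambda g -> phi f (phi g x) = phi g (phi f x).
Proof.
case: phiM => _ _ _ pM fL gL; rewrite -!pM //; congr (phi _ x).
by apply: functional_extensionality_dep => N; rewrite mulrC.
Qed.

Lemma morphism_eh m x : (0 < m)%N ->
  \sum_(k < m.+1) (-1) ^+ k *: phi (e_sym F k) (phi (h_sym F (m - k)) x) = 0.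
Proof.
case: (phiM) => p1 pD pZ pM m0.
transitivity (\sum_(k < m.+1)
    phi (fun N => (-1) ^+ k *: (e_sym F k N * h_sym F (m - k) N)) x).
  apply: eq_bigr => k _; rewrite pZ; last exact: in_Lambda_mul (in_Lambda_e _) (in_Lambda_h _).
  by rewrite pM //; [apply: in_Lambda_e | apply: in_Lambda_h].
rewrite -(@morphism_sum m.+1 (fun k N => (-1) ^+ k *: (e_sym F k N * h_sym F (m - k) N))).
  have -> : (fun N => \sum_(k < m.+1) (-1) ^+ k *: (e_sym F k N * h_sym F (m - k) N)) =
      (fun N => 0 *: 1 : {mpoly F[N]}).
    by apply: functional_extensionality_dep => N; rewrite eh_identity // scale0r.
  by rewrite pZ ?scale0r //; apply: in_Lambda_one.
by move=> k _; apply/in_Lambda_scale/in_Lambda_mul; [apply: in_Lambda_e | apply: in_Lambda_h].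
Qed.

Lemma morphism_newton m x :
  \sum_(k < m) phi (p_sym F k.+1) (phi (h_sym F (m - k.+1)) x) =
  m%:R *: phi (h_sym F m) x.
Proof.
case: (phiM) => p1 pD pZ pM.
rewrite -pZ; last exact: in_Lambda_h.
transitivity (\sum_(k < m) phi (fun N => p_sym F k.+1 N * h_sym F (m - k.+1) N) x).
  by apply: eq_bigr => k _; rewrite pM //; [apply: in_Lambda_p | apply: in_Lambda_h].
rewrite -(@morphism_sum m (fun k N => p_sym F k.+1 N * h_sym F (m - k.+1) N)).
  by congr (phi _ x); apply: functional_extensionality_dep => N; rewrite newton_identity.
by move=> k _; apply: in_Lambda_mul; [apply: in_Lambda_p | apply: in_Lambda_h].
Qed.

End Morphism.
End SymmetricFunctions.

(** * The equivalences *)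

Lemma card_squares_le n (T : ribbons) : (forall R, R \in T -> #|` R| = n) ->
  (#|` squares T| <= n * #|` T|)%N.
Proof.
move=> cT; have le s : (#|` \big[fsetU/fset0]_(R <- s) (R : {fset square})| <=
    \sum_(R <- s) #|` (R : {fset square})|)%N.
  elim: s => [|R s IH]; first by rewrite !big_nil cardfs0.
  rewrite !big_cons cardfsU; apply: (leq_trans (leq_subr _ _)).
  by rewrite leq_add2l.
apply: (leq_trans (le _)); rewrite big_seq (eq_bigr (fun=> n)) //.
by rewrite -big_seq big_const_seq count_predT iter_addn addn0.
Qed.

Section Coefficients.
Variables (n : nat) (n0 : (0 < n)%N) (F : fieldType) (q : F).

Lemma psize_mono mu lam : diagram lam `<=` diagram mu -> (psize lam <= psize mu)%N.
Proof. exact: fsubset_leq_card. Qed.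

Lemma psize_union mu lam S : diagram mu = diagram lam `|` S ->
  (psize mu <= psize lam + #|` S|)%N.
Proof. by rewrite /psize => ->; rewrite cardfsU leq_subr. Qed.

(** The size bound makes the raising sums finite; the inclusion does so for the lowering sums. *)
Lemma Kcoef_neq0 mu lam k : Kcoef q n mu lam k != 0 ->
  diagram lam `<=` diagram mu /\ (psize mu <= psize lam + n * k)%N.
Proof.
rewrite KcoefE // => K0; have [[T [ad e cT]]|no] := pselect (exists T,
  strip_to n (diagram mu) (diagram lam) k T); last first.
  by rewrite strip_sum0 ?eqxx // in K0 => T sT; apply: no; exists T.
split; first by rewrite -e fsubsetUl.
apply: (leq_trans (psize_union (esym e))); rewrite leq_add2l -cT.
by apply: card_squares_le => R RT; have [] := addable_ribbon ad RT.
Qed.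

Lemma Lcoef_neq0 mu lam k : Lcoef q n mu lam k != 0 ->
  diagram lam `<=` diagram mu /\ (psize mu <= psize lam + n * k)%N.
Proof.
rewrite /Lcoef; case: pselect => [[T vT] _|_]; last by rewrite eqxx.
have [ad e cT] := (vertical_strip_ofP n mu lam k T).1 vT.
split; first by rewrite -e fsubsetUl.
apply: (leq_trans (psize_union (esym e))); rewrite leq_add2l -cT.
by apply: card_squares_le => R RT; have [] := vaddable_ribbon ad RT.
Qed.

Lemma Xcoef_neq0 mu lam k : Xcoef q n mu lam k != 0 ->
  diagram lam `<=` diagram mu /\ (psize mu <= psize lam + n * k)%N.
Proof.
move=> X0; have [[Ts [bT sT]]|no] := pselect (exists Ts,
    border_ribbon_strip n mu lam Ts /\ border_size Ts = k); last first.
  case/eqP: X0; rewrite /Xcoef fsbig1 // => Ts [bT sT].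
  by case: no; exists Ts.
have [A [Ts' [_ _ _ e]]] := (border_ribbon_stripP n0 mu lam Ts).1 bT.
split; first by rewrite e fsubsetUl.
apply: (leq_trans (psize_union e)); rewrite leq_add2l -sT.
have hT T : T \in Ts -> forall R, R \in T -> #|` R| = n.
  case: bT => _ h _ _ _ /(nthP fset0)[i lt <-] R RT.
  by have [[rT _ _ _] _] := h i lt; have [] := rT R RT.
rewrite /border_size /all_squares; elim: Ts hT {bT sT e} => [|T Ts IH] hT.
  by rewrite !big_nil cardfs0.
rewrite !big_cons cardfsU mulnDr; apply: (leq_trans (leq_subr _ _)).
apply: leq_add; first by apply: card_squares_le => R; apply: hT; apply: mem_head.
by apply: IH => T' TT'; apply: hT; rewrite inE TT' orbT.
Qed.

Lemma Kcoef_same mu : Kcoef q n mu mu 0 = 1.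
Proof.
rewrite /Kcoef; case: pselect => [e|[]].
  case: cid => T hT /=; have [_ _ /eqP] := hT; rewrite cardfs_eq0 => /eqP ->.
  by rewrite /spins big_nil expr0.
exists fset0; apply/horizontal_strip_ofP; split; rewrite ?squares_fset0 ?fsetU0 ?cardfs0 //.
split; rewrite ?squares_fset0 ?fsetU0 //; try exact: young_diagram.
  split=> //; rewrite ?squares_fset0 //.
  apply/is_skew_shapeP; exists (diagram mu), (diagram mu).
  by split; rewrite ?fsetDv //; exact: young_diagram.
by apply/fdisjointP => x _; rewrite in_fset0.
Qed.

Lemma Lcoef_same mu : Lcoef q n mu mu 0 = 1.
Proof.
rewrite /Lcoef; case: pselect => [e|[]].
  case: cid => T hT /=; have [_ _ /eqP] := hT; rewrite cardfs_eq0 => /eqP ->.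
  by rewrite /spins big_nil expr0.
exists fset0; apply/vertical_strip_ofP; split; rewrite ?squares_fset0 ?fsetU0 ?cardfs0 //.
have e0 : transposes fset0 = fset0 by apply/fsetP => R; rewrite in_transposes !in_fset0.
have y := young_transpose (@young_diagram mu); rewrite /vaddable e0.
split; rewrite ?squares_fset0 ?fsetU0 //.
  split=> //; rewrite ?squares_fset0 //.
  apply/is_skew_shapeP; exists (transpose (diagram mu)), (transpose (diagram mu)).
  by split; rewrite ?fsetDv.
by apply/fdisjointP => x _; rewrite in_fset0.
Qed.

Lemma Kcoef0 mu lam : Kcoef q n mu lam 0 = (mu == lam)%:R.
Proof.
have [->|ne] := eqVneq mu lam; first exact: Kcoef_same.
apply: contraNeq ne => /Kcoef_neq0[sub le]; apply/eqP/diagram_inj/esym/eqP.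
by rewrite eqEfcard sub; move: le; rewrite muln0 addn0.
Qed.

Lemma Lcoef0 mu lam : Lcoef q n mu lam 0 = (mu == lam)%:R.
Proof.
have [->|ne] := eqVneq mu lam; first exact: Lcoef_same.
apply: contraNeq ne => /Lcoef_neq0[sub le]; apply/eqP/diagram_inj/esym/eqP.
by rewrite eqEfcard sub; move: le; rewrite muln0 addn0.
Qed.

Lemma ext_mx0 (D : matrix_family F) lam mu : ext_mx D lam mu 0 = (lam == mu)%:R.
Proof. by []. Qed.

Definition raising (c : matrix_family F) : matrix_family F := fun lam mu => c mu lam.

(** In degree 0 [Kcoef] is already the identity matrix, as is [Lcoef]. For [Xcoef] the extension is
    a real change, since border ribbon strips are nonempty. *)
Lemma ext_K_raising lam mu k :
  ext_mx (raising (Kcoef q n)) lam mu k = Kcoef q n mu lam k.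
Proof. by rewrite /ext_mx; case: (k =P 0%N) => [->|//]; rewrite Kcoef0 eq_sym. Qed.

Lemma ext_L_raising lam mu k :
  ext_mx (raising (Lcoef q n)) lam mu k = Lcoef q n mu lam k.
Proof. by rewrite /ext_mx; case: (k =P 0%N) => [->|//]; rewrite Lcoef0 eq_sym. Qed.

Lemma ext_K lam mu k : ext_mx (Kcoef q n) lam mu k = Kcoef q n lam mu k.
Proof. by rewrite /ext_mx; case: (k =P 0%N) => [->|//]; rewrite Kcoef0. Qed.

Lemma ext_L lam mu k : ext_mx (Lcoef q n) lam mu k = Lcoef q n lam mu k.
Proof. by rewrite /ext_mx; case: (k =P 0%N) => [->|//]; rewrite Lcoef0. Qed.

Lemma bounded_lowering c :
  (forall mu lam k, c mu lam k != 0 :> F ->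
    diagram lam `<=` diagram mu /\ (psize mu <= psize lam + n * k)%N) ->
  bounded n c.
Proof. by move=> h lam mu k /h[/psize_mono le _]; apply: leq_trans le (leq_addr _ _). Qed.

Lemma bounded_raising c :
  (forall mu lam k, c mu lam k != 0 :> F ->
    diagram lam `<=` diagram mu /\ (psize mu <= psize lam + n * k)%N) ->
  bounded n (raising c).
Proof. by move=> h lam mu k /h[]. Qed.

Lemma parts_below N mu : (psize mu <= N)%N ->
  forall nu, diagram nu `<=` diagram mu -> nu \in parts N.
Proof. by move=> le nu /psize_mono le'; rewrite in_parts; apply: leq_trans le. Qed.

(** * The operator relations and the four equivalences *)

Section Equivalence.
Variables (V : lmodType F) (v : intpart -> V) (H E P : nat -> {linear V -> V}).
Hypothesis natF : forall m, (0 < m)%N -> m%:R != 0 :> F.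
Hypothesis hep : satisfy_hep_relations H E P.

Lemma rel_eh m x : (0 < m)%N ->
  \sum_(k < m.+1) (-1) ^+ k *: ext_op E k (ext_op H (m - k)%N x) = 0.
Proof.
case: hep => phi phiM rel m0; rewrite -[RHS](morphism_eh phiM x m0).
apply: eq_bigr => k _; congr (_ *: _); rewrite /ext_op.
have hE y : (if (m - k)%N == 0%N then y else H (m - k)%N y) = phi (h_sym F (m - k)) y.
  case: ((m - k)%N =P 0%N) => [->|/eqP]; first by rewrite (morphism_h0 phiM).
  by rewrite -lt0n => /rel[-> _ _].
rewrite hE; case: (nat_of_ord k =P 0%N) => [->|/eqP]; first by rewrite (morphism_e0 phiM).
by rewrite -lt0n => /rel[_ -> _].
Qed.

(** In [dual_identity] the vertical strip lies above the horizontal one, so lowering removes it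
    first: E is applied before H, while raising uses [rel_eh]. *)
Lemma rel_eh_rev m x : (0 < m)%N ->
  \sum_(k < m.+1) (-1) ^+ (m - k) *: ext_op H k (ext_op E (m - k)%N x) = 0.
Proof.
case: hep => phi phiM rel m0; rewrite -[RHS](morphism_eh phiM x m0).
rewrite [RHS](reindex_inj rev_ord_inj) /=.
apply: eq_bigr => k _; rewrite subSS subKn; last by rewrite -ltnS.
congr (_ *: _); rewrite (morphism_comm phiM) ?in_Lambda_e ?in_Lambda_h //.
  rewrite /ext_op.
  have eE y : (if (m - k)%N == 0%N then y else E (m - k)%N y) = phi (e_sym F (m - k)) y.
    case: ((m - k)%N =P 0%N) => [->|/eqP]; first by rewrite (morphism_e0 phiM).
    by rewrite -lt0n => /rel[_ -> _].
  rewrite eE; case: (nat_of_ord k =P 0%N) => [->|/eqP]; first by rewrite (morphism_h0 phiM).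
  by rewrite -lt0n => /rel[-> _ _].
- exact: in_Lambda_e.
exact: in_Lambda_h.
Qed.

(** In [murnaghan_identity] the border strip lies below the horizontal strip. Lowering therefore
    applies H before P, as here, and raising uses [rel_ph_rev]. *)
Lemma rel_ph m x : (0 < m)%N ->
  \sum_(k < m.+1) (if k == 0%N :> nat then - m%:R else 1) *:
    ext_op P k (ext_op H (m - k)%N x) = 0.
Proof.
case: hep => phi phiM rel m0.
rewrite big_ord_recl /= subn0 /ext_op /= gtn_eqF // (eq_bigr (fun k : 'I_m =>
  phi (p_sym F k.+1) (phi (h_sym F (m - k.+1)) x))).
  rewrite (morphism_newton phiM) scaleNr addrC.
  by have [-> _ _] := rel m m0; rewrite subrr.
move=> k _; rewrite scale1r /bump add1n; have [_ _ <-] := rel k.+1 isT.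
congr (phi _ _); case: ((m - k.+1)%N =P 0%N) => [->|/eqP]; first by rewrite (morphism_h0 phiM).
by rewrite -lt0n => /rel[-> _ _].
Qed.

Lemma rel_ph_rev m x : (0 < m)%N ->
  \sum_(k < m.+1) (if k == m :> nat then - m%:R else 1) *:
    ext_op H k (ext_op P (m - k)%N x) = 0.
Proof.
case: hep => phi phiM rel m0.
rewrite big_ord_recr /= eqxx subnn /ext_op /= gtn_eqF // (eq_bigr (fun k : 'I_m =>
  phi (p_sym F (m - k)) (phi (h_sym F k) x))); last first.
  move=> k _; rewrite (ltn_eqF (ltn_ord k)) scale1r.
  have mk : (0 < m - k)%N by rewrite subn_gt0.
  rewrite (gtn_eqF mk) (morphism_comm phiM x (in_Lambda_p F mk) (in_Lambda_h F k)).
  have [_ _ ->] := rel _ mk.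
  case: (nat_of_ord k =P 0%N) => [->|/eqP]; first by rewrite (morphism_h0 phiM).
  by rewrite -lt0n => /rel[-> _ _].
have [<- _ _] := rel m m0; rewrite scaleNr -(morphism_newton phiM) (reindex_inj rev_ord_inj) /=.
apply/eqP; rewrite subr_eq0; apply/eqP; apply: eq_bigr => k _.
by rewrite subKn.
Qed.

Lemma natF_c m : (0 < m)%N -> - m%:R != 0 :> F.
Proof. by move=> m0; rewrite oppr_eq0 natF. Qed.

Lemma pieri_raising_dual :
  raising_rule (Kcoef q n) v H <-> raising_rule (Lcoef q n) v E.
Proof.
have bK := bounded_raising Kcoef_neq0; have bL := bounded_raising Lcoef_neq0.
have mx m lam mu N : (0 < m)%N -> (psize lam <= N)%N -> (psize mu <= N)%N ->
    \sum_(k < m.+1) (-1) ^+ k * (\sum_(nu <- parts N)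
      ext_mx (raising (Kcoef q n)) lam nu (m - k)%N * ext_mx (raising (Lcoef q n)) nu mu k) = 0.
  move=> m0 _ lemu; rewrite -[RHS](@dual_identity n n0 F q mu lam m (parts N)) //.
  - apply: eq_bigr => k _; congr (_ * _); apply: eq_bigr => nu _.
    by rewrite ext_K_raising ext_L_raising mulrC.
  - exact: parts_uniq.
  - exact: parts_below.
have c0 m : (-1) ^+ m != 0 :> F by rewrite signr_eq0.
split=> r k lam k0; move: k k0 lam.
  apply: (determine_right bK bL (c := fun _ k => (-1) ^+ k) rel_eh mx) => // k k0 lam.
  exact: r.
apply: (determine_left bK bL (c := fun _ k => (-1) ^+ k) rel_eh mx) => // k k0 lam.
exact: r.
Qed.

Lemma pieri_lowering_dual :
  lowering_rule (Kcoef q n) v H <-> lowering_rule (Lcoef q n) v E.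
Proof.
have bK := bounded_lowering Kcoef_neq0; have bL := bounded_lowering Lcoef_neq0.
have mx m lam mu N : (0 < m)%N -> (psize lam <= N)%N -> (psize mu <= N)%N ->
    \sum_(k < m.+1) (-1) ^+ (m - k) * (\sum_(nu <- parts N)
      ext_mx (Lcoef q n) lam nu (m - k)%N * ext_mx (Kcoef q n) nu mu k) = 0.
  move=> m0 lelam _; rewrite -[RHS](@dual_identity n n0 F q lam mu m (parts N)) //.
  - rewrite [RHS](reindex_inj rev_ord_inj) /=; apply: eq_bigr => k _.
    rewrite subSS; congr (_ * _); apply: eq_bigr => nu _.
    by rewrite ext_K ext_L subKn // -ltnS.
  - exact: parts_uniq.
  - exact: parts_below.
have c0 m : (-1) ^+ m != 0 :> F by rewrite signr_eq0.
split=> r k lam k0; move: k k0 lam.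
  apply: (determine_left bL bK (c := fun m k => (-1) ^+ (m - k)) rel_eh_rev mx) => // k k0 lam.
  exact: r.
apply: (determine_right bL bK (c := fun m k => (-1) ^+ (m - k)) rel_eh_rev mx) => // k k0 lam.
exact: r.
Qed.

Lemma pieri_raising_murnaghan :
  raising_rule (Kcoef q n) v H <-> raising_rule (Xcoef q n) v P.
Proof.
have bK := bounded_raising Kcoef_neq0; have bX := bounded_raising Xcoef_neq0.
have mx m lam mu N : (0 < m)%N -> (psize lam <= N)%N -> (psize mu <= N)%N ->
    \sum_(k < m.+1) (if k == m :> nat then - m%:R else 1) * (\sum_(nu <- parts N)
      ext_mx (raising (Xcoef q n)) lam nu (m - k)%N * ext_mx (raising (Kcoef q n)) nu mu k) = 0.
  move=> m0 lelam lemu; rewrite big_ord_recr /= eqxx subnn.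
  rewrite (bigD1_seq lam) ?parts_uniq ?in_parts //= ext_mx0 eqxx mul1r.
  rewrite ext_K_raising [X in _ * (_ + X)]big1 ?addr0; last first.
    by move=> nu ne; rewrite ext_mx0 eq_sym (negbTE ne) mul0r.
  rewrite mulNr -(@murnaghan_identity n n0 F q mu lam m (parts N)); first last.
  - exact: parts_below.
  - exact: parts_uniq.
  apply/eqP; rewrite subr_eq0; apply/eqP; rewrite [RHS](reindex_inj rev_ord_inj) /=.
  apply: eq_bigr => k _; rewrite (ltn_eqF (ltn_ord k)) mul1r; apply: eq_bigr => nu _.
  rewrite ext_K_raising subnSK // subKn; last exact: ltnW.
  by rewrite /ext_mx gtn_eqF ?subn_gt0.
have cr m : (0 < m)%N -> (if m == m then - m%:R else 1) != 0 :> F.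
  by rewrite eqxx; apply: natF_c.
have cl m : (0 < m)%N -> (if 0%N == m then - m%:R else 1) != 0 :> F.
  by move=> m0; rewrite ltn_eqF // oner_neq0.
split=> r k lam k0; move: k k0 lam.
  apply: (determine_left bX bK (c := fun m k => if k == m then - m%:R else 1) rel_ph_rev mx) => // k k0 lam.
  exact: r.
apply: (determine_right bX bK (c := fun m k => if k == m then - m%:R else 1) rel_ph_rev mx) => // k k0 lam.
exact: r.
Qed.

Lemma pieri_lowering_murnaghan :
  lowering_rule (Kcoef q n) v H <-> lowering_rule (Xcoef q n) v P.
Proof.
have bK := bounded_lowering Kcoef_neq0; have bX := bounded_lowering Xcoef_neq0.
have mx m lam mu N : (0 < m)%N -> (psize lam <= N)%N -> (psize mu <= N)%N ->
    \sum_(k < m.+1) (if k == 0%N :> nat then - m%:R else 1) * (\sum_(nu <- parts N)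
      ext_mx (Kcoef q n) lam nu (m - k)%N * ext_mx (Xcoef q n) nu mu k) = 0.
  move=> m0 lelam lemu; rewrite big_ord_recl /= subn0.
  rewrite (bigD1_seq mu) ?parts_uniq ?in_parts //= ext_mx0 eqxx mulr1.
  rewrite ext_K [X in _ * (_ + X)]big1 ?addr0; last first.
    by move=> nu ne; rewrite ext_mx0 (negbTE ne) mulr0.
  rewrite mulNr -(@murnaghan_identity n n0 F q lam mu m (parts N)); first last.
  - exact: parts_below.
  - exact: parts_uniq.
  rewrite addrC; apply/eqP; rewrite subr_eq0; apply/eqP.
  apply: eq_bigr => k _; rewrite mul1r /bump add1n; apply: eq_bigr => nu _.
  by rewrite ext_K mulrC.
have cl m : (0 < m)%N -> (if 0%N == 0%N then - m%:R else 1) != 0 :> F.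
  by rewrite eqxx; apply: natF_c.
have cr m : (0 < m)%N -> (if m == 0%N then - m%:R else 1) != 0 :> F.
  by move=> m0; rewrite gtn_eqF // oner_neq0.
split=> r k lam k0; move: k k0 lam.
  apply: (determine_right bK bX (c := fun m k => if k == 0%N then - m%:R else 1) rel_ph mx) => // k k0 lam.
  exact: r.
apply: (determine_left bK bX (c := fun m k => if k == 0%N then - m%:R else 1) rel_ph mx) => // k k0 lam.
exact: r.
Qed.

End Equivalence.
End Coefficients.

From mathcomp Require Import complex.

Lemma natr_Cq_neq0 (R : realType) m : (0 < m)%N -> m%:R != 0 :> Cq R.
Proof.
move=> m0; have -> : m%:R = tofrac (m%:R : {poly R[i]}) by rewrite rmorph_nat.
by rewrite tofrac_eq0 -polyC_natr polyC_eq0 pnatr_eq0 -lt0n.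
Qed.

Local Close Scope ring_scope.

Theorem theorem54 (R : realType) (n : nat) (n_ge1 : (1 <= n)%N)
    (V : lmodType (Cq R)) (v : intpart -> V) :
  (forall H E P : nat -> {linear V -> V},
     commuting_operators H E P -> satisfy_hep_relations H E P ->
     let pieri := raising_rule (Kcoef (qvar R) n) v H in
     let dual_pieri := raising_rule (Lcoef (qvar R) n) v E in
     let murnaghan_nakayama := raising_rule (Xcoef (qvar R) n) v P in
     pieri \/ dual_pieri \/ murnaghan_nakayama ->
     pieri /\ dual_pieri /\ murnaghan_nakayama) /\
  (forall Hperp Eperp Pperp : nat -> {linear V -> V},
     commuting_operators Hperp Eperp Pperp ->
     satisfy_hep_relations Hperp Eperp Pperp ->
     let pieri := lowering_rule (Kcoef (qvar R) n) v Hperp in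
     let dual_pieri := lowering_rule (Lcoef (qvar R) n) v Eperp in
     let murnaghan_nakayama := lowering_rule (Xcoef (qvar R) n) v Pperp in
     pieri \/ dual_pieri \/ murnaghan_nakayama ->
     pieri /\ dual_pieri /\ murnaghan_nakayama).
Proof.
split=> H E P _ hep /=.
  have HE := pieri_raising_dual n_ge1 (qvar R) v hep.
  have HP := pieri_raising_murnaghan n_ge1 (qvar R) v (@natr_Cq_neq0 R) hep.
  by move=> [h|[/HE h|/HP h]]; do ![split] => //; [exact/HE|exact/HP|exact/HE|exact/HP|exact/HE|exact/HP].
have HE := pieri_lowering_dual n_ge1 (qvar R) v hep.
have HP := pieri_lowering_murnaghan n_ge1 (qvar R) v (@natr_Cq_neq0 R) hep.
by move=> [h|[/HE h|/HP h]]; do ![split] => //; [exact/HE|exact/HP|exact/HE|exact/HP|exact/HE|exact/HP].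
Qed.
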